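(* Let $f(z,w)=(p(z),q(z,w))$ be an Axiom A polynomial skew product of $\mathbb{C}^2$. Then $$\Lambda = A_{pt}(C_{J_p}) \subseteq A_{cc}(C_{J_p}) \subseteq A(C_{J_p}) = W^u(\Lambda)\cap (J_p\times\mathbb{C}).$$
   Context: A polynomial skew product of $\mathbb{C}^2$ is a map $f(z,w)=(p(z),q(z,w))$, with $p,q$ polynomials, that extends holomorphically to an endomorphism of $\mathbb{P}^2$ of degree $d\ge 2$ (so $p$ and $q$ both have degree $d$). Write $q_z(w)=q(z,w)$ and $Q_z^n=q_{p^{n-1}(z)}\circ\cdots\circ q_{p(z)}\circ q_z$. $K_p$ and $J_p=\partial K_p$ are the filled Julia set and Julia set of $p$; $A_p$ is the finite set of attracting periodic points of $p$ in $\mathbb{C}$. $K=\{x\in\mathbb{C}^2:\sup_n\|f^n(x)\|<\infty\}$, $K_z=K\cap(\{z\}\times\mathbb{C})$, and $J_z=\partial K_z$ (boundary in $\{z\}\times\mathbb{C}$). Vertical expansion: for a compact $Z\subseteq K_p$ with $p(Z)\subseteq Z$, $f$ is vertically expanding over $Z$ if there are $c>0$, $L>1$ with $|(Q_z^n)'(w)|\ge cL^n$ for all $z\in Z$, $w\in J_z$, $n\ge1$. Axiom A: (by a characterization of Jonsson, used as the definition) $f$ is Axiom A on $\mathbb{C}^2$ iff (i) $p$ is hyperbolic (expanding on $J_p$), (ii) $f$ is vertically expanding over $J_p$, and (iii) $f$ is vertically expanding over $A_p$. $\Lambda$: the union of the basic sets of saddle type of $f$ contained in $J_p\times\mathbb{C}$;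 equivalently, the closure of the set of saddle periodic points $(z,w)$ of $f$ with $z\in J_p$ (points with $f^n(z,w)=(z,w)$ for some $n\ge1$, $z\in J_p$, $|(Q_z^n)'(w)|<1$). $W^u(\Lambda)$: the set of all $x\in\mathbb{C}^2$ for which there is a backward orbit $x_0=x$, $f(x_{-k})=x_{-k+1}$ for $k \geq 1$, with $x_{-k}\to\Lambda$ as $k\to\infty$. Critical locus over $J_p$: $C_{J_p}=\{(z,c): z\in J_p,\ q_z'(c)=0\}$. For $X\subseteq\mathbb{C}^2$ the accumulation set is $A(X)=\bigcap_{N\ge0}\overline{\bigcup_{n\ge N}f^n(X)}$ (closure in $\mathbb{C}^2$); for a point $x$, $A(x)=A(\{x\})$. Set $A_{pt}(C_{J_p})=\overline{\bigcup_{x\in C_{J_p}}A(x)}$ and $A_{cc}(C_{J_p})=\overline{\bigcup_{C}A(C)}$, the latter union over all connected components $C$ of $C_{J_p}$. *)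

(* Defs.v *)
From HB Require Import structures.
From mathcomp Require Import all_boot all_order all_algebra.
From mathcomp Require Import complex.
From mathcomp Require Import boolp classical_sets functions reals.
From mathcomp Require Import topology normedtype sequences.

Set Implicit Arguments.
Unset Strict Implicit.
Unset Printing Implicit Defensive.
Import Order.TTheory GRing.Theory Num.Theory.
Import numFieldNormedType.Exports.
Local Open Scope classical_set_scope.
Local Open Scope complex_scope.
Local Open Scope ring_scope.

(* The field R[i], sealed under a numClosedFieldType-valued constant so that it
   carries the topology and norm that MathComp-Analysis puts on every such
   field; the product Cplx R * Cplx R is C^2, with the sup norm. *)
Definition Cplx (R : realType) : numClosedFieldType := R[i].

Definition boundary (T : topologicalType) (A : set T) : set T :=
  closure A `\` interior A.

Definition poly_iter (R : realType) (p : {poly Cplx R}) (n : nat) :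
    {poly Cplx R} :=
  iter n (fun r => p \Po r) 'X.

Definition filled_julia (R : realType) (p : {poly Cplx R}) : set (Cplx R) :=
  [set z | bounded_fun (fun n : nat => iter n (horner p) z)].

Definition julia (R : realType) (p : {poly Cplx R}) : set (Cplx R) :=
  boundary (filled_julia p).

Definition attracting_periodic (R : realType) (p : {poly Cplx R}) :
    set (Cplx R) :=
  [set z | exists n, [/\ (0 < n)%N, iter n (horner p) z = z &
     `|((poly_iter p n)^`()).[z]| < 1]].

Definition hyperbolic (R : realType) (p : {poly Cplx R}) : Prop :=
  exists c L : R, [/\ 0 < c, 1 < L & forall (z : Cplx R) (n : nat),
    julia p z -> (0 < n)%N ->
    (c * L ^+ n)%:C <= `|((poly_iter p n)^`()).[z]|].

(* The outer variable of q is w and its coefficients are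
   polynomials in z, so that q(z,w) = (fiber q z).[w]. *)

Definition fiber (R : realType) (q : {poly {poly Cplx R}}) (z : Cplx R) :
    {poly Cplx R} :=
  map_poly (horner_eval z) q.

Definition skew_map (R : realType) (p : {poly Cplx R}) (q : {poly {poly Cplx R}})
    (x : Cplx R * Cplx R) : Cplx R * Cplx R :=
  (p.[x.1], (fiber q x.1).[x.2]).

(* Q_z^n as a polynomial in w *)
Fixpoint fiber_iter (R : realType) (p : {poly Cplx R})
    (q : {poly {poly Cplx R}}) (z : Cplx R) (n : nat) : {poly Cplx R} :=
  if n is m.+1 then fiber q (iter m (horner p) z) \Po fiber_iter p q z m
  else 'X.

(* The value at (x, y, t) of the homogeneous polynomial of degree d whose
   coefficient at x^i y^j t^(d-i-j) is a i j. *)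
Definition form3 (R : realType) (d : nat) (a : nat -> nat -> Cplx R)
    (x y t : Cplx R) : Cplx R :=
  \sum_(i < d.+1) \sum_(j < d.+1 | (i + j <= d)%N)
    a i j * x ^+ i * y ^+ j * t ^+ (d - i - j).

(* A holomorphic endomorphism of P^2 of degree d is [F0 : F1 : F2] with F0, F1,
   F2 homogeneous of degree d and without common zero besides the origin; it
   extends g when it sends [z : w : 1] to [g(z,w) : 1]. *)
Definition extends_to_P2 (R : realType) (d : nat)
    (g : Cplx R * Cplx R -> Cplx R * Cplx R) : Prop :=
  exists a0 a1 a2 : nat -> nat -> Cplx R,
    (forall x y t : Cplx R,
       form3 d a0 x y t = 0 -> form3 d a1 x y t = 0 ->
       form3 d a2 x y t = 0 -> [/\ x = 0, y = 0 & t = 0]) /\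
    (forall z w : Cplx R,
       [/\ form3 d a2 z w 1 != 0,
           form3 d a0 z w 1 = (g (z, w)).1 * form3 d a2 z w 1 &
           form3 d a1 z w 1 = (g (z, w)).2 * form3 d a2 z w 1]).

Definition skew_product (R : realType) (d : nat) (p : {poly Cplx R})
    (q : {poly {poly Cplx R}}) : Prop :=
  (2 <= d)%N /\ extends_to_P2 d (skew_map p q).

Definition filled_julia2 (R : realType) (p : {poly Cplx R})
    (q : {poly {poly Cplx R}}) : set (Cplx R * Cplx R) :=
  [set x | bounded_fun (fun n : nat => iter n (skew_map p q) x)].

Definition fiber_julia (R : realType) (p : {poly Cplx R})
    (q : {poly {poly Cplx R}}) (z : Cplx R) : set (Cplx R) :=
  boundary [set w | filled_julia2 p q (z, w)].

(* Only meaningful for Z compact, contained in K_p and forward invariant; it is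
   used below for the Julia set and the attracting periodic points of p. *)
Definition vertically_expanding (R : realType) (p : {poly Cplx R})
    (q : {poly {poly Cplx R}}) (Z : set (Cplx R)) : Prop :=
  exists c L : R, [/\ 0 < c, 1 < L & forall (z w : Cplx R) (n : nat),
    Z z -> fiber_julia p q z w -> (0 < n)%N ->
    (c * L ^+ n)%:C <= `|((fiber_iter p q z n)^`()).[w]|].

Definition axiomA (R : realType) (p : {poly Cplx R})
    (q : {poly {poly Cplx R}}) : Prop :=
  [/\ hyperbolic p,
      vertically_expanding p q (julia p) &
      vertically_expanding p q (attracting_periodic p)].

(* Lambda, the union of the saddle basic sets over J_p, as the closure of the
   saddle periodic points there. When p is expanding on J_p, a periodic point
   over J_p is a saddle exactly when its vertical multiplier has modulus < 1. *)
Definition saddle_set (R : realType) (p : {poly Cplx R})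
    (q : {poly {poly Cplx R}}) : set (Cplx R * Cplx R) :=
  closure [set x | julia p x.1 /\ exists n, [/\ (0 < n)%N,
    iter n (skew_map p q) x = x & `|((fiber_iter p q x.1 n)^`()).[x.2]| < 1]].

(* Convergence to S means that the distance to S tends to 0; nothing converges
   to the empty set. *)
Definition unstable_set (R : realType)
    (g : Cplx R * Cplx R -> Cplx R * Cplx R) (S : set (Cplx R * Cplx R)) :
    set (Cplx R * Cplx R) :=
  [set x | exists u : nat -> Cplx R * Cplx R,
    [/\ u 0%N = x, forall k, g (u k.+1) = u k &
        forall e : R, 0 < e ->
          \forall k \near \oo, exists2 y, S y & ball y e%:C (u k)]].

Definition critical_locus (R : realType) (p : {poly Cplx R})
    (q : {poly {poly Cplx R}}) : set (Cplx R * Cplx R) :=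
  [set x | julia p x.1 /\ ((fiber q x.1)^`()).[x.2] = 0].

Definition accum (T : topologicalType) (g : T -> T) (X : set T) : set T :=
  \bigcap_(N in [set: nat])
    closure (\bigcup_(n in [set n | (N <= n)%N]) (iter n g @` X)).

Definition accum_pt (T : topologicalType) (g : T -> T) (X : set T) : set T :=
  closure (\bigcup_(x in X) accum g [set x]).

Definition accum_cc (T : topologicalType) (g : T -> T) (X : set T) : set T :=
  closure (\bigcup_(x in X) accum g (connected_component X x)).

(* Main.v *)
(* Let J be the union of the fibre Julia sets J_z over J_p, and F = f^m with
   vertical derivative at least 4 on J. Choosing the nearest root of
   Q_z^m = v shows that a point whose F-image is t-close to J is t/2-close to J;
   so orbits starting away from J, in particular critical orbits, stay away from
   J. On such points x of K the map F sends a disc of K to a disc of K lying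
   strictly deeper, and composing with small dilations centred at the orbit of x
   improves the Cauchy estimate exponentially: f contracts vertically along the
   orbit, uniformly and robustly in the base point. With the expansion of p on
   J_p this gives a closing lemma: an almost closed orbit segment near such
   points is shadowed by a saddle periodic point. Hence the orbit of a critical
   point in K accumulates on Lambda only.

   Conversely a saddle periodic point attracts a critical point (Fatou): a
   polynomial T with T(w) = 0 and no critical point in {|T| <= rho} has an
   isolated sheet around w, and the minimum principle for T/(X - w) there bounds
   T'(w) from below, which fails for T = Q_z^n - w with n a large multiple of
   the period.

   A point y of A(C) has a bounded backward orbit in A(C). The limit points of
   that orbit have bounded forward orbits, and they are not in J because
   z |-> J_z is lower semicontinuous; so the closing lemma applies to them and
   they lie in Lambda. Lower semicontinuity is the harmonicity of the Green
   function on a disc that escapes completely, in the form of the product formula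
   for a zero-free polynomial at the vertices of a regular polygon. Finally, for
   x in W^u(Lambda) over J_p, a critical orbit close to Lambda is moved into the
   fibre of a backward image of x and contracted towards x. *)

Require Import Defs.
From HB Require Import structures.
From mathcomp Require Import all_boot all_order all_algebra.
From mathcomp Require Import cyclic separable cyclotomic.
From mathcomp Require Import complex ring lra zify.
From mathcomp Require Import boolp classical_sets functions reals.
From mathcomp Require Import topology normedtype sequences.
Import Order.TTheory GRing.Theory Num.Theory.
Import numFieldNormedType.Exports.
Local Open Scope classical_set_scope.
Local Open Scope ring_scope.
Set Implicit Arguments.
Unset Strict Implicit.
Unset Printing Implicit Defensive.

(** * Modulus, topology and compactness of the complex plane *)

(** Every analytic tool appears in a form that speaks of polynomials alone: Cauchy's estimate is an
    average over roots of unity, openness is the nearest-root bound [root_near], the Green function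
    is replaced by two-sided growth bounds for iterates, and the dilations play the part of the
    hyperbolic metric. Degree and leading coefficient of a fibre iterate do not depend on the base
    point, so these estimates are uniform in [z].

    The obstacle is that the fibre changes along an orbit: there is no fixed domain for a normal
    family or a Schwarz lemma, and a shadowing orbit lives over other base points than the orbit it
    follows. Hence contraction is first obtained as a number, [1 / 4] after [N] steps, and then
    thickened to [1 / 2] on a neighbourhood, in the base direction as well. The same [N] expands by
    4 on [J_p], of which the Taylor error leaves 2. Closing an orbit is then a pair of fixed point
    problems with ratio [1 / 2], backwards in the base and forwards in the fibre, with a tolerance
    independent of the length of the segment. *)

Section Modulus.
Variable R : realType.
Implicit Types x y : Cplx R.

(** The norm of [Cplx R] takes its values in [Cplx R] itself; its real part turns the estimates into
    inequalities over [R], within reach of [lra]. *)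
Definition cabs (x : Cplx R) : R := complex.Re `|x|.

Lemma cabsE x : `|x| = (cabs x)%:C%C.
Proof. by rewrite /cabs normc_def. Qed.

Lemma cabs_sqrt x :
  cabs x = Num.sqrt (complex.Re x ^+ 2 + complex.Im x ^+ 2).
Proof. by rewrite /cabs normc_def. Qed.

Lemma cabs_ge0 x : 0 <= cabs x.
Proof. by rewrite cabs_sqrt sqrtr_ge0. Qed.

Lemma cabs0 : cabs 0 = 0.
Proof. by rewrite /cabs normr0. Qed.

Lemma cabs1 : cabs 1 = 1.
Proof. by rewrite /cabs normr1. Qed.

Lemma cabsM x y : cabs (x * y) = cabs x * cabs y.
Proof. by apply: complexI; rewrite rmorphM /= -!cabsE normrM. Qed.

Lemma cabsX x n : cabs (x ^+ n) = cabs x ^+ n.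
Proof. by elim: n => [|n IH]; rewrite ?expr0 ?cabs1 // !exprS cabsM IH. Qed.

Lemma cabsN x : cabs (- x) = cabs x.
Proof. by rewrite /cabs normrN. Qed.

Lemma cabsB x y : cabs (x - y) = cabs (y - x).
Proof. by rewrite -cabsN opprB. Qed.

Lemma cabsD x y : cabs (x + y) <= cabs x + cabs y.
Proof. by rewrite -lecR rmorphD /= -!cabsE; exact: ler_normD. Qed.

Lemma cabs_eq0 x : (cabs x == 0) = (x == 0).
Proof. by rewrite -(inj_eq (@complexI R)) -cabsE normr_eq0. Qed.

Lemma cabs_gt0 x : (0 < cabs x) = (x != 0).
Proof. by rewrite lt0r cabs_eq0 cabs_ge0 andbT. Qed.

Lemma cabs_real (r : R) : 0 <= r -> cabs (r%:C%C : Cplx R) = r.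
Proof. by move=> r0; apply: complexI; rewrite -cabsE ger0_norm ?ler0c. Qed.

Lemma cabs_tri (a x y : Cplx R) : cabs (x - y) <= cabs (x - a) + cabs (a - y).
Proof. by rewrite -[x - y](subrKA a); exact: cabsD. Qed.

Lemma cabs_le_add x y : cabs x <= cabs y + cabs (x - y).
Proof. by rewrite -{1}[x](subrKC y); exact: cabsD. Qed.

Lemma cabs_sum I (r : seq I) (P : pred I) (F : I -> Cplx R) :
  cabs (\sum_(i <- r | P i) F i) <= \sum_(i <- r | P i) cabs (F i).
Proof.
elim/big_rec2 : _ => [|i y x _ h]; first by rewrite cabs0.
by apply: le_trans (cabsD _ _) _; rewrite lerD2l.
Qed.

Lemma cabs_prod I (r : seq I) (P : pred I) (F : I -> Cplx R) :
  cabs (\prod_(i <- r | P i) F i) = \prod_(i <- r | P i) cabs (F i).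
Proof. exact: (big_morph cabs cabsM cabs1). Qed.

Lemma cabs_le_ReIm x : cabs x <= `|complex.Re x| + `|complex.Im x|.
Proof.
have le_sqr (s : R) : 0 <= s -> complex.Re x ^+ 2 + complex.Im x ^+ 2 <= s ^+ 2 -> cabs x <= s.
  by move=> s0 h; rewrite cabs_sqrt -[s]ger0_norm // -(sqrtr_sqr s) ler_wsqrtr.
apply: le_sqr; rewrite ?addr_ge0 //.
rewrite sqrrD !real_normK ?num_real //.
have := mulr_ge0 (normr_ge0 (complex.Re x)) (normr_ge0 (complex.Im x)).
by set a := (_ * _); set b := _ ^+ 2; set c := _ ^+ 2; lra.
Qed.

Lemma cabs_ge_Re x : `|complex.Re x| <= cabs x.
Proof.
by rewrite cabs_sqrt -(sqrtr_sqr (complex.Re x)) ler_wsqrtr // lerDl sqr_ge0.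
Qed.

Lemma cabs_ge_Im x : `|complex.Im x| <= cabs x.
Proof.
by rewrite cabs_sqrt -(sqrtr_sqr (complex.Im x)) ler_wsqrtr // lerDr sqr_ge0.
Qed.

End Modulus.

Section Topology.
Variable R : realType.

Lemma posC_real (e : Cplx R) : 0 < e -> exists2 r : R, 0 < r & e = r%:C%C.
Proof.
case: e => a b; rewrite ltcE /= => /andP[/eqP -> a0].
by exists a.
Qed.

Lemma nbhs_cplx (x : Cplx R) (A : set (Cplx R)) :
  nbhs x A <-> exists2 e : R, 0 < e & forall y, cabs (x - y) < e -> A y.
Proof.
split.
  move=> /nbhs_ballP[e /= /posC_real[r r0 ->] sub].
  by exists r => // y xy; apply: sub; rewrite /ball /= /ball_ cabsE ltcR.
move=> [e e0 sub]; apply/nbhs_ballP; exists (e%:C%C); first by rewrite /= ltcR.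
by move=> y; rewrite /ball /= /ball_ cabsE ltcR; exact: sub.
Qed.

Definition near2 (e : R) (x y : Cplx R * Cplx R) : Prop :=
  cabs (x.1 - y.1) < e /\ cabs (x.2 - y.2) < e.

Lemma ball_cplx2 (x y : Cplx R * Cplx R) (e : R) :
  ball x (e%:C%C : Cplx R) y <-> near2 e x y.
Proof.
by rewrite /ball /= /prod_ball /= /ball /= /ball_ !cabsE !ltcR; split.
Qed.

Lemma nbhs_cplx2 (x : Cplx R * Cplx R) (A : set (Cplx R * Cplx R)) :
  nbhs x A <-> exists2 e : R, 0 < e & forall y, near2 e x y -> A y.
Proof.
split.
  move=> /nbhs_ballP[e /= /posC_real[r r0 ->] sub].
  by exists r => // y xy; apply: sub; apply/ball_cplx2.
move=> [e e0 sub]; apply/nbhs_ballP; exists (e%:C%C); first by rewrite /= ltcR.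
by move=> y /ball_cplx2; exact: sub.
Qed.

Lemma closure_cplx (A : set (Cplx R)) x :
  closure A x <-> forall e : R, 0 < e -> exists2 y, A y & cabs (x - y) < e.
Proof.
split=> [cl e e0|h B /nbhs_cplx[e e0 sub]].
  have nb : nbhs x [set y | cabs (x - y) < e] by apply/nbhs_cplx; exists e.
  by have [y [Ay By]] := cl _ nb; exists y.
by have [y Ay xy] := h e e0; exists y; split=> //; exact: sub.
Qed.

Lemma closure_cplx2 (A : set (Cplx R * Cplx R)) x :
  closure A x <-> forall e : R, 0 < e -> exists2 y, A y & near2 e x y.
Proof.
split=> [cl e e0|h B /nbhs_cplx2[e e0 sub]].
  have nb : nbhs x [set y | near2 e x y] by apply/nbhs_cplx2; exists e.
  by have [y [Ay By]] := cl _ nb; exists y.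
by have [y Ay xy] := h e e0; exists y; split=> //; exact: sub.
Qed.

Lemma near2_sym (e : R) x y : near2 e x y -> near2 e y x.
Proof. by case=> h1 h2; split; rewrite cabsB. Qed.

Lemma near2_tri (e1 e2 : R) x y z :
  near2 e1 x y -> near2 e2 y z -> near2 (e1 + e2) x z.
Proof.
move=> [a b] [c e]; split.
  by apply: le_lt_trans (cabs_tri y.1 _ _) (ltrD _ _).
by apply: le_lt_trans (cabs_tri y.2 _ _) (ltrD _ _).
Qed.

Lemma near2_le (e1 e2 : R) x y : e1 <= e2 -> near2 e1 x y -> near2 e2 x y.
Proof. by move=> e12 [a b]; split; apply: lt_le_trans e12. Qed.

Lemma near2_half (e : R) x y z :
  near2 (e / 2) x y -> near2 (e / 2) y z -> near2 e x z.
Proof. by move=> h k; have := near2_tri h k; rewrite -splitr. Qed.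

Lemma near2_refl (e : R) x : 0 < e -> near2 e x x.
Proof. by move=> e0; split; rewrite subrr cabs0. Qed.

Lemma bounded_cplx (u : nat -> Cplx R) :
  bounded_fun u <-> exists M : R, forall n, cabs (u n) <= M.
Proof.
split.
  move=> [M [Mr h]].
  have /complex_realP[m Mm] := Mr.
  exists (m + 1) => n.
  rewrite -lecR -cabsE; apply: (h ((m + 1)%:C%C)) => //.
  by rewrite Mm ltcR ltrDl.
move=> [M h]; exists (M%:C%C); split; first by apply/complex_realP; exists M.
move=> x Mx n _ /=; rewrite (le_trans _ (ltW Mx)) // cabsE lecR.
exact: h.
Qed.

Lemma bounded_cplx2 (u : nat -> Cplx R * Cplx R) :
  bounded_fun u <->
  exists M : R, forall n, cabs (u n).1 <= M /\ cabs (u n).2 <= M.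
Proof.
split.
  move=> [M [Mr h]].
  have /complex_realP[m Mm] := Mr.
  exists (m + 1) => n.
  have Mm1 : M < (m + 1)%:C%C by rewrite Mm ltcR ltrDl.
  have := h _ Mm1 n I; rewrite /= prodnormedzmodule.ProdNormedZmodule.prod_normE !cabsE.
  by rewrite maxEle; case: ifP; rewrite !lecR => h1 h2; split=> //;
     [exact: le_trans h2|move/negbT: h1; rewrite -ltNge => /ltW/le_trans; apply].
move=> [M h]; exists (M%:C%C); split; first by apply/complex_realP; exists M.
move=> x Mx n _ /=; rewrite (le_trans _ (ltW Mx)) // prodnormedzmodule.ProdNormedZmodule.prod_normE !cabsE.
by case: (h n) => h1 h2; rewrite maxEle; case: ifP => _; rewrite lecR.
Qed.

End Topology.

Section RealFacts.
Variable R : realType.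

Lemma nat_above (M : R) : exists n : nat, M < n%:R.
Proof.
exists (Num.bound `|M|); apply: le_lt_trans (ler_norm M) _.
by apply: archi_boundP.
Qed.

Lemma inv_small (e : R) : 0 < e ->
  exists n : nat, forall k, (n <= k)%N -> k.+1%:R^-1 < e.
Proof.
move=> e0; have [n hn] := nat_above e^-1; exists n => k nk.
rewrite -[e]invrK ltf_pV2 ?posrE ?invr_gt0 ?ltr0n //.
by apply: lt_trans hn _; rewrite ltr_nat ltnS.
Qed.

Lemma bernoulli (h : R) n : 0 <= h -> 1 + n%:R * h <= (1 + h) ^+ n.
Proof.
move=> h0; elim: n => [|n IH]; first by rewrite mul0r addr0 expr0.
rewrite exprS; apply: le_trans (_ : (1 + h) * (1 + n%:R * h) <= _).
  rewrite -natr1; have : 0 <= n%:R * h * h by rewrite !mulr_ge0.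
  nra.
by rewrite ler_wpM2l // addr_ge0.
Qed.

Lemma expr_large (L M : R) : 1 < L ->
  exists n0, forall n, (n0 <= n)%N -> M < L ^+ n.
Proof.
move=> L1; have h0 : 0 < L - 1 by rewrite subr_gt0.
have [n0 hn0] := nat_above (M / (L - 1)); exists n0 => n n0n.
have -> : L = 1 + (L - 1) by rewrite subrKC.
apply: lt_le_trans (bernoulli n (ltW h0)).
have : M < n0%:R * (L - 1) by rewrite -ltr_pdivrMr.
have : (n0%:R : R) * (L - 1) <= n%:R * (L - 1).
  by rewrite ler_wpM2r ?ler_nat // ltW.
lra.
Qed.

Lemma expr_small (t e : R) : 0 <= t < 1 -> 0 < e ->
  exists n0, forall n, (n0 <= n)%N -> t ^+ n < e.
Proof.
move=> /andP[t0 t1] e0; have [->|tN0] := eqVneq t 0.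
  by exists 1%N => -[|n] // _; rewrite expr0n.
have tp : 0 < t by rewrite lt0r tN0.
have L1 : 1 < t^-1 by rewrite -invr1 ltf_pV2 // posrE.
have [n0 h] := expr_large e^-1 L1; exists n0 => n /h.
by rewrite exprVn ltf_pV2 // posrE ?exprn_gt0.
Qed.

Lemma le_small (a : R) : (forall e, 0 < e -> a < e) -> a <= 0.
Proof. by move=> h; case: lerP => // a0; have := h a a0; rewrite ltxx. Qed.

End RealFacts.

Section Compactness.
Variable R : realType.
Implicit Types P : nat -> Prop.

Definition infinitely P := forall n0, exists2 n, (n0 <= n)%N & P n.

Lemma infinitely_mono P (Q : nat -> Prop) : (forall n, P n -> Q n) ->
  infinitely P -> infinitely Q.
Proof. by move=> PQ h n0; have [n n0n /PQ] := h n0; exists n. Qed.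

Lemma infinitely_all : infinitely (fun=> True).
Proof. by move=> n; exists n. Qed.

(** Bolzano-Weierstrass for [B], with an infinite index set [P] in place of a subsequence: extra
    conditions on the indices are carried along without composing index maps. *)
Definition bw_space X (dist : X -> X -> R) (B : X -> Prop) :=
  forall P (u : nat -> X), infinitely P -> (forall n, P n -> B (u n)) ->
  exists l, forall e, 0 < e -> infinitely (fun n => P n /\ dist (u n) l < e).

(** The limit is the upper limit along [P]: the supremum of the levels reached by infinitely many
    terms. *)
Lemma bw_real (M : R) : bw_space (fun x y : R => `|x - y|) (fun x : R => `|x| <= M).
Proof.
move=> P u infP bu.
pose S : set R := [set y | infinitely (fun n => P n /\ y <= u n)].
have hS : has_sup S.
  split.
    exists (- M) => n0; have [n n0n Pn] := infP n0; exists n => //; split=> //.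
    by have := bu n Pn; rewrite ler_norml => /andP[].
  exists M => y /(_ 0%N)[n _ [Pn yn]].
  by have := bu n Pn; rewrite ler_norml => /andP[_ h]; exact: le_trans yn h.
exists (sup S) => e e0.
have [y Sy ly] := sup_adherent e0 hS.
have : ~ S (sup S + e / 2).
  move=> /(sup_upper_bound hS); rewrite gerDl => h.
  by have := divr_gt0 e0 (ltr0Sn R 1); rewrite ltNge h.
move=> /existsNP[n1 hn1] n0.
have [n nn [Pn yn]] := Sy (maxn n0 n1).
exists n; first by apply: leq_trans nn; rewrite leq_maxl.
split=> //.
have : u n < sup S + e / 2.
  rewrite ltNge; apply/negP => h; apply: hn1; exists n => //.
  by apply: leq_trans nn; rewrite leq_maxr.
by rewrite ltr_norml; lra.
Qed.

Lemma bw_prod X Y (dX : X -> X -> R) (dY : Y -> Y -> R) BX BY :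
  bw_space dX BX -> bw_space dY BY ->
  bw_space (fun x y => Num.max (dX x.1 y.1) (dY x.2 y.2))
           (fun x => BX x.1 /\ BY x.2).
Proof.
move=> hX hY P u infP bu.
have [l1 hl1] := hX P (fst \o u) infP (fun n Pn => (bu n Pn).1).
have ch k : exists n, (k <= n)%N /\ P n /\ dX (u n).1 l1 < k.+1%:R^-1.
  have k0 : 0 < (k.+1%:R^-1 : R) by rewrite invr_gt0.
  by have [n kn h] := hl1 _ k0 k; exists n.
have [phi hphi] := choice ch.
have bphi k : True -> BY (u (phi k)).2.
  by move=> _; apply: (bu _ _).2; have [_ []] := hphi k.
have [l2 hl2] := hY (fun=> True) _ infinitely_all bphi.
exists (l1, l2) => e e0 n0.
have [n1 hn1] := inv_small e0.
have [k kn [_ hk]] := hl2 _ e0 (maxn n0 n1).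
have [k1 [k2 k3]] := hphi k.
exists (phi k); first by apply: leq_trans k1; apply: leq_trans kn; rewrite leq_maxl.
split=> //=; rewrite gt_max hk andbT (lt_trans k3) // hn1 //.
by apply: leq_trans kn; rewrite leq_maxr.
Qed.

Lemma bw_cplx (M : R) :
  bw_space (fun x y : Cplx R => cabs (x - y)) (fun x : Cplx R => cabs x <= M).
Proof.
move=> P u infP bu.
pose v n := (complex.Re (u n), complex.Im (u n)).
have bv n : P n -> `|(v n).1| <= M /\ `|(v n).2| <= M.
  by move=> Pn; split; apply: le_trans (bu n Pn);
     [exact: cabs_ge_Re|exact: cabs_ge_Im].
have [[a b] hl] := bw_prod (@bw_real M) (@bw_real M) infP bv.
exists (Complex a b : Cplx R) => e e0.
apply: infinitely_mono (hl _ (divr_gt0 e0 (ltr0Sn R 1))) => n [Pn] /=.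
rewrite gt_max => /andP[h1 h2]; split=> //.
apply: le_lt_trans (cabs_le_ReIm _) _.
have -> : u n - (Complex a b : Cplx R) =
    Complex (complex.Re (u n) - a) (complex.Im (u n) - b) :> Cplx R.
  by case: (u n) => x y.
by rewrite /= [e]splitr ltrD.
Qed.

Lemma bw_cplx2 (M : R) P (u : nat -> Cplx R * Cplx R) : infinitely P ->
  (forall n, P n -> cabs (u n).1 <= M /\ cabs (u n).2 <= M) ->
  exists l, forall e, 0 < e -> infinitely (fun n => P n /\ near2 e (u n) l).
Proof.
move=> infP bu.
have [l hl] := bw_prod (@bw_cplx M) (@bw_cplx M) infP bu.
exists l => e e0; apply: infinitely_mono (hl e e0) => n [Pn].
by rewrite gt_max => /andP[].
Qed.

Definition cclosed (E : set (Cplx R)) := forall x,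
  (forall e : R, 0 < e -> exists2 y, E y & cabs (x - y) < e) -> E x.

(** Banach's theorem by compactness: a cluster point of the iterates is fixed because consecutive
    iterates approach each other. *)
Lemma contraction_fixpoint (E : set (Cplx R)) (M : R) g x0 :
  cclosed E -> (forall x, E x -> cabs x <= M) -> E x0 ->
  (forall x, E x -> E (g x)) ->
  (forall x y, E x -> E y -> cabs (g x - g y) <= cabs (x - y) / 2) ->
  exists2 x, E x & g x = x.
Proof.
move=> cE bE Ex0 gE gc; pose u n := iter n g x0.
have Eu n : E (u n) by elim: n => //= n IH; exact: gE.
have du n : cabs (u n.+1 - u n) <= cabs (u 1%N - u 0%N) * (1 / 2) ^+ n.
  elim: n => [|n IH]; first by rewrite expr0 mulr1.
  apply: le_trans (gc _ _ (Eu n.+1) (Eu n)) _.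
  by rewrite exprSr mulrA; lra.
have [l hl] := bw_cplx infinitely_all (fun n _ => bE _ (Eu n)).
have El : E l.
  apply: cE => e e0; have [n _ [_ h]] := hl e e0 0%N.
  by exists (u n) => //; rewrite cabsB.
exists l => //; apply/eqP; rewrite -subr_eq0 -cabs_eq0 eq_le cabs_ge0 andbT.
apply: le_small => e e0.
set D := cabs (u 1%N - u 0%N) in du.
have D1 : 0 < D + 1 by rewrite ltr_wpDl ?cabs_ge0.
have e4 : 0 < e / 4 by rewrite divr_gt0.
have half01 : 0 <= (1 / 2 : R) < 1 by lra.
have [n0 hn0] := expr_small half01 (divr_gt0 e4 D1).
have [n nn [_ hn]] := hl _ e4 n0.
have h1 := du n; have h2 := gc _ _ El (Eu n).
have h3 : D * (1 / 2) ^+ n <= e / 4.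
  have := hn0 n nn; rewrite ltr_pdivlMr // => h.
  have p0 : 0 <= (1 / 2 : R) ^+ n by apply: exprn_ge0; lra.
  by move: h p0; set t := _ ^+ n; lra.
have := cabs_tri (g (u n)) (g l) l.
have := cabs_tri (u n) (g (u n)) l.
rewrite [cabs (l - _)]cabsB in h2.
rewrite /= in h1; lra.
Qed.

Lemma cplx_min (E : set (Cplx R)) (M : R) (g : Cplx R -> R) x0 :
  cclosed E -> (forall x, E x -> cabs x <= M) -> E x0 ->
  (forall x, E x -> 0 <= g x) ->
  (forall x, E x -> forall e, 0 < e -> exists2 r, 0 < r &
     forall y, cabs (y - x) < r -> `|g y - g x| < e) ->
  exists2 x, E x & forall y, E y -> g x <= g y.
Proof.
move=> cE bE Ex0 g0 gc.
have hi : has_inf (g @` E).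
  split; first by exists (g x0), x0.
  by exists 0 => _ [x Ex <-]; exact: g0.
have ch n : exists x, E x /\ g x < inf (g @` E) + n.+1%:R^-1.
  have n0 : 0 < (n.+1%:R^-1 : R) by rewrite invr_gt0.
  by have [_ [x Ex <-] h] := inf_adherent n0 hi; exists x.
have [u hu] := choice ch.
have [l hl] := bw_cplx infinitely_all (fun n _ => bE _ (hu n).1).
have El : E l.
  apply: cE => e e0; have [n _ [_ h]] := hl e e0 0%N.
  by exists (u n); rewrite 1?cabsB //; have [] := hu n.
exists l => // y Ey.
have : inf (g @` E) <= g y by apply: ge_inf; [exact: hi.2|exists y].
suff : g l - inf (g @` E) <= 0 by lra.
apply: le_small => e e0.
have [r r0 hr] := gc l El _ (divr_gt0 e0 (ltr0Sn R 1)).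
have [n0 hn0] := inv_small (divr_gt0 e0 (ltr0Sn R 1)).
have [n /hn0 nn [_ /hr]] := hl r r0 n0.
rewrite ltr_norml => /andP[h1 h2]; have [_ h3] := hu n.
by move: nn h3; set a := (n.+1%:R)^-1; lra.
Qed.

End Compactness.

(** * Roots of polynomials and the Cauchy estimate *)

Section PolynomialFacts.
Variable R : realType.
Local Notation C := (Cplx R).
Implicit Types P T : {poly C}.

Lemma cplx_prim_root n : (0 < n)%N -> exists z : C, n.-primitive_root z.
Proof.
move=> n0; pose P : {poly C} := 'X^n - 1.
have [r DP] := closed_field_poly_normal P.
rewrite (monicP _) ?monicXnsubC // scale1r in DP.
have rn1 : all n.-unity_root r by apply/allP=> z; rewrite -root_prod_XsubC -DP.
have szr : (n <= size r)%N by rewrite -ltnS -(size_prod_XsubC r id) -DP size_XnsubC.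
have ur : uniq r.
  by rewrite -separable_prod_XsubC -DP separable_Xn_sub_1 // pnatr_eq0 -lt0n.
by have /hasP[z _ hz] := has_prim_root n0 rn1 ur szr; exists z.
Qed.

Lemma horner_roots P (r : seq C) x :
  P = lead_coef P *: \prod_(z <- r) ('X - z%:P) ->
  P.[x] = lead_coef P * \prod_(z <- r) (x - z).
Proof.
move=> {1}->; rewrite hornerZ horner_prod; congr (_ * _).
by apply: eq_bigr => z _; rewrite hornerXsubC.
Qed.

Lemma size_roots P (r : seq C) : P != 0 ->
  P = lead_coef P *: \prod_(z <- r) ('X - z%:P) -> size r = (size P).-1.
Proof.
move=> P0 h; rewrite {1}h size_scale ?lead_coef_eq0 //.
by rewrite (size_prod_XsubC r id).
Qed.

Lemma seq_min (s : seq C) (g : C -> R) : s != [::] ->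
  exists2 x, x \in s & forall y, y \in s -> g x <= g y.
Proof.
elim: s => // a [|b s] IH _.
  by exists a; rewrite ?inE // => y; rewrite inE => /eqP->.
have [//|x xs hx] := IH; have [xa|ax] := leP (g x) (g a).
  exists x; first by rewrite inE xs orbT.
  by move=> y; rewrite inE => /orP[/eqP->//|/hx].
exists a; first by rewrite inE eqxx.
move=> y; rewrite inE => /orP[/eqP->//|/hx]; exact/le_trans/ltW.
Qed.

Lemma prod_ge_pow (s : seq C) (g : C -> R) m : 0 <= m ->
  (forall z, z \in s -> m <= g z) -> m ^+ size s <= \prod_(z <- s) g z.
Proof.
move=> m0; elim: s => [|a s IH] h; first by rewrite big_nil.
rewrite big_cons /= exprS ler_pM ?exprn_ge0 //.
  by apply: h; rewrite inE eqxx.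
by apply: IH => z zs; apply: h; rewrite inE zs orbT.
Qed.

(* The nearest root [x'] of [P - y] satisfies this, since the distance from [x]
   to every root is at least [|x - x'|]. *)
Lemma root_near P x y : (1 < size P)%N ->
  exists2 x', P.[x'] = y &
    cabs (lead_coef P) * cabs (x - x') ^+ (size P).-1 <= cabs (P.[x] - y).
Proof.
move=> sP; pose Q := P - y%:P.
have szy : (size (- y%:P : {poly C}) < size P)%N.
  by rewrite size_polyN; apply: leq_ltn_trans (size_polyC_leq1 y) sP.
have sQ : size Q = size P by rewrite size_polyDl.
have lQ : lead_coef Q = lead_coef P by rewrite lead_coefDl.
have [r hr] := closed_field_poly_normal Q.
have Q0 : Q != 0 by rewrite -size_poly_gt0 sQ (leq_trans _ sP).
have szr := size_roots Q0 hr.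
have r0 : r != [::] by rewrite -size_eq0 szr sQ -lt0n -subn1 subn_gt0.
have [x' x'r hx'] := seq_min (fun z => cabs (x - z)) r0.
exists x'.
  apply/eqP; rewrite -subr_eq0; have -> : P.[x'] - y = Q.[x'] by rewrite !hornerE.
  by rewrite -rootE hr rootZ ?lead_coef_eq0 // root_prod_XsubC.
have -> : P.[x] - y = Q.[x] by rewrite !hornerE.
rewrite (horner_roots x hr) cabsM lQ ler_wpM2l ?cabs_ge0 // cabs_prod -sQ -szr.
by apply: (prod_ge_pow (g := fun z => cabs (x - z))); rewrite ?cabs_ge0.
Qed.

(** The radius depends on leading coefficient and degree only. Fibre iterates of the same order
    share both, so their roots can be moved uniformly in the base point. *)
Lemma root_near_eps (b : C) D (e : R) : b != 0 -> 0 < e ->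
  exists2 r : R, 0 < r & forall P, lead_coef P = b -> size P = D.+2 ->
    forall x y, cabs (P.[x] - y) < r ->
    exists2 x', P.[x'] = y & cabs (x - x') < e.
Proof.
move=> b0 e0; exists (cabs b * e ^+ D.+1) => [|P lP sP x y h].
  by rewrite mulr_gt0 ?cabs_gt0 // exprn_gt0.
have [|x' Px' hx'] := @root_near P x y; first by rewrite sP.
exists x' => //; have := le_lt_trans hx' h.
rewrite lP sP ltr_pM2l ?cabs_gt0 //= => hh.
by rewrite -(ltr_pXn2r (ltn0Sn D)) ?nnegrE ?cabs_ge0 // ltW.
Qed.

(** By [root_near_eps] the value [(1 - t) * P.[x]] is taken close to [x] when [t] is small. *)
Lemma min_modulus P x (e : R) : (1 < size P)%N -> P.[x] != 0 -> 0 < e ->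
  exists2 x', cabs (x - x') < e & cabs P.[x'] < cabs P.[x].
Proof.
move=> sP Px0 e0.
have lP0 : lead_coef P != 0 by rewrite lead_coef_eq0 -size_poly_gt0 (leq_trans _ sP).
case sD : (size P) sP => [|[|D]] // _.
have [r r0 hr] := root_near_eps D lP0 e0.
have c0 : 0 < cabs P.[x] by rewrite cabs_gt0.
pose t := Num.min (1 / 2) (r / (2 * cabs P.[x])).
have t0 : 0 < t by rewrite lt_min divr_gt0 //= divr_gt0 // mulr_gt0.
have t1 : t <= 1 / 2 by rewrite ge_min lexx.
have tr : t * cabs P.[x] < r.
  apply: le_lt_trans (_ : r / 2 < r); last by lra.
  have : t <= r / (2 * cabs P.[x]) by rewrite ge_min lexx orbT.
  by rewrite ler_pdivlMr ?mulr_gt0 //; lra.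
have [|x' Px' hx'] := hr P (erefl _) sD x (((1 - t)%:C)%C * P.[x]).
  have -> : P.[x] - ((1 - t)%:C)%C * P.[x] = (t%:C)%C * P.[x].
    by rewrite -[X in X - _]mul1r -mulrBl rmorphB /= subKr.
  by rewrite cabsM cabs_real // ltW.
exists x' => //; rewrite Px' cabsM cabs_real; last by lra.
by rewrite gtr_pMl //; lra.
Qed.

Lemma sum_prim_root n (w : C) j : n.-primitive_root w ->
  \sum_(k < n) (w ^+ k) ^+ j = if (n %| j)%N then n%:R else 0.
Proof.
move=> pw; have -> : \sum_(k < n) (w ^+ k) ^+ j = \sum_(k < n) (w ^+ j) ^+ k.
  by apply: eq_bigr => k _; rewrite exprAC.
rewrite (prim_order_dvd pw); case: eqVneq => [->|wj].
  rewrite (eq_bigr (fun=> 1)) => [|k _]; last by rewrite expr1n.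
  by rewrite sumr_const card_ord.
apply/eqP; have := subrX1 (w ^+ j) n.
have -> : (w ^+ j) ^+ n = 1 by rewrite exprAC (prim_expr_order pw) expr1n.
rewrite subrr => /esym/eqP.
by rewrite mulf_eq0 subr_eq0 (negbTE wj).
Qed.

(** The mean over the circle is replaced by a mean over [n]-th roots of unity, which extracts the
    linear coefficient exactly once [n] is large for the degree. *)
Lemma cauchy_estimate P u (t M : R) : 0 < t ->
  (forall x, cabs (x - u) = t -> cabs P.[x] <= M) ->
  t * cabs (P^`()).[u] <= M.
Proof.
move=> t0 hM; pose Q := P \Po ('X + u%:P).
have Q1 : Q`_1 = (P^`()).[u].
  have -> : Q`_1 = (Q^`()).[0].
    by rewrite horner_coef0 coef_deriv mulr1n.
  rewrite deriv_comp derivD derivX derivC addr0 mulr1.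
  by rewrite horner_comp !hornerE.
(* [n >= size Q] puts every coefficient into the sum, and [n >= 2] leaves [i = 1] as the only
   [i < n] for which [n] divides [n.-1 + i]; the weight [(w ^+ k) ^+ n.-1] is the inverse of
   [w ^+ k]. *)
pose n := (size Q).+2; have [//|w pw] := @cplx_prim_root n.
have Qx x : Q.[x] = P.[x + u] by rewrite horner_comp !hornerE.
pose tc : C := (t%:C)%C.
have key : \sum_(k < n) (w ^+ k) ^+ n.-1 * Q.[tc * w ^+ k] = n%:R * tc * Q`_1.
  transitivity (\sum_(k < n) \sum_(i < n)
      Q`_i * tc ^+ i * (w ^+ k) ^+ (n.-1 + i)).
    apply: eq_bigr => k _; rewrite (@horner_coef_wide _ n) ?mulr_sumr; last first.
      by rewrite /n ltnW.
    apply: eq_bigr => i _; rewrite exprMn exprD.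
    by move: (_ ^+ n.-1) ((w ^+ k) ^+ i) (tc ^+ i) => x y z; ring.
  rewrite exchange_big /=.
  have o1 : (1 < n)%N by [].
  rewrite (bigD1 (Ordinal o1)) //= -mulr_sumr (sum_prim_root _ pw).
  rewrite addn1 dvdnn expr1 big1 ?addr0 => [|i iN1].
    by rewrite mulrC [Q`__ * _]mulrC mulrA.
  rewrite -mulr_sumr (sum_prim_root _ pw) ifF ?mulr0 //.
  apply/negP => /dvdnP[q hq].
  case: i hq iN1 => i /= li hq; rewrite -val_eqE /= => i1.
  have {}hq : ((size Q).+1 + i = q * (size Q).+2)%N by exact: hq.
  have : (i < (size Q).+2)%N by exact: li.
  case: q hq => [|[|q]]; [lia|lia|nia].
have w1 k : cabs (w ^+ k) = 1.
  have wn : cabs w ^+ n = 1 by rewrite -cabsX prim_expr_order // cabs1.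
  rewrite cabsX; have -> : cabs w = 1 by apply/eqP; rewrite -(@pexpr_eq1 _ (cabs w) n) ?cabs_ge0 // wn.
  by rewrite expr1n.
have : cabs (n%:R * tc * Q`_1) <= n%:R * M.
  rewrite -key; apply: le_trans (cabs_sum _ _ _) _.
  rewrite -[X in X%:R]card_ord mulr_natl -sumr_const; apply: ler_sum => k _.
  rewrite cabsM cabsX w1 expr1n mul1r Qx; apply: hM.
  by rewrite addrK cabsM w1 mulr1 cabs_real // ltW.
rewrite !cabsM cabs_real ?(ltW t0) // Q1.
have -> : cabs (n%:R : C) = n%:R.
  by rewrite -(@cabs_real _ n%:R) ?ler0n // rmorph_nat.
by rewrite -mulrA ler_pM2l // ltr0n.
Qed.

(* Factorwise, [\prod_k (h w^k - a) = +-(a^n - h^n)]. *)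
Lemma circle_product T n (w v h : C) (s : R) : n.-primitive_root w ->
  0 < s -> cabs h <= s / 2 ->
  (forall a, cabs (a - v) < s -> T.[a] != 0) ->
  \prod_(k < n) cabs T.[v + h * w ^+ k]
    <= cabs T.[v] ^+ n * (1 + 2^-1 ^+ n) ^+ (size T).-1.
Proof.
move=> pw s0 hs nz.
have T0 : T != 0.
  apply/eqP => T0; have := nz v; rewrite subrr cabs0 s0 T0 horner0 eqxx.
  by move=> /(_ isT).
have [r hr] := closed_field_poly_normal T.
rewrite -(size_roots T0 hr).
have rs a : a \in r -> s <= cabs (a - v).
  move=> ar; rewrite leNgt; apply/negP => /nz.
  by rewrite -rootE hr rootZ ?lead_coef_eq0 // root_prod_XsubC ar.
rewrite (eq_bigr (fun k : 'I_n => cabs (lead_coef T) *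
    \prod_(a <- r) cabs (v + h * w ^+ k - a))) => [|k _]; last first.
  by rewrite (horner_roots _ hr) cabsM cabs_prod.
rewrite big_split /= prodr_const card_ord exchange_big /=.
rewrite (horner_roots _ hr) cabsM exprMn cabs_prod -mulrA ler_wpM2l //.
  by rewrite exprn_ge0 ?cabs_ge0.
elim: r rs {hr} => [|a r IH] rs.
  by rewrite !big_nil expr1n mulr1.
rewrite !big_cons /= exprS exprMn mulrACA.
apply: ler_pM; last 1 first.
- by apply: IH => b br; apply: rs; rewrite inE br orbT.
- by apply: prodr_ge0 => k _; exact: cabs_ge0.
- by apply: prodr_ge0 => b _; apply: prodr_ge0 => k _; exact: cabs_ge0.
have {}rs : s <= cabs (a - v) by apply: rs; rewrite inE eqxx.
have -> : \prod_(k < n) cabs (v + h * w ^+ k - a) = cabs ((a - v) ^+ n - h ^+ n).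
  rewrite -cabs_prod.
  have -> : \prod_(k < n) (v + h * w ^+ k - a) =
      (-1) ^+ n * \prod_(k < n) ((a - v) - h * w ^+ k).
    rewrite -[X in (-1) ^+ X]card_ord -prodr_const -big_split /=.
    by apply: eq_bigr => k _; ring.
  rewrite cabsM cabsX cabsN cabs1 expr1n mul1r; congr cabs.
  have n0 := prim_order_gt0 pw.
  have [->|h0] := eqVneq h 0.
    rewrite expr0n gtn_eqF // subr0 (eq_bigr (fun=> a - v)) => [|k _].
      by rewrite prodr_const card_ord.
    by rewrite mul0r subr0.
  have := congr1 (horner ^~ ((a - v) / h)) (factor_Xn_sub_1 pw).
  rewrite /= horner_prod big_mkord !hornerE => E.
  have -> : (a - v) ^+ n - h ^+ n = h ^+ n * (((a - v) / h) ^+ n - 1).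
    by rewrite mulrBr mulr1 -exprMn mulrC divfK.
  rewrite -E -[X in h ^+ X]card_ord -prodr_const -big_split /=.
  by apply: eq_bigr => k _; rewrite !hornerE mulrBr mulrCA divff // mulr1.
apply: le_trans (cabsD _ _) _; rewrite cabsN !cabsX mulrDr mulr1 [cabs (v - a)]cabsB lerD2l.
rewrite -exprMn; apply: lerXn2r; rewrite ?nnegrE ?mulr_ge0 ?cabs_ge0 ?invr_ge0 //.
by apply: le_trans hs _; rewrite ler_pM2r // invr_gt0.
Qed.

End PolynomialFacts.

(** * Families of polynomials, uniformly on bounded sets *)

Section Families.
Variable R : realType.
Local Notation C := (Cplx R).
Implicit Types (g h k : C -> C -> C) (F G : C -> {poly C}).

(** Lipschitz on bounded sets, jointly in base point and fibre variable. Base maps enter as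
    functions constant in the second argument, so that one calculus serves both. *)
Definition lipB g := forall B : R, exists2 M : R, 0 <= M &
  forall z z' w w', cabs z <= B -> cabs z' <= B -> cabs w <= B -> cabs w' <= B ->
  cabs (g z w - g z' w') <= M * (cabs (z - z') + cabs (w - w')).

Lemma lipB_bound g : lipB g -> forall B : R, exists2 M : R, 0 <= M &
  forall z w, cabs z <= B -> cabs w <= B -> cabs (g z w) <= M.
Proof.
move=> lg B; have [B0|B0] := ltP B 0.
  by exists 0 => // z w zB; have := le_lt_trans zB B0; rewrite ltNge cabs_ge0.
have [M M0 hM] := lg B.
exists (cabs (g 0 0) + M * (B + B)) => [|z w zB wB].
  by rewrite addr_ge0 ?cabs_ge0 // mulr_ge0 // addr_ge0.
have := hM z 0 w 0 zB; rewrite !cabs0 !subr0 => /(_ B0 wB B0) h.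
apply: le_trans (cabs_le_add _ (g 0 0)) _; rewrite lerD2l.
by apply: le_trans h _; rewrite ler_wpM2l // lerD.
Qed.

Lemma lipB_cst (c : C) : lipB (fun _ _ => c).
Proof. by move=> B; exists 0 => // *; rewrite subrr cabs0 mul0r. Qed.

Lemma lipB_fst : lipB (fun z _ => z).
Proof. by move=> B; exists 1 => // *; rewrite mul1r lerDl cabs_ge0. Qed.

Lemma lipB_snd : lipB (fun _ w => w).
Proof. by move=> B; exists 1 => // *; rewrite mul1r lerDr cabs_ge0. Qed.

Lemma lipB_add g h : lipB g -> lipB h -> lipB (fun z w => g z w + h z w).
Proof.
move=> lg lh B; have [M M0 hM] := lg B; have [N N0 hN] := lh B.
exists (M + N) => [|z z' w w' a b c d]; first by rewrite addr_ge0.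
have -> : g z w + h z w - (g z' w' + h z' w') =
          (g z w - g z' w') + (h z w - h z' w') by ring.
by apply: le_trans (cabsD _ _) _; rewrite mulrDl lerD ?hM ?hN.
Qed.

Lemma lipB_mul g h : lipB g -> lipB h -> lipB (fun z w => g z w * h z w).
Proof.
move=> lg lh B; have [M M0 hM] := lg B; have [N N0 hN] := lh B.
have [M' M'0 hM'] := lipB_bound lg B; have [N' N'0 hN'] := lipB_bound lh B.
exists (M' * N + M * N') => [|z z' w w' a b c d].
  by rewrite addr_ge0 // mulr_ge0.
have -> : g z w * h z w - (g z' w' * h z' w') =
   g z w * (h z w - h z' w') + (g z w - g z' w') * h z' w' by ring.
apply: le_trans (cabsD _ _) _; rewrite [leRHS]mulrDl !cabsM lerD //.
  by rewrite -mulrA ler_pM ?cabs_ge0 ?hM' ?hN.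
by rewrite mulrAC ler_pM ?cabs_ge0 ?hM ?hN'.
Qed.

Lemma lipB_comp g h k : lipB g -> lipB h -> lipB k ->
  lipB (fun z w => g (h z w) (k z w)).
Proof.
move=> lg lh lk B; have [M1 M10 hM1] := lh B; have [M2 M20 hM2] := lk B.
have [B1 B10 hB1] := lipB_bound lh B; have [B2 B20 hB2] := lipB_bound lk B.
have [M M0 hM] := lg (B1 + B2).
exists (M * (M1 + M2)) => [|z z' w w' a b c d].
  by rewrite mulr_ge0 // addr_ge0.
apply: le_trans (hM _ _ _ _ _ _ _ _) _.
- by apply: le_trans (hB1 _ _ a c) _; rewrite lerDl.
- by apply: le_trans (hB1 _ _ b d) _; rewrite lerDl.
- by apply: le_trans (hB2 _ _ a c) _; rewrite lerDr.
- by apply: le_trans (hB2 _ _ b d) _; rewrite lerDr.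
by rewrite -mulrA ler_wpM2l // mulrDl lerD ?hM1 ?hM2.
Qed.

Lemma lipB_horner (P : {poly C}) : lipB (fun z _ => P.[z]).
Proof.
elim/poly_ind: P => [|P c IH].
  have -> : (fun z _ : C => (0 : {poly C}).[z]) = (fun _ _ => 0).
    by apply/funext => z; apply/funext => w; rewrite horner0.
  exact: lipB_cst.
have -> : (fun z _ : C => (P * 'X + c%:P).[z]) = (fun z _ => P.[z] * z + c).
  by apply/funext => z; apply/funext => w; rewrite !hornerE.
by apply: lipB_add; [apply: lipB_mul => //; exact: lipB_fst|exact: lipB_cst].
Qed.

(** First-order Taylor expansion in the fibre variable with a remainder constant uniform in [z];
    through it, bounds on a derivative at a point become bounds on distances nearby. *)
Definition taylorB F := forall B : R, exists2 M : R, 0 <= M &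
  forall z x v, cabs z <= B -> cabs x <= B -> cabs v <= B ->
  cabs ((F z).[x] - (F z).[v] - ((F z)^`()).[v] * (x - v))
    <= M * cabs (x - v) ^+ 2.

Definition goodF F := [/\ lipB (fun z w => (F z).[w]),
  lipB (fun z w => ((F z)^`()).[w]) & taylorB F].

Lemma eq_goodF F G : F =1 G -> goodF F -> goodF G.
Proof. by move=> /funext ->. Qed.

Lemma eq_lipB g h : (forall z w, g z w = h z w) -> lipB g -> lipB h.
Proof.
by move=> e; have -> : g = h by apply/funext => z; apply/funext.
Qed.

Lemma goodF_cst (c : C -> C) : lipB (fun z _ => c z) -> goodF (fun z => (c z)%:P).
Proof.
move=> lc; split.
- by apply: eq_lipB lc => z w; rewrite hornerC.
- by apply: eq_lipB (lipB_cst 0) => z w; rewrite derivC horner0.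
move=> B; exists 0 => // z x v _ _ _.
by rewrite !hornerC subrr derivC horner0 mul0r subr0 cabs0 mul0r.
Qed.

Lemma goodF_X : goodF (fun=> 'X).
Proof.
split.
- by apply: eq_lipB lipB_snd => z w; rewrite hornerX.
- by apply: eq_lipB (lipB_cst 1) => z w; rewrite derivX hornerC.
move=> B; exists 0 => // z x v _ _ _.
by rewrite !hornerX derivX hornerC mul1r subrr cabs0 mul0r.
Qed.

Lemma goodF_add F G : goodF F -> goodF G -> goodF (fun z => F z + G z).
Proof.
move=> [F1 F2 F3] [G1 G2 G3]; split.
- by apply: eq_lipB (lipB_add F1 G1) => z w; rewrite hornerD.
- by apply: eq_lipB (lipB_add F2 G2) => z w; rewrite derivD hornerD.
move=> B; have [M M0 hM] := F3 B; have [N N0 hN] := G3 B.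
exists (M + N) => [|z x v a b c]; first by rewrite addr_ge0.
rewrite derivD !hornerD mulrDl [leRHS]mulrDl.
have -> : (F z).[x] + (G z).[x] - ((F z).[v] + (G z).[v]) -
     (((F z)^`()).[v] * (x - v) + ((G z)^`()).[v] * (x - v)) =
  ((F z).[x] - (F z).[v] - ((F z)^`()).[v] * (x - v)) +
  ((G z).[x] - (G z).[v] - ((G z)^`()).[v] * (x - v)) by ring.
by apply: le_trans (cabsD _ _) _; rewrite lerD ?hM ?hN.
Qed.

Lemma goodF_mul F G : goodF F -> goodF G -> goodF (fun z => F z * G z).
Proof.
move=> [F1 F2 F3] [G1 G2 G3]; split.
- by apply: eq_lipB (lipB_mul F1 G1) => z w; rewrite hornerM.
- apply: eq_lipB (lipB_add (lipB_mul F2 G1) (lipB_mul F1 G2)) => z w.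
  by rewrite derivM hornerD !hornerM.
move=> B; have [M M0 hM] := F3 B; have [N N0 hN] := G3 B.
have [K K0 hK] := lipB_bound F1 B; have [K' K'0 hK'] := lipB_bound G1 B.
have [L L0 hL] := F1 B; have [L' L'0 hL'] := G1 B.
exists (M * K' + K * N + L * L') => [|z x v a b c].
  by rewrite !addr_ge0 // mulr_ge0.
rewrite derivM hornerD !hornerM.
have -> : (F z).[x] * (G z).[x] - (F z).[v] * (G z).[v] -
   (((F z)^`()).[v] * (G z).[v] + (F z).[v] * ((G z)^`()).[v]) * (x - v) =
  ((F z).[x] - (F z).[v] - ((F z)^`()).[v] * (x - v)) * (G z).[v] +
  (F z).[v] * ((G z).[x] - (G z).[v] - ((G z)^`()).[v] * (x - v)) +
  ((F z).[x] - (F z).[v]) * ((G z).[x] - (G z).[v]) by ring.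
apply: le_trans (cabsD _ _) _; rewrite [leRHS]mulrDl lerD //.
  apply: le_trans (cabsD _ _) _; rewrite [leRHS]mulrDl !cabsM lerD //.
    by rewrite mulrAC ler_pM ?cabs_ge0 ?hM ?hK'.
  by rewrite -mulrA ler_pM ?cabs_ge0 ?hN ?hK.
rewrite cabsM expr2 mulrACA.
have h1 := hL z z x v a a b c; rewrite subrr cabs0 add0r in h1.
have h2 := hL' z z x v a a b c; rewrite subrr cabs0 add0r in h2.
by rewrite ler_pM ?cabs_ge0.
Qed.

Lemma goodF_comp F G (k : C -> C) : goodF F -> goodF G -> lipB (fun z _ => k z) ->
  goodF (fun z => F (k z) \Po G z).
Proof.
move=> [F1 F2 F3] [G1 G2 G3] lk; split.
- by apply: eq_lipB (lipB_comp F1 lk G1) => z w; rewrite horner_comp.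
- apply: eq_lipB (lipB_mul (lipB_comp F2 lk G1) G2) => z w.
  by rewrite deriv_comp hornerM horner_comp.
move=> B.
have [B1 B10 hB1] := lipB_bound lk B; have [B2 B20 hB2] := lipB_bound G1 B.
have [M M0 hM] := F3 (B1 + B2); have [N N0 hN] := G3 B.
have [L L0 hL] := G1 B; have [K K0 hK] := lipB_bound F2 (B1 + B2).
exists (M * L ^+ 2 + K * N) => [|z x v a b c].
  by rewrite addr_ge0 // mulr_ge0 // exprn_ge0.
rewrite deriv_comp hornerM !horner_comp.
set y := (G z).[x]; set u := (G z).[v].
have -> : (F (k z)).[y] - (F (k z)).[u] -
    ((F (k z))^`()).[u] * ((G z)^`()).[v] * (x - v) =
  ((F (k z)).[y] - (F (k z)).[u] - ((F (k z))^`()).[u] * (y - u)) +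
  ((F (k z))^`()).[u] * (y - u - ((G z)^`()).[v] * (x - v)) by ring.
have yu : cabs (y - u) <= L * cabs (x - v).
  by have := hL z z x v a a b c; rewrite subrr cabs0 add0r.
have kB : cabs (k z) <= B1 + B2 by apply: le_trans (hB1 z v a c) _; rewrite lerDl.
have yB : cabs y <= B1 + B2 by apply: le_trans (hB2 z x a b) _; rewrite lerDr.
have uB : cabs u <= B1 + B2 by apply: le_trans (hB2 z v a c) _; rewrite lerDr.
apply: le_trans (cabsD _ _) _; rewrite [leRHS]mulrDl lerD //.
  apply: le_trans (hM _ _ _ kB yB uB) _; rewrite -mulrA ler_wpM2l // -exprMn.
  by rewrite lerXn2r ?nnegrE ?cabs_ge0 // mulr_ge0 ?cabs_ge0.
by rewrite cabsM -mulrA ler_pM ?cabs_ge0 ?hK ?hN.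
Qed.

Lemma goodF_poly (P : {poly C}) : goodF (fun=> P).
Proof.
elim/poly_ind: P => [|P c IH].
  by apply: eq_goodF (goodF_cst (lipB_cst 0)) => z; rewrite polyC0.
apply: goodF_add (goodF_cst (lipB_cst c)); exact: goodF_mul IH goodF_X.
Qed.

Lemma goodF_fiber (q : {poly {poly C}}) : goodF (fiber q).
Proof.
elim/poly_ind: q => [|q c IH].
  apply: eq_goodF (goodF_cst (lipB_cst 0)) => z.
  by rewrite /fiber map_poly0 polyC0.
apply: eq_goodF (goodF_add (goodF_mul IH goodF_X) (goodF_cst (lipB_horner c))) => z.
by rewrite /fiber rmorphD rmorphM /= map_polyX map_polyC.
Qed.

Lemma lipB_iter (p : {poly C}) n : lipB (fun z _ => iter n (horner p) z).
Proof.
elim: n => [|n IH] /=; first exact: lipB_fst.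
exact: lipB_comp (lipB_horner p) IH lipB_snd.
Qed.

Lemma goodF_iter (p : {poly C}) (q : {poly {poly C}}) n :
  goodF (fun z => fiber_iter p q z n).
Proof.
elim: n => [|n IH] /=; first exact: goodF_X.
exact: goodF_comp (goodF_fiber q) IH (lipB_iter p n).
Qed.

End Families.

(** * Coefficients of a skew product extending to the projective plane *)

Section Structure.
Variable R : realType.
Local Notation C := (Cplx R).
Implicit Types (a : nat -> nat -> C) (q : {poly {poly C}}).

Lemma nonvanishing_const (P : {poly C}) : (forall x, P.[x] != 0) ->
  forall x, P.[x] = P.[0].
Proof.
move=> nz; have : size P == 1%N.
  apply/negPn/negP => /closed_rootP[x]; rewrite /root => Px.
  by have := nz x; rewrite Px.
by move=> /eqP/eq_leq/size1_polyC -> x; rewrite !hornerC.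
Qed.

Lemma poly_ext (P Q : {poly C}) : (forall x, P.[x] = Q.[x]) -> P = Q.
Proof.
move=> h; apply/eqP; rewrite -subr_eq0; apply/eqP; set S := P - Q.
have S0 x : S.[x] = 0 by rewrite !hornerE h subrr.
clearbody S.
(* [S + 1] takes only the value 1, so it has no root and must be constant. *)
have : size (S + 1) == 1%N.
  apply/negPn/negP => /closed_rootP[x].
  by rewrite /root !hornerE S0 add0r oner_eq0.
move=> /eqP/eq_leq/size1_polyC E.
have : (S + 1).[0] = 1 by rewrite !hornerE S0 add0r.
rewrite E hornerC => E1; rewrite E1 in E.
by apply: (addIr 1); rewrite E add0r.
Qed.

Lemma fiber_coef q z i : (fiber q z)`_i = (q`_i).[z].
Proof. by rewrite /fiber coef_map_id0 /= /horner_eval ?horner0. Qed.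

Lemma fiber_size_le q z : (size (fiber q z) <= size q)%N.
Proof.
by apply/leq_sizeP => j hj; rewrite fiber_coef nth_default // horner0.
Qed.

Lemma fiber_ext q q' :
  (forall z w, (fiber q z).[w] = (fiber q' z).[w]) -> q = q'.
Proof.
move=> h; apply/polyP => i; apply: poly_ext => z.
by rewrite -!fiber_coef (poly_ext (h z)).
Qed.

(** Dehomogenization by [t = 1], in the shape of [q]: a polynomial in the second variable over
    polynomials in the first. *)
Definition form_poly d a : {poly {poly C}} :=
  \poly_(j < d.+1) \poly_(i < d.+1) (if (i + j <= d)%N then a i j else 0).

Lemma form3_affine d a z w : form3 d a z w 1 = (fiber (form_poly d a) z).[w].
Proof.
have sz : (size (fiber (form_poly d a) z) <= d.+1)%N.
  by rewrite (leq_trans (fiber_size_le _ _)) // size_poly.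
rewrite (horner_coef_wide _ sz) /form3 (exchange_big_dep predT) //=.
apply: eq_bigr => j _; rewrite fiber_coef coef_poly ltn_ord.
rewrite (horner_coef_wide _ (size_poly _ _)) mulr_suml big_mkcond /=.
apply: eq_bigr => i _; rewrite coef_poly ltn_ord.
by case: ifP; rewrite ?mul0r // expr1n mulr1.
Qed.

Lemma form3_infinity d a x y :
  form3 d a x y 0 = \sum_(i < d.+1) a i (d - i)%N * x ^+ i * y ^+ (d - i).
Proof.
apply: eq_bigr => i _; have id : (i <= d)%N by rewrite -ltnS.
have jd : (d - i < d.+1)%N by rewrite ltnS leq_subr.
rewrite (bigD1 (Ordinal jd)) /= ?subnKC // subnn expr0 mulr1.
rewrite big1 ?addr0 // => j /andP[ij]; rewrite -val_eqE /= => jN.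
rewrite expr0n; have -> : (d - i - j == 0)%N = false; last by rewrite mulr0.
by apply/negbTE; rewrite -lt0n; lia.
Qed.

(** The third form has no zero in the affine chart, hence is the constant [c] there; the other two
    are then [c] times [p] and [q]. On the line at infinity only the terms of degree exactly [d]
    survive, and the absence of a common zero there forces full degree. A term of degree [d] in [w]
    leaves no room for [z], so the leading coefficient of [q] is constant. *)
Lemma skew_structure d (p : {poly C}) q : skew_product d p q ->
  [/\ (2 <= d)%N, size p = d.+1, size q = d.+1 &
      exists2 b : C, b != 0 & lead_coef q = b%:P].
Proof.
move=> [d2 [a0 [a1 [a2 [nz ext]]]]].
have d0 : (0 < d)%N by rewrite (leq_trans _ d2).
have nz2 z w : form3 d a2 z w 1 != 0 by have [] := ext z w.
pose c := form3 d a2 0 0 1; have c0 : c != 0 := nz2 0 0.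
have cE z w : form3 d a2 z w 1 = c.
  transitivity (form3 d a2 z 0 1).
    rewrite !form3_affine; apply: nonvanishing_const => x.
    by rewrite -form3_affine.
  rewrite /c !form3_affine !horner_coef0 !fiber_coef.
  apply: nonvanishing_const => x.
  by rewrite -fiber_coef -horner_coef0 -form3_affine.
have E2 : form_poly d a2 = (c%:P)%:P.
  apply: fiber_ext => z w; rewrite -form3_affine cE.
  by rewrite /fiber map_polyC /= hornerC /horner_eval hornerC.
have E0 : form_poly d a0 = (c *: p)%:P.
  apply: fiber_ext => z w; rewrite -form3_affine.
  have [_ -> _] := ext z w.
  by rewrite cE /fiber map_polyC /= hornerC /horner_eval hornerZ mulrC.
have E1 : form_poly d a1 = c%:P *: q.
  apply: fiber_ext => z w; rewrite -form3_affine.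
  have [_ _ ->] := ext z w.
  rewrite cE /= mulrC /fiber linearZ_LR /=.
  by rewrite /horner_eval hornerC hornerZ.
have coefE a i j : (i <= d)%N -> (j <= d)%N -> (i + j <= d)%N ->
    ((form_poly d a)`_j)`_i = a i j.
  by move=> h1 h2 h3; rewrite coef_poly ltnS h2 coef_poly ltnS h1 h3.
have a0j i : (i < d)%N -> a0 i (d - i)%N = 0.
  move=> id; rewrite -coefE ?E0 ?coefC ?subnKC ?leq_subr // ?(ltnW id) //.
  by rewrite subn_eq0 leqNgt id /= coef0.
have a2j i : (i <= d)%N -> a2 i (d - i)%N = 0.
  move=> id; rewrite -coefE ?E2 ?coefC ?subnKC ?leq_subr //.
  have [->|iN0] := posnP i; first by rewrite subn0 gtn_eqF // coef0.
  by case: ifP => _; rewrite ?coef0 // coefC gtn_eqF.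
have F2 x y : form3 d a2 x y 0 = 0.
  by rewrite form3_infinity big1 // => i _; rewrite a2j ?mul0r // -ltnS.
have F0 x y : form3 d a0 x y 0 = a0 d 0%N * x ^+ d.
  rewrite form3_infinity big_ord_recr /= subnn expr0 mulr1 big1 ?add0r //.
  by move=> i _; rewrite a0j ?mul0r.
(* At [[0 : 1 : 0]] the first and the third form vanish, so the coefficient of [y ^+ d] in the
   second cannot be zero. *)
have b0 : a1 0%N d != 0.
  apply/eqP => b0; have [] := nz 0 1 0.
  - by rewrite F0 expr0n gtn_eqF // mulr0.
  - rewrite form3_infinity big_ord_recl /= subn0 b0 !mul0r add0r big1 // => i _.
    by rewrite expr0n /= mulr0 mul0r.
  - exact: F2.
  by move=> _ /eqP; rewrite oner_eq0.
(* If the first form vanished on the whole line at infinity, the second would have a zero on it: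
   some [[x : 1 : 0]] when [H] has a root, and [[1 : 0 : 0]] when [H] is constant. *)
have p0 : a0 d 0%N != 0.
  apply/eqP => p0; have F0' x y : form3 d a0 x y 0 = 0 by rewrite F0 p0 mul0r.
  pose H : {poly C} := \poly_(i < d.+1) a1 i (d - i)%N.
  have F1 x : form3 d a1 x 1 0 = H.[x].
    rewrite form3_infinity (horner_coef_wide _ (size_poly _ _)).
    by apply: eq_bigr => i _; rewrite coef_poly ltn_ord expr1n mulr1.
  have [/eq_leq/size1_polyC sH|] := eqVneq (size H) 1%N.
    have Hd : a1 d 0%N = 0.
      have : H`_d = 0 by rewrite sH coefC gtn_eqF.
      by rewrite coef_poly ltnSn subnn.
    have [] := nz 1 0 0; rewrite ?F0' ?F2 //.
      rewrite form3_infinity big_ord_recr /= subnn Hd !mul0r addr0 big1 // => i _.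
      by rewrite expr0n subn_eq0 leqNgt ltn_ord mulr0.
    by move=> /eqP; rewrite oner_eq0.
  move=> /closed_rootP[x /eqP Hx].
  have [] := nz x 1 0; rewrite ?F0' ?F2 ?F1 //.
  by move=> _ /eqP; rewrite oner_eq0.
have cP0 : c%:P != 0 :> {poly C} by rewrite polyC_eq0.
have szp : size p = d.+1.
  have cp : c *: p = (form_poly d a0)`_0 by rewrite E0 coefC.
  apply/eqP; rewrite -(size_scale p c0) cp eqn_leq coef_poly /= size_poly /=.
  rewrite ltnNge; apply/negP => /leq_sizeP/(_ d (leqnn d)).
  by rewrite coef_poly ltnSn addn0 leqnn; exact/eqP.
have qd : c%:P * q`_d = (a1 0%N d)%:P.
  rewrite -coefZ -E1; apply/polyP => i; rewrite coef_poly ltnSn coef_poly coefC.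
  have [->|iN0] := posnP i; first by rewrite /= add0n leqnn.
  have -> : (i + d <= d)%N = false by lia.
  by rewrite if_same.
have szq : size q = d.+1.
  rewrite -(size_scale q cP0) -E1; apply/eqP; rewrite eqn_leq size_poly /=.
  rewrite ltnNge; apply/negP => /leq_sizeP/(_ d (leqnn d)).
  by rewrite E1 coefZ qd => /eqP; rewrite polyC_eq0 (negbTE b0).
split=> //; exists (c^-1 * a1 0%N d); first by rewrite mulf_neq0 ?invr_eq0.
apply: (mulfI cP0); rewrite lead_coefE szq qd -polyCM mulrA divff ?mul1r //.
Qed.

(** Leading coefficient of the [n]-th fibre iterate, the same over every base point. *)
Definition iter_lead (b : C) d n : C := iter n (fun x => b * x ^+ d) 1.

Lemma iter_lead_neq0 (b : C) d n : b != 0 -> iter_lead b d n != 0.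
Proof.
by move=> b0; elim: n => [|n IH] /=; rewrite ?oner_eq0 // mulf_neq0 // expf_neq0.
Qed.

Lemma fiber_size q (b : C) d z : size q = d.+1 -> lead_coef q = b%:P -> b != 0 ->
  size (fiber q z) = d.+1 /\ lead_coef (fiber q z) = b.
Proof.
move=> sq lq b0; have cd : (fiber q z)`_d = b.
  by rewrite fiber_coef -[X in q`_X]/(d.+1.-1) -sq -lead_coefE lq hornerC.
have sz : size (fiber q z) = d.+1.
  apply/eqP; rewrite eqn_leq; apply/andP; split.
    by rewrite -sq fiber_size_le.
  by rewrite ltnNge; apply/negP => /leq_sizeP/(_ d (leqnn d))/eqP; rewrite cd (negbTE b0).
by rewrite lead_coefE sz.
Qed.

Lemma fiber_iter_size (p : {poly C}) q (b : C) d z n :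
  (0 < d)%N -> size q = d.+1 -> lead_coef q = b%:P -> b != 0 ->
  size (fiber_iter p q z n) = (d ^ n).+1 /\
  lead_coef (fiber_iter p q z n) = iter_lead b d n.
Proof.
move=> d0 sq lq b0; elim: n => [|n [IH1 IH2]] /=.
  by rewrite size_polyX lead_coefX.
have [s1 l1] := fiber_size (iter n (horner p) z) sq lq b0.
have szN : (1 < size (fiber_iter p q z n))%N by rewrite IH1 ltnS expn_gt0 d0.
have lE := lead_coef_comp (fiber q (iter n (horner p) z)) szN.
rewrite lE l1 IH2 s1; split=> //.
have := size_comp_poly (fiber q (iter n (horner p) z)) (fiber_iter p q z n).
rewrite IH1 s1 /= -expnS => <-; rewrite prednK // size_poly_gt0 -lead_coef_eq0.
by rewrite lE mulf_neq0 ?l1 // expf_neq0 // IH2 iter_lead_neq0.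
Qed.

End Structure.

(** * Escape and Julia sets *)

Section Growth.
Variable R : realType.
Local Notation C := (Cplx R).

Lemma fiber_coef_bound (q : {poly {poly C}}) (B : R) n : exists2 M : R, 0 <= M &
  forall z i, cabs z <= B -> (i < n)%N -> cabs (fiber q z)`_i <= M.
Proof.
elim: n => [|n [M M0 hM]]; first by exists 0.
have [N N0 hN] := lipB_bound (lipB_horner q`_n) B.
exists (M + N); first by rewrite addr_ge0.
move=> z i zB; rewrite ltnS leq_eqVlt => /orP[/eqP->|/(hM z i zB) h].
  by rewrite fiber_coef (le_trans (hN z z zB zB)) // lerDr.
by rewrite (le_trans h) // lerDl.
Qed.

(** The constants depend only on the degree, the leading coefficient and a bound on the other
    coefficients, hence are common to all fibres over a bounded base. The cap [a <= 1] is what lets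
    the lower bound be iterated in [growth_below]. *)
Lemma growth_poly (d : nat) (b : C) (M : R) : (2 <= d)%N -> b != 0 -> 0 <= M ->
  exists r a c : R, [/\ 1 <= r, 0 < a <= 1, 1 <= c & forall P : {poly C},
   size P = d.+1 -> P`_d = b -> (forall i, (i < d)%N -> cabs P`_i <= M) ->
   forall w, [/\ r <= cabs w -> 2 * cabs w <= cabs P.[w],
     r <= cabs w -> a * cabs w ^+ d <= cabs P.[w] &
     cabs P.[w] <= c * Num.max (cabs w) r ^+ d]].
Proof.
move=> d2 b0 M0; have cb : 0 < cabs b by rewrite cabs_gt0.
case: d d2 => // d d2; pose N : R := M * d.+1%:R.
have N0 : 0 <= N by rewrite mulr_ge0.
pose a := Num.min 1 (cabs b / 2).
have a0 : 0 < a by rewrite lt_min ltr01 divr_gt0.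
have a1 : a <= 1 by rewrite ge_min lexx.
have ab : a <= cabs b / 2 by rewrite ge_min lexx orbT.
(* [2 * N / cabs b] makes the lower-order terms at most half of the leading one; [2 / a] turns the
   resulting power bound into doubling. *)
pose r := 1 + 2 * N / cabs b + 2 / a.
have ra0 : 0 <= 2 / a by rewrite divr_ge0 // ltW.
have rb0 : 0 <= 2 * N / cabs b by rewrite divr_ge0 ?mulr_ge0 // ltW.
have r1 : 1 <= r by rewrite /r; lra.
pose c := 1 + N + cabs b.
exists r, a, c; split=> //; first by rewrite a0.
  by rewrite /c; lra.
move=> P sP Pd Pi w.
have PE : P.[w] = \sum_(i < d.+1) P`_i * w ^+ i + b * w ^+ d.+1.
  by rewrite (@horner_coef_wide _ d.+2) ?sP // big_ord_recr /= Pd.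
have low (m : R) : 1 <= m -> cabs w <= m ->
    cabs (\sum_(i < d.+1) P`_i * w ^+ i) <= N * m ^+ d.
  move=> m1 wm; apply: le_trans (cabs_sum _ _ _) _.
  have -> : N * m ^+ d = \sum_(i < d.+1) M * m ^+ d.
    by rewrite sumr_const card_ord /N -mulr_natr; ring.
  apply: ler_sum => i _; rewrite cabsM cabsX ler_pM ?cabs_ge0 ?exprn_ge0 ?cabs_ge0 //.
    exact: Pi.
  apply: le_trans (_ : m ^+ i <= _); first by rewrite lerXn2r ?nnegrE ?cabs_ge0 // (le_trans _ m1).
  by rewrite ler_weXn2l // -ltnS.
have main : r <= cabs w -> a * cabs w ^+ d.+1 <= cabs P.[w].
  move=> rw; have w1 : 1 <= cabs w := le_trans r1 rw.
  have lw := low _ w1 (lexx _).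
  have tri := cabs_tri 0 (b * w ^+ d.+1) (- \sum_(i < d.+1) P`_i * w ^+ i).
  have h1 : cabs b * cabs w ^+ d.+1 <= cabs P.[w] + N * cabs w ^+ d.
    rewrite -cabsX -cabsM.
    have -> : b * w ^+ d.+1 = P.[w] - \sum_(i < d.+1) P`_i * w ^+ i.
      by rewrite PE addrC addKr.
    by apply: le_trans (cabsD _ _) _; rewrite cabsN lerD2l.
  have wd : 0 < cabs w ^+ d by rewrite exprn_gt0 // (lt_le_trans _ w1).
  have h2 : N <= cabs b / 2 * cabs w.
    have : 2 * N / cabs b <= cabs w by rewrite (le_trans _ rw) // /r; lra.
    by rewrite ler_pdivrMr //; lra.
  rewrite exprS in h1 *; set x := cabs w ^+ d in wd h1 *; set y := cabs w in h1 h2 w1 *.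
  have h3 : N * x <= cabs b / 2 * y * x by rewrite ler_pM2r.
  have h4 : a * (y * x) <= cabs b / 2 * (y * x).
    by rewrite ler_wpM2r // mulr_ge0 ?cabs_ge0 // ltW.
  lra.
split=> //.
  move=> rw; apply: le_trans (main rw).
  have w1 : 1 <= cabs w := le_trans r1 rw.
  have h2 : 2 <= a * cabs w.
    have : 2 / a <= cabs w by rewrite (le_trans _ rw) // /r; lra.
    by rewrite ler_pdivrMr // mulrC.
  case: d d2 {N N0 r ra0 rb0 r1 c rw Pd sP Pi PE low main} => // d _.
  have h3 : 1 <= cabs w ^+ d by rewrite exprn_ege1.
  rewrite !exprS; set x := cabs w ^+ d in h3 *; set y := cabs w in h2 w1 *.
  have -> : a * (y * (y * x)) = (a * y) * y * x by ring.
  rewrite -[leLHS]mulr1 ler_pM //; first by rewrite mulr_ge0 // (le_trans _ w1).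
  by rewrite ler_wpM2r // (le_trans _ w1).
set m := Num.max (cabs w) r.
have wm : cabs w <= m by rewrite le_max lexx.
have m1 : 1 <= m by rewrite le_max r1 orbT.
have m0 : 0 <= m := le_trans ler01 m1.
rewrite PE; apply: le_trans (cabsD _ _) _.
have h1 := low _ m1 wm.
have h2 : N * m ^+ d <= N * m ^+ d.+1 by rewrite ler_wpM2l // ler_weXn2l.
have h3 : cabs (b * w ^+ d.+1) <= cabs b * m ^+ d.+1.
  by rewrite cabsM cabsX ler_wpM2l ?cabs_ge0 // lerXn2r ?nnegrE ?cabs_ge0.
have h4 : 0 <= m ^+ d.+1 by rewrite exprn_ge0.
by rewrite /c; lra.
Qed.

(** Above [r] the sequence only grows, so a late value below [y] excludes an earlier one above
    [y]. *)
Lemma doubling_mono (x : nat -> R) (r y : R) n k : 0 < r ->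
  (forall n, r <= x n -> 2 * x n <= x n.+1) ->
  r <= y -> (k <= n)%N -> x n <= y -> x k <= y.
Proof.
move=> r0 h ry; elim: n => [|n IH]; first by rewrite leqn0 => /eqP->.
rewrite leq_eqVlt => /orP[/eqP->//|kn] xn; apply: IH => //.
rewrite leNgt; apply/negP => yx.
have rx : r <= x n by rewrite (le_trans ry) // ltW.
have := h n rx; lra.
Qed.

Lemma doubling_bounded (x : nat -> R) (r M : R) : 0 < r ->
  (forall n, r <= x n -> 2 * x n <= x n.+1) ->
  (forall n, x n <= M) -> forall n, x n <= r.
Proof.
move=> r0 h xM n; rewrite leNgt; apply/negP => rx.
have g k : 2 ^+ k * r <= x (k + n)%N.
  elim: k => [|k IH]; first by rewrite expr0 mul1r ltW.
  have p2 : 1 <= (2 : R) ^+ k by rewrite exprn_ege1 // ler1n.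
  have rk : r <= x (k + n)%N by rewrite (le_trans _ IH) // ler_peMl // ltW.
  by rewrite exprS -mulrA (le_trans _ (h _ rk)) // ler_pM2l.
have l12 : 1 < (2 : R) by rewrite ltr1n.
have [k hk] := expr_large (M / r) l12.
have := hk k (leqnn k); rewrite ltr_pdivrMr // => h1.
by have := le_lt_trans (xM (k + n)%N) (lt_le_trans h1 (g k)); rewrite ltxx.
Qed.

End Growth.

Section PlaneSets.
Variable R : realType.
Local Notation C := (Cplx R).
Implicit Types (K : set C) (P : {poly C}).

Lemma boundaryP K x : cclosed K ->
  boundary K x <-> K x /\ forall e : R, 0 < e -> exists2 y, ~ K y & cabs (x - y) < e.
Proof.
move=> cK; split.
  move=> [/closure_cplx cl ni]; split; first exact: cK.
  move=> e e0; apply: contrapT => h; apply: ni; apply/nbhs_cplx.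
  exists e => // y xy; apply: contrapT => nKy; apply: h; by exists y.
move=> [Kx h]; split; first by apply/closure_cplx => e e0; exists x; rewrite ?subrr ?cabs0.
by move=> /nbhs_cplx[e e0 sub]; have [y nKy /sub] := h e e0.
Qed.

Lemma poly_cont P x (e : R) : 0 < e ->
  exists2 r : R, 0 < r & forall y, cabs (x - y) < r -> cabs (P.[x] - P.[y]) < e.
Proof.
move=> e0; have [M M0 hM] := lipB_horner P (cabs x + 1).
have M1 : 0 < M + 1 by rewrite ltr_wpDl.
exists (Num.min 1 (e / (M + 1))) => [|y]; first by rewrite lt_min ltr01 divr_gt0.
rewrite lt_min => /andP[h1]; rewrite ltr_pdivlMr // => h2.
have xb : cabs x <= cabs x + 1 by rewrite lerDl.
have yb : cabs y <= cabs x + 1.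
  by rewrite (le_trans (cabs_le_add y x)) // lerD2l cabsB ltW.
have := hM x y x x xb yb xb xb; rewrite subrr cabs0 addr0 => h.
by apply: le_lt_trans h _; have := cabs_ge0 (x - y); lra.
Qed.

(** Continuity of [P] gives one direction, openness in the form of [root_near_eps] the other. *)
Lemma boundary_preimage K K' P x : (1 < size P)%N -> cclosed K -> cclosed K' ->
  (forall y, K' y <-> K P.[y]) -> boundary K' x <-> boundary K P.[x].
Proof.
move=> sP cK cK' KK'; split.
  move=> /(boundaryP _ cK')[K'x h]; apply/(boundaryP _ cK); split; first exact/KK'.
  move=> e e0; have [r r0 hr] := poly_cont P x e0.
  have [y nKy xy] := h r r0; exists P.[y]; last exact: hr.
  by move/KK'.
move=> /(boundaryP _ cK)[KPx h]; apply/(boundaryP _ cK'); split; first exact/KK'.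
move=> e e0; case sD : (size P) sP => [|[|D]] // _.
have lP0 : lead_coef P != 0 by rewrite lead_coef_eq0 -size_poly_gt0 sD.
have [r r0 hr] := root_near_eps D lP0 e0.
have [y nKy xy] := h r r0.
have [x' Px' hx'] := hr P (erefl _) sD x y xy.
by exists x' => // /KK'; rewrite Px'.
Qed.

(** The boundary point is the last point of [K] on the segment from [u] to [x]. *)
Lemma segment_boundary K u x : cclosed K -> K u -> ~ K x ->
  exists2 v, boundary K v & cabs (v - u) < cabs (x - u).
Proof.
move=> cK Ku nKx.
have xu : 0 < cabs (x - u).
  by rewrite cabs_gt0 subr_eq0; apply/eqP => xu; rewrite xu in nKx.
pose y (t : R) : C := u + (t%:C)%C * (x - u).
have dy s t : cabs (y s - y t) = `|s - t| * cabs (x - u).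
  have -> : y s - y t = ((s - t)%:C)%C * (x - u).
    by rewrite /y rmorphB /=; ring.
  rewrite cabsM; congr (_ * _); case: (lerP t s) => st.
    by rewrite cabs_real // subr_ge0.
  by rewrite -cabsN -rmorphN /= opprB cabs_real // subr_ge0 ltW.
have y0 : y 0 = u by rewrite /y mul0r addr0.
have y1 : y 1 = x by rewrite /y mul1r addrC subrK.
pose S : set R := [set t | 0 <= t <= 1 /\ K (y t)].
have S0 : S 0 by split; rewrite ?lexx ?ler01 // y0.
have hS : has_sup S by split; [exists 0|exists 1 => t [/andP[]]].
have s0 : 0 <= sup S by apply: sup_upper_bound.
have s1 : sup S <= 1 by apply: ge_sup; [exists 0|move=> t [/andP[]]].
have Ks : K (y (sup S)).
  apply: cK => e e0.
  have [t St tS] := sup_adherent (divr_gt0 e0 xu) hS.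
  exists (y t); first by case: St.
  have tle : t <= sup S by apply: sup_upper_bound.
  rewrite dy ger0_norm ?subr_ge0 // -ltr_pdivlMr //; lra.
have sN1 : sup S < 1.
  by rewrite lt_neqAle s1 andbT; apply/eqP => sE; rewrite sE y1 in Ks.
exists (y (sup S)); last first.
  by rewrite -[X in _ - X]y0 dy subr0 ger0_norm // gtr_pMl.
apply/(boundaryP _ cK); split=> // e e0.
pose t := sup S + Num.min (1 - sup S) (e / (2 * cabs (x - u))).
have m0 : 0 < Num.min (1 - sup S) (e / (2 * cabs (x - u))).
  by rewrite lt_min subr_gt0 sN1 divr_gt0 // mulr_gt0.
have t1 : t <= 1 by rewrite -lerBrDl ge_min lexx.
exists (y t).
  move=> Kt; have St : S t by split=> //; rewrite t1 andbT /t addr_ge0 // ltW.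
  by have := sup_upper_bound hS St; rewrite /t gerDl leNgt m0.
rewrite dy /t opprD addrA subrr sub0r normrN gtr0_norm //.
apply: le_lt_trans (_ : e / 2 < e); last by lra.
have : Num.min (1 - sup S) (e / (2 * cabs (x - u))) <= e / (2 * cabs (x - u)).
  by rewrite ge_min lexx orbT.
by rewrite ler_pdivlMr ?mulr_gt0 //; lra.
Qed.

End PlaneSets.

Section Iterates.
Variable R : realType.
Local Notation C := (Cplx R).
Variables (p : {poly C}) (q : {poly {poly C}}).
Local Notation Z n z := (iter n (horner p) z).
Local Notation Q z n := (fiber_iter p q z n).

Lemma iter_skew n z w :
  iter n (skew_map p q) (z, w) = (Z n z, (Q z n).[w]).
Proof.
elim: n => [|n IH]; first by rewrite /= hornerX.
by rewrite iterS IH /skew_map /= horner_comp.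
Qed.

Lemma iter_skewE n x :
  iter n (skew_map p q) x = (Z n x.1, (Q x.1 n).[x.2]).
Proof. by case: x => z w; exact: iter_skew. Qed.

Lemma fiber_iterD z m n : Q z (m + n) = Q (Z n z) m \Po Q z n.
Proof.
elim: m => [|m IH] /=; first by rewrite comp_polyX.
by rewrite IH comp_polyA iterD.
Qed.

Lemma fiber_iter1 z : Q z 1 = fiber q z.
Proof. by rewrite /= comp_polyXr. Qed.

Lemma horner_fiber_iterD z m n w :
  (Q z (m + n)).[w] = (Q (Z n z) m).[(Q z n).[w]].
Proof. by rewrite fiber_iterD horner_comp. Qed.

Lemma deriv_fiber_iterD z m n w : ((Q z (m + n))^`()).[w] =
  ((Q (Z n z) m)^`()).[(Q z n).[w]] * ((Q z n)^`()).[w].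
Proof. by rewrite fiber_iterD deriv_comp hornerM horner_comp. Qed.

Lemma horner_poly_iter n z : (poly_iter p n).[z] = Z n z.
Proof.
by elim: n => [|n IH]; rewrite ?hornerX // /poly_iter /= horner_comp IH.
Qed.

End Iterates.

(** * Constants extracted from the hypotheses *)

Section SetupDef.
Variable R : realType.
Local Notation C := (Cplx R).
Variables (d : nat) (p : {poly C}) (q : {poly {poly C}}) (b : C).
Variables (B r a c ce L : R).

(* [B] and [r] are escape radii of [p] and of the fibre maps over [|z| <= B]. *)
Record setup : Prop := Setup {
  st_d : (2 <= d)%N;
  st_sp : size p = d.+1;
  st_sq : size q = d.+1;
  st_lq : lead_coef q = b%:P;
  st_b : b != 0;
  st_B : 1 <= B;
  st_p : forall z, B <= cabs z -> 2 * cabs z <= cabs p.[z];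
  st_r : 1 <= r;
  st_q : forall z w, cabs z <= B -> r <= cabs w ->
    2 * cabs w <= cabs (fiber q z).[w];
  st_a : 0 < a <= 1;
  st_qa : forall z w, cabs z <= B -> r <= cabs w ->
    a * cabs w ^+ d <= cabs (fiber q z).[w];
  st_c : 1 <= c;
  st_qc : forall z w, cabs z <= B ->
    cabs (fiber q z).[w] <= c * Num.max (cabs w) r ^+ d;
  st_ce : 0 < ce;
  st_L : 1 < L;
  st_base : forall z n, julia p z -> (0 < n)%N ->
    ce * L ^+ n <= cabs ((poly_iter p n)^`()).[z];
  st_vert : forall z w n, julia p z -> fiber_julia p q z w -> (0 < n)%N ->
    ce * L ^+ n <= cabs ((fiber_iter p q z n)^`()).[w]
}.

End SetupDef.

Lemma setup_exists (R : realType) d (p : {poly Cplx R}) (q : {poly {poly Cplx R}}) :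
  skew_product d p q -> axiomA p q ->
  exists b B r a c ce L, setup d p q b B r a c ce L.
Proof.
move=> /skew_structure[d2 sp sq [b b0 lq]] [[c1 [L1 [c10 L11 h1]]] [c2 [L2 [c20 L21 h2]]] _].
have Mp : exists2 M : R, 0 <= M & forall i, (i < d)%N -> cabs p`_i <= M.
  elim: (d) => [|n [M M0 hM]]; first by exists 0.
  exists (M + cabs p`_n); first by rewrite addr_ge0 ?cabs_ge0.
  move=> i; rewrite ltnS leq_eqVlt => /orP[/eqP->|/hM h]; first by rewrite lerDr.
  by rewrite (le_trans h) // lerDl cabs_ge0.
have [M M0 hM] := Mp.
have bp0 : p`_d != 0.
  by rewrite -[X in p`_X]/(d.+1.-1) -sp -lead_coefE lead_coef_eq0 -size_poly_gt0 sp.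
have [B [aB [cB [B1 _ _ hB]]]] := growth_poly d2 bp0 M0.
have [N N0 hN] := fiber_coef_bound q B d.
have [r [a [c [r1 a01 c1' hr]]]] := growth_poly d2 b0 N0.
have hq z w : cabs z <= B ->
    [/\ r <= cabs w -> 2 * cabs w <= cabs (fiber q z).[w],
     r <= cabs w -> a * cabs w ^+ d <= cabs (fiber q z).[w] &
     cabs (fiber q z).[w] <= c * Num.max (cabs w) r ^+ d].
  move=> zB; have [s1 l1] := fiber_size z sq lq b0.
  by apply: hr => // [|i id]; [rewrite -[RHS]l1 lead_coefE s1|exact: hN].
have cL (x y X Y : R) n : 0 < y -> 1 < X -> x <= y -> 1 < Y -> Y <= X ->
    x * Y ^+ n <= y * X ^+ n.
  move=> y0 X1 xy Y1 YX.
  have Y0 : 0 <= Y := le_trans ler01 (ltW Y1).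
  apply: le_trans (_ : y * Y ^+ n <= _); first by rewrite ler_wpM2r ?exprn_ge0.
  by rewrite ler_pM2l // lerXn2r ?nnegrE // (le_trans Y0).
exists b, B, r, a, c, (Num.min c1 c2), (Num.min L1 L2).
have min0 : 0 < Num.min c1 c2 by rewrite lt_min c10.
have min1 : 1 < Num.min L1 L2 by rewrite lt_min L11.
refine (Setup d2 sp sq lq b0 B1 _ r1 _ a01 _ c1' _ min0 min1 _ _).
- by move=> z; have [h _ _] := hB p sp (erefl _) hM z; exact: h.
- by move=> z w zB; have [h _ _] := hq z w zB; exact: h.
- by move=> z w zB; have [_ h _] := hq z w zB; exact: h.
- by move=> z w zB; have [_ _ h] := hq z w zB; exact: h.
- move=> z n Jz n0; have := h1 z n Jz n0; rewrite cabsE lecR; apply: le_trans.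
  by apply: cL c10 L11 _ min1 _; rewrite ge_min lexx.
- move=> z w n Jz Jw n0; have := h2 z w n Jz Jw n0; rewrite cabsE lecR; apply: le_trans.
  by apply: cL c20 L21 _ min1 _; rewrite ge_min lexx orbT.
Qed.

(** * Vertical expansion and contraction *)

Opaque horner.

Section Dynamics.
Variable R : realType.
Local Notation C := (Cplx R).
Variables (d : nat) (p : {poly C}) (q : {poly {poly C}}) (b : C).
Variables (B r a c ce L : R).
Hypothesis S : setup d p q b B r a c ce L.
Local Notation Z n z := (iter n (horner p) z).
Local Notation Q z n := (fiber_iter p q z n).
Local Notation W z n w := ((fiber_iter p q z n).[w]).
Local Notation dW z n w := ((fiber_iter p q z n)^`()).[w].
Local Notation Kz z w := (filled_julia2 p q (z, w)).
Local Notation Jz z w := (fiber_julia p q z w).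

Lemma B_gt0 : 0 < B. Proof. exact: lt_le_trans ltr01 (st_B S). Qed.
Lemma r_gt0 : 0 < r. Proof. exact: lt_le_trans ltr01 (st_r S). Qed.
Lemma d_gt0 : (0 < d)%N. Proof. exact: leq_trans (st_d S). Qed.

Lemma filled_juliaP z : filled_julia p z <-> forall n, cabs (Z n z) <= B.
Proof.
split=> [/bounded_cplx[M hM]|h]; last by apply/bounded_cplx; exists B.
apply: (doubling_bounded (x := fun n => cabs (Z n z)) B_gt0 _ hM) => n.
exact: (st_p S).
Qed.

Lemma lip_cont (g : C -> C -> C) x (e : R) : lipB g -> 0 < e ->
  exists2 s : R, 0 < s & forall y, near2 s x y ->
    cabs (g x.1 x.2 - g y.1 y.2) < e.
Proof.
move=> lg e0; pose D := cabs x.1 + cabs x.2 + 1.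
have [M M0 hM] := lg D.
have M1 : 0 < M + 1 by rewrite ltr_wpDl.
exists (Num.min 1 (e / (2 * (M + 1)))) => [|y [h1 h2]].
  by rewrite lt_min ltr01 divr_gt0 // mulr_gt0.
have x1 := cabs_ge0 x.1; have x2 := cabs_ge0 x.2.
have y1 := cabs_le_add y.1 x.1; have y2 := cabs_le_add y.2 x.2.
rewrite cabsB in y1; rewrite [cabs (y.2 - _)]cabsB in y2.
move: h1 h2; rewrite !lt_min => /andP[h1 h1'] /andP[h2 h2'].
apply: le_lt_trans (hM _ _ _ _ _ _ _ _) _; rewrite /D; try lra.
apply: le_lt_trans (_ : (M + 1) * (cabs (x.1 - y.1) + cabs (x.2 - y.2)) < _).
  by rewrite ler_wpM2r ?lerDl // addr_ge0 ?cabs_ge0.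
by rewrite mulrC -ltr_pdivlMr //; move: h1' h2'; rewrite invfM; lra.
Qed.

Lemma filled_julia_closed : cclosed (filled_julia p).
Proof.
move=> z h; apply/filled_juliaP => n; rewrite leNgt; apply/negP => Bn.
have e0 : 0 < cabs (Z n z) - B by rewrite subr_gt0.
have [s s0 hs] := lip_cont (z, 0) (lipB_iter p n) e0.
have [y /filled_juliaP/(_ n) Ky zy] := h s s0.
have := hs (y, 0); rewrite /near2 /= subrr cabs0 => /(_ (conj zy s0)).
have := cabs_le_add (Z n z) (Z n y); lra.
Qed.

Lemma boundary_closed (K : set C) : cclosed K -> cclosed (boundary K).
Proof.
move=> cK x h; apply/(boundaryP _ cK); split.
  apply: (cK) => e /h[y /(boundaryP _ cK)[Ky _] xy]; by exists y.
move=> e e0; have [y /(boundaryP _ cK)[_ Jy] xy] := h _ (divr_gt0 e0 (ltr0Sn R 1)).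
have [u Ku yu] := Jy _ (divr_gt0 e0 (ltr0Sn R 1)); exists u => //.
by rewrite [e]splitr; apply: le_lt_trans (cabs_tri y _ _) (ltrD _ _).
Qed.

Lemma julia_closed : cclosed (julia p).
Proof. exact: boundary_closed filled_julia_closed. Qed.

Lemma julia_filled z : julia p z -> filled_julia p z.
Proof. by move=> /(boundaryP _ filled_julia_closed)[]. Qed.

Lemma julia_bound z : julia p z -> cabs z <= B.
Proof. by move=> /julia_filled/filled_juliaP/(_ 0%N). Qed.

Lemma julia_step z : julia p z <-> julia p p.[z].
Proof.
apply: boundary_preimage; [|exact: filled_julia_closed..|].
  by rewrite (st_sp S) ltnS d_gt0.
move=> y; split=> /filled_juliaP h; apply/filled_juliaP => n.
  by have := h n.+1; rewrite iterSr.
case: n => [|n]; last by have := h n; rewrite -iterSr.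
rewrite /= leNgt; apply/negP => By.
by have := st_p S (ltW By); have := h 0%N; have := B_gt0; rewrite /=; lra.
Qed.

Lemma julia_iter n z : julia p z <-> julia p (Z n z).
Proof.
elim: n => [|n IH]; first by split.
by rewrite iterS; exact: iff_trans IH (julia_step _).
Qed.

Lemma juliaZ n z : julia p z -> julia p (Z n z).
Proof. by move/julia_iter. Qed.

Lemma fiber_doubling z w : julia p z ->
  forall n, r <= cabs (W z n w) -> 2 * cabs (W z n w) <= cabs (W z n.+1 w).
Proof.
move=> jz n rn; rewrite /= horner_comp; apply: (st_q S) => //.
by apply/julia_bound/juliaZ.
Qed.

Lemma escape_mono z w (y : R) k n : julia p z -> r <= y -> (k <= n)%N ->
  cabs (W z n w) <= y -> cabs (W z k w) <= y.
Proof.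
move=> jz; apply: (doubling_mono (x := fun n => cabs (W z n w)) r_gt0).
exact: fiber_doubling.
Qed.

Lemma KzP z w : julia p z -> Kz z w <-> forall n, cabs (W z n w) <= r.
Proof.
move=> jz; split.
  move=> /bounded_cplx2[M hM].
  apply: (doubling_bounded (x := fun n => cabs (W z n w)) (M := M) r_gt0).
    exact: fiber_doubling.
  by move=> n; have [_] := hM n; rewrite iter_skew.
move=> h; apply/bounded_cplx2; exists (B + r) => n; rewrite iter_skew /=.
have := julia_bound (juliaZ n jz); have := h n; have := B_gt0; have := r_gt0.
by move=> ? ? ? ?; split; lra.
Qed.

Lemma Kz_bound z w : julia p z -> Kz z w -> cabs w <= r.
Proof. by move=> jz /(KzP _ jz)/(_ 0%N); rewrite hornerX. Qed.

Lemma W_cont z w n (e : R) : 0 < e -> exists2 s : R, 0 < s &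
  forall z' w', cabs (z - z') < s -> cabs (w - w') < s ->
  cabs (W z n w - W z' n w') < e.
Proof.
move=> e0; have [gn _ _] := goodF_iter p q n.
have [s s0 hs] := lip_cont (z, w) gn e0; exists s => // z' w' h1 h2.
exact: (hs (z', w')).
Qed.

Lemma Kz_closed2 z w : julia p z ->
  (forall e : R, 0 < e -> exists z' w',
     [/\ julia p z', Kz z' w', cabs (z - z') < e & cabs (w - w') < e]) -> Kz z w.
Proof.
move=> jz h; apply/KzP => // n; rewrite leNgt; apply/negP => rn.
have e0 : 0 < cabs (W z n w) - r by rewrite subr_gt0.
have [s s0 hs] := W_cont z w n e0.
have [z' [w' [jz' /(KzP _ jz')/(_ n) K' h1 h2]]] := h s s0.
have := hs _ _ h1 h2; have := cabs_le_add (W z n w) (W z' n w'); lra.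
Qed.

Lemma Kz_closed z : julia p z -> cclosed [set w | Kz z w].
Proof.
move=> jz w h; apply: Kz_closed2 => // e e0.
by have [y Ky wy] := h e e0; exists z, y; rewrite subrr cabs0.
Qed.

Lemma Kz_iter n z w : julia p z -> Kz z w <-> Kz (Z n z) (W z n w).
Proof.
move=> jz; have jn := juliaZ n jz; split=> [/(KzP _ jz) h|/(KzP _ jn) h].
  by apply/KzP => // k; rewrite -horner_fiber_iterD.
apply/KzP => // k; apply: (escape_mono (n := (k + n)%N)) => //; first by rewrite leq_addr.
by rewrite horner_fiber_iterD.
Qed.

Lemma fiber_iter_szn z n : size (Q z n) = (d ^ n).+1.
Proof. by have [] := fiber_iter_size p z n d_gt0 (st_sq S) (st_lq S) (st_b S). Qed.

Lemma fiber_iter_lead z n : lead_coef (Q z n) = iter_lead b d n.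
Proof. by have [] := fiber_iter_size p z n d_gt0 (st_sq S) (st_lq S) (st_b S). Qed.

Lemma Jz_iter n z w : julia p z -> Jz z w <-> Jz (Z n z) (W z n w).
Proof.
move=> jz; apply: boundary_preimage.
- by rewrite fiber_iter_szn ltnS expn_gt0 d_gt0.
- exact/Kz_closed/juliaZ.
- exact: Kz_closed.
- by move=> y; exact: Kz_iter.
Qed.

Lemma Jz_Kz z w : julia p z -> Jz z w -> Kz z w.
Proof. by move=> jz /(boundaryP _ (Kz_closed jz))[]. Qed.

Lemma Jz_bound z w : julia p z -> Jz z w -> cabs w <= r.
Proof. by move=> jz /(Jz_Kz jz); exact: Kz_bound. Qed.

Lemma root_lift n (e : R) : 0 < e -> exists2 s : R, 0 < s &
  forall z w v, cabs (W z n w - v) < s ->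
  exists2 x, W z n x = v & cabs (w - x) < e.
Proof.
move=> e0; have dn : (0 < d ^ n)%N by rewrite expn_gt0 d_gt0.
have [s s0 hs] := root_near_eps (d ^ n).-1 (iter_lead_neq0 d n (st_b S)) e0.
exists s => // z w v h; apply: hs h; first exact: fiber_iter_lead.
by rewrite fiber_iter_szn prednK.
Qed.

(** A linear factor of at least 4 survives a quadratic Taylor error of at most [2 * x] as the factor
    2; this is the origin of the threshold 4 throughout. *)
Lemma expansion_step (A x M y l : R) :
  4 <= l -> l * x - M * x ^+ 2 <= y -> 0 <= x -> M * x <= 2 -> 2 * x <= y.
Proof.
move=> l4 h x0 Mx.
have : M * x ^+ 2 <= 2 * x by rewrite expr2 mulrA ler_wpM2r.
have : 4 * x <= l * x by rewrite ler_wpM2r.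
lra.
Qed.

(** On [K] the conditions [far] and [safe] coincide ([far_safe], [safe_far]). The first is what
    expansion propagates, and it makes sense outside [K]; the second provides the discs for the
    Cauchy estimate. *)
Definition far (t : R) z w := forall v, Jz z v -> t <= cabs (w - v).
Definition safe (t : R) z w := forall x, cabs (x - w) < t -> Kz z x.

Lemma far_safe t z w : julia p z -> Kz z w -> far t z w -> safe t z w.
Proof.
move=> jz Kw fw x xw; apply: contrapT => nKx.
have [v Jv vw] := segment_boundary (Kz_closed jz) Kw nKx.
by have := fw v Jv; rewrite cabsB leNgt (lt_trans vw).
Qed.

Lemma safe_Kz t z w : 0 < t -> safe t z w -> Kz z w.
Proof. by move=> t0; apply; rewrite subrr cabs0. Qed.

Lemma safe_far t z w : julia p z -> safe t z w -> far t z w.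
Proof.
move=> jz sw v /(boundaryP _ (Kz_closed jz))[_ Jv].
rewrite leNgt; apply/negP => wv.
have e0 : 0 < t - cabs (w - v) by rewrite subr_gt0.
have [y nKy vy] := Jv _ e0; apply: nKy; apply: sw.
apply: le_lt_trans (cabs_tri v _ _) _.
by rewrite [cabs (y - v)]cabsB [cabs (v - w)]cabsB -ltrBrDr.
Qed.

Lemma far_le s t z w : s <= t -> far t z w -> far s z w.
Proof. by move=> st fw v Jv; exact: le_trans (fw v Jv). Qed.

Let D := B + r + 2.

Lemma juliaD z : julia p z -> cabs z <= D.
Proof. by move/julia_bound; have := r_gt0; rewrite /D; lra. Qed.

(* The root of [Q_z^m = v1] nearest to [w] lies on [J_z], where [Q_z^m] expands
   at least by the factor 4. *)
Lemma expand_far m : (0 < m)%N -> 4 <= ce * L ^+ m ->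
  exists2 eta : R, 0 < eta & forall s z w, julia p z -> 2 * s <= eta ->
    far s z w -> far (2 * s) (Z m z) (W z m w).
Proof.
move=> m0 exm; have [_ _ tm] := goodF_iter p q m; have [M M0 hM] := tm D.
have M1 : 0 < M + 1 by rewrite ltr_wpDl.
have e0 : 0 < Num.min 1 (2 / (M + 1)) by rewrite lt_min ltr01 divr_gt0.
have [eta eta0 heta] := root_lift m e0.
exists eta; first exact: eta0.
move=> s z w jz s2 fw v1 Jv1; rewrite leNgt; apply/negP => wv1.
have [v Wv] := heta z w v1 (lt_le_trans wv1 s2).
rewrite lt_min => /andP[wv wv'].
have Jv : Jz z v by apply/(Jz_iter m _ jz); rewrite Wv.
have vr := Jz_bound jz Jv; have B0 := B_gt0; have r0 := r_gt0.
have wD : cabs w <= D by have := cabs_le_add w v; rewrite /D; lra.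
have vD : cabs v <= D by rewrite /D; lra.
have T := hM z w v (juliaD jz) wD vD; rewrite Wv in T.
have ex := le_trans exm (st_vert S jz Jv m0).
have h : cabs (dW z m v) * cabs (w - v) - M * cabs (w - v) ^+ 2 <= cabs (W z m w - v1).
  rewrite -cabsM lerBlDr; apply: le_trans (cabs_le_add _ (W z m w - v1)) _.
  by rewrite lerD2l cabsB.
have Mx : M * cabs (w - v) <= 2.
  by move: wv'; rewrite ltr_pdivlMr //; have := cabs_ge0 (w - v); lra.
have := expansion_step 0 ex h (cabs_ge0 _) Mx.
by have := fw v Jv; lra.
Qed.

(** On [J] the vertical derivative has modulus at least [ce * L], and it is Lipschitz, so its zeros
    keep a definite distance. *)
Lemma crit_far : exists2 s : R, 0 < s & forall z w, julia p z ->
  ((fiber q z)^`()).[w] = 0 -> far s z w.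
Proof.
have [_ l1 _] := goodF_fiber q; have [M M0 hM] := l1 D.
have M1 : 0 < M + 1 by rewrite ltr_wpDl.
have cL : 0 < ce * L by rewrite mulr_gt0 ?(st_ce S) // (lt_trans ltr01 (st_L S)).
exists (Num.min 1 (ce * L / (M + 1))) => [|z w jz cw v Jv].
  by rewrite lt_min ltr01 divr_gt0.
rewrite leNgt; apply/negP; rewrite lt_min => /andP[h1]; rewrite ltr_pdivlMr // => h2.
have vr := Jz_bound jz Jv; have B0 := B_gt0; have r0 := r_gt0.
have wD : cabs w <= D by have := cabs_le_add w v; rewrite /D; lra.
have vD : cabs v <= D by rewrite /D; lra.
have := hM z z w v (juliaD jz) (juliaD jz) wD vD.
rewrite cw sub0r cabsN subrr cabs0 add0r => h3.
have := st_vert S jz Jv (ltnSn 0); rewrite fiber_iter1 expr1 => h4.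
by have := cabs_ge0 (w - v); lra.
Qed.

Lemma far_iter n (s : R) : 0 < s -> exists2 t : R, 0 < t & forall z w,
  julia p z -> far s z w -> far t (Z n z) (W z n w).
Proof.
move=> s0; have [t t0 ht] := root_lift n s0; exists t; first exact: t0.
move=> z w jz fw v1 Jv1.
rewrite leNgt; apply/negP => /ht[v Wv wv].
have Jv : Jz z v by apply/(Jz_iter n _ jz); rewrite Wv.
by have := fw v Jv; rewrite leNgt wv.
Qed.

Lemma far_iter_all n (s : R) : 0 < s -> exists2 t : R, 0 < t & forall k z w,
  (k < n)%N -> julia p z -> far s z w -> far t (Z k z) (W z k w).
Proof.
move=> s0; elim: n => [|n [t t0 ht]].
  by exists 1; [exact: ltr01|move=> k z w k0; exfalso; move: k0; rewrite ltn0].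
have [t' t'0 ht'] := far_iter n s0.
exists (Num.min t t') => [|k z w]; first by rewrite lt_min t0.
rewrite ltnS leq_eqVlt => /orP[/eqP->|kn] jz fw.
  by apply: far_le (ht' _ _ jz fw); rewrite ge_min lexx orbT.
by apply: far_le (ht _ _ _ kn jz fw); rewrite ge_min lexx.
Qed.

(* The part of [K] over [J_p] whose whole forward orbit stays at vertical
   distance at least [t] from the fibre Julia sets. *)
Definition Lset (t : R) z w :=
  julia p z /\ forall n, safe t (Z n z) (W z n w).

Lemma Lset_iter t n z w : Lset t z w -> Lset t (Z n z) (W z n w).
Proof.
move=> [jz h]; split; first exact: juliaZ.
by move=> k; rewrite -iterD -horner_fiber_iterD.
Qed.

Lemma Lset_safe t z w : Lset t z w -> safe t z w.
Proof. by move=> [_ /(_ 0%N)]; rewrite hornerX. Qed.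

Lemma deriv_dilation (k u : C) :
  ('X + k%:P * ('X - u%:P))^`() = (1 + k)%:P :> {poly C}.
Proof.
by rewrite derivD derivX mul_polyC derivZ derivXsubC alg_polyC polyCD polyC1.
Qed.

(* Composing [Q^m] with the dilations [x |-> x + kappa (x - u_k)] centred at the
   orbit still maps a disc into [K], while multiplying the derivative at the
   centre by [(1 + kappa)^k]; the Cauchy estimate then bounds it. *)
Lemma Lset_contraction m (eta t : R) : 0 < t -> 4 * t <= eta ->
  (forall s z w, julia p z -> 2 * s <= eta ->
    far s z w -> far (2 * s) (Z m z) (W z m w)) ->
  exists2 A : R * R, 0 < A.2 & forall z u k, Lset (2 * t) z u ->
    (1 + A.2) ^+ k * cabs (dW z (k * m) u) <= A.1.
Proof.
move=> t0 t4 step; have r0 := r_gt0.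
(* Points of a fibre of [K] are at most [2 * r] apart, so the dilation moves them by at most [t].
   One application of [Q^m] improves safety from [t] to [2 * t], and the dilation spends exactly
   this gain; [Phi_safe] is the resulting invariant. *)
pose kap := t / (2 * r); have kap0 : 0 < kap by rewrite divr_gt0 // mulr_gt0.
exists (2 * r / t, kap) => //= z u k [jz sz].
pose uk j := W z (j * m) u.
pose phi j : {poly C} := 'X + ((kap%:C)%C)%:P * ('X - (uk j)%:P).
pose Phi := fix Phi j := if j is i.+1 then
  phi i.+1 \Po (Q (Z (i * m) z) m \Po Phi i) else 'X.
have Phi_safe j x : cabs (x - u) < t -> safe t (Z (j * m) z) (Phi j).[x].
  move=> xu; elim: j => [|j IH].
    rewrite /= hornerX => y yx.
    have s0 : safe (2 * t) z u by have := sz 0%N; rewrite hornerX.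
    apply: s0; apply: le_lt_trans (cabs_tri x _ _) _.
    have -> : 2 * t = t + t by lra.
    exact: ltrD.
  have jj := juliaZ (j * m) jz.
  set y := W (Z (j * m) z) m (Phi j).[x].
  have Ej : Z (j.+1 * m) z = Z m (Z (j * m) z) by rewrite mulSn iterD.
  have s1 : safe (2 * t) (Z (j.+1 * m) z) y.
    rewrite Ej; apply: (far_safe (juliaZ m jj)).
      by apply: (proj1 (Kz_iter m _ jj)); exact: safe_Kz t0 IH.
    by apply: (step t _ _ jj); [lra|exact: safe_far jj IH].
  have PE : (Phi j.+1).[x] = y + (kap%:C)%C * (y - uk j.+1).
    by rewrite /= !horner_comp /phi !hornerE.
  have jj1 := juliaZ (j.+1 * m) jz.
  have yr : cabs y <= r.
    by apply: (Kz_bound jj1); apply: safe_Kz s1; rewrite mulr_gt0.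
  have ur : cabs (uk j.+1) <= r.
    by apply: (Kz_bound jj1); apply: safe_Kz (sz _); rewrite mulr_gt0.
  move=> v vx; apply: s1; apply: le_lt_trans (cabs_tri (Phi j.+1).[x] _ _) _.
  have -> : 2 * t = t + t by lra.
  apply: ltr_leD => //; rewrite PE addrAC subrr add0r cabsM cabs_real ?(ltW kap0) //.
  rewrite /kap mulrAC ler_pdivrMr ?mulr_gt0 // ler_pM2l //.
  by apply: le_trans (cabsD _ _) _; rewrite cabsN; lra.
have Phi_u j : (Phi j).[u] = uk j.
  elim: j => [|j IH]; first by rewrite /uk !hornerX.
  rewrite /= !horner_comp IH.
  have -> : W (Z (j * m) z) m (uk j) = uk j.+1.
    by rewrite /uk -horner_fiber_iterD -mulSn.
  by rewrite /phi !hornerE subrr mulr0 addr0.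
have dPhi j : ((Phi j)^`()).[u] = ((1 + kap)%:C)%C ^+ j * dW z (j * m) u.
  elim: j => [|j IH]; first by rewrite /= expr0 mul1r.
  rewrite /= !deriv_comp !hornerM !horner_comp IH Phi_u.
  rewrite mulSn deriv_fiber_iterD.
  have -> : ((phi j.+1)^`()) = (((1 + kap)%:C)%C)%:P.
    rewrite deriv_dilation; congr (_%:P).
    by rewrite [in RHS]rmorphD rmorph1.
  by rewrite hornerC exprS; ring.
have t2 : 0 < t / 2 by rewrite divr_gt0.
have := cauchy_estimate (P := Phi k) (u := u) (M := r) t2.
rewrite dPhi cabsM cabsX cabs_real ?addr_ge0 ?(ltW kap0) // => H.
have {}H := H _; rewrite ler_pdivlMr //.
have : t / 2 * ((1 + kap) ^+ k * cabs (dW z (k * m) u)) <= r.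
  apply: H => x xu; apply: (Kz_bound (juliaZ (k * m) jz)).
  by apply: (safe_Kz t0); apply: Phi_safe; rewrite xu; lra.
lra.
Qed.

(** [tau] lies below the distance to [J] of the first [m] iterates of critical points and within the
    range of [expand_far], so each further block of [m] steps doubles the distance [tau] and never
    loses it. [N] is a multiple of [m] at which the exponential gain of [Lset_contraction], applied
    with [tau / 2], beats [4 * A]. *)
Lemma contraction_constants : exists tau N, [/\ 0 < tau, (0 < N)%N,
  4 <= ce * L ^+ N,
  forall z w n, julia p z -> ((fiber q z)^`()).[w] = 0 ->
    far tau (Z n z) (W z n w) &
  forall z w, Lset tau z w -> cabs (dW z N w) <= 1 / 4].
Proof.
have [m1 hm1] := expr_large (4 / ce) (st_L S).
have exn n : (m1 <= n)%N -> 4 <= ce * L ^+ n.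
  by move=> /hm1; rewrite ltr_pdivrMr ?(st_ce S) // mulrC; exact: ltW.
pose m := m1.+1; have exm : 4 <= ce * L ^+ m by apply: exn; exact: leqnSn.
have [eta eta0 step] := expand_far (ltn0Sn m1) exm.
have [s0 s00 hs0] := crit_far.
have [s1 s10 hs1] := far_iter_all m s00.
pose tau := Num.min s1 (eta / 2).
have tau0 : 0 < tau by rewrite lt_min s10 divr_gt0.
have tau2 : 2 * tau <= eta.
  have : tau <= eta / 2 by rewrite ge_min lexx orbT.
  lra.
have t20 : 0 < tau / 2 by rewrite divr_gt0.
have t24 : 4 * (tau / 2) <= eta by lra.
have [[A kap] kap0 hA] := Lset_contraction t20 t24 step.
have kap1 : 1 < 1 + kap by rewrite ltrDl; exact: kap0.
have [k hk] := expr_large (4 * A) kap1.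
have kk : (0 < k.+1)%N by [].
exists tau, (k.+1 * m)%N; split=> //.
- by apply: exn; rewrite (leq_trans (leqnSn m1)) // leq_pmull.
- move=> z w n jz cw.
  rewrite (divn_eq n m) iterD horner_fiber_iterD.
  have jn := juliaZ (n %% m) jz.
  have : far tau (Z (n %% m) z) (W z (n %% m) w).
    apply: far_le (hs1 _ _ _ _ jz (hs0 _ _ jz cw)); rewrite ?ltn_pmod //.
    by rewrite ge_min lexx.
  move: jn; set z1 := Z _ z; set w1 := W z _ w => jz1 f1.
  elim: (n %/ m)%N => [|j IH]; first by rewrite /= hornerX.
  rewrite mulSn iterD horner_fiber_iterD.
  apply: far_le (step _ _ _ (juliaZ _ jz1) tau2 IH); lra.
move=> z w Lz; have := hA z w k.+1; have -> : 2 * (tau / 2) = tau by lra.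
move=> /(_ Lz) /= h1.
have h2 : 4 * A < (1 + kap) ^+ k.+1 by apply: hk.
have p0 : 0 < (1 + kap) ^+ k.+1 by rewrite exprn_gt0 // addr_gt0.
have h3 : (1 + kap) ^+ k.+1 * (4 * cabs (dW z (k.+1 * m) w)) <= (1 + kap) ^+ k.+1 * 1 by lra.
by rewrite ler_pM2l // in h3; lra.
Qed.

End Dynamics.

(** * Closing lemma *)

Section Closing.
Variable R : realType.
Local Notation C := (Cplx R).
Variables (d : nat) (p : {poly C}) (q : {poly {poly C}}) (b : C).
Variables (B r a c ce L : R).
Hypothesis S : setup d p q b B r a c ce L.
Variables (tau : R) (N : nat).
Hypothesis tau0 : 0 < tau.
Hypothesis N0 : (0 < N)%N.
Hypothesis expN : 4 <= ce * L ^+ N.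
Local Notation Z n z := (iter n (horner p) z).
Local Notation W z n w := ((fiber_iter p q z n).[w]).
Local Notation dW z n w := ((fiber_iter p q z n)^`()).[w].
Hypothesis conN : forall z w, Lset p q tau z w -> cabs (dW z N w) <= 1 / 4.

(** [A.1] is the radius of a neighbourhood on which the contraction persists, [A.2] the cost of
    changing the base point. The new base point [z'] has only to be close to [z], which is what
    shadowing in other fibres requires. *)
Lemma robust_contraction : exists A : R * R, [/\ 0 < A.1 <= 1, 0 <= A.2,
  forall z w z' y y', Lset p q tau z w -> cabs (z' - z) <= A.1 ->
    cabs (y - w) <= A.1 -> cabs (y' - w) <= A.1 ->
    cabs (dW z' N y') <= 1 / 2 /\
    cabs (W z' N y - W z' N y') <= cabs (y - y') / 2 &
  forall z z' y, cabs z <= B + 1 -> cabs z' <= B + 1 -> cabs y <= r + 1 ->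
    cabs (W z N y - W z' N y) <= A.2 * cabs (z - z')].
Proof.
have [l0 l1 tN] := goodF_iter p q N; pose D := B + r + 2.
have B0 := B_gt0 S; have r0 := r_gt0 S.
have [M0 M00 hM0] := l0 D; have [M1 M10 hM1] := l1 D; have [M2 M20 hM2] := tN D.
have M12 : 0 < 8 * (M1 + M2 + 1) by rewrite mulr_gt0 // ltr_wpDl // addr_ge0.
(* The change [2 * rho * M1] of the derivative and the Taylor error [2 * rho * M2] together stay
   below the [1 / 4] that separates the bounds [1 / 4] and [1 / 2]. *)
pose rho := Num.min 1 (1 / (8 * (M1 + M2 + 1))).
have rho0 : 0 < rho by rewrite lt_min ltr01 divr_gt0.
have rho1 : rho <= 1 by rewrite ge_min lexx.
have rhoM : rho * (M1 + M2) <= 1 / 8.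
  have : rho <= 1 / (8 * (M1 + M2 + 1)) by rewrite ge_min lexx orbT.
  rewrite ler_pdivlMr //; lra.
exists (rho, M0); split=> [||z w z' y y' Lz zz yw yw'|z z' y zB zB' yr].
- by rewrite /= rho0.
- exact: M00.
- move: zz yw yw' => /= zz yw yw'.
  have jz : julia p z by case: Lz.
  have wr := Kz_bound S jz (safe_Kz tau0 (Lset_safe Lz)).
  have zB := julia_bound S jz.
  have zD : cabs z <= D by rewrite /D; lra.
  have wD : cabs w <= D by rewrite /D; lra.
  have zD' : cabs z' <= D by have := cabs_le_add z' z; rewrite /D; lra.
  have yD : cabs y <= D by have := cabs_le_add y w; rewrite /D; lra.
  have yD' : cabs y' <= D by have := cabs_le_add y' w; rewrite /D; lra.
  have dy : cabs (dW z' N y') <= 1 / 4 + M1 * (2 * rho).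
    apply: le_trans (cabs_le_add _ (dW z N w)) _; apply: lerD; first exact: conN.
    apply: le_trans (hM1 _ _ _ _ zD' zD yD' wD) _.
    by rewrite ler_wpM2l //; lra.
  have M2r : 0 <= M2 * rho by rewrite mulr_ge0 // ltW.
  have M1r : 0 <= M1 * rho by rewrite mulr_ge0 // ltW.
  split; first by lra.
  have T := hM2 z' y y' zD' yD yD'.
  apply: le_trans (cabs_le_add _ (dW z' N y' * (y - y'))) _.
  have yy : cabs (y - y') <= 2 * rho.
    by apply: le_trans (cabs_tri w _ _) _; rewrite [cabs (w - _)]cabsB; lra.
  have y0 := cabs_ge0 (y - y').
  have h1 : M2 * cabs (y - y') ^+ 2 <= M2 * (2 * rho) * cabs (y - y').
    by rewrite expr2 mulrA ler_wpM2r // ler_wpM2l.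
  rewrite cabsM.
  have h2 : cabs (dW z' N y') * cabs (y - y') <= (1 / 4 + M1 * (2 * rho)) * cabs (y - y').
    by rewrite ler_wpM2r.
  have h3 : (1 / 4 + M1 * (2 * rho) + M2 * (2 * rho)) * cabs (y - y') <= (1 / 2) * cabs (y - y').
    by rewrite ler_wpM2r //; lra.
  lra.
have := hM0 z z' y y; rewrite subrr cabs0 addr0; apply; rewrite /D; lra.
Qed.

Lemma poly_iter_size n : (1 < size (poly_iter p n))%N.
Proof.
elim: n => [|n IH]; first by rewrite size_polyX.
have := size_comp_poly p (poly_iter p n); rewrite (st_sp S) /= => E.
have : (0 < d * (size (poly_iter p n)).-1)%N.
  by rewrite muln_gt0 (d_gt0 S) -ltnS prednK // ltnW.
by rewrite -E; case: (size _) => [|[|]].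
Qed.

Lemma base_expand : exists2 sigma : R, 0 < sigma & forall z x, julia p z -> julia p x ->
  cabs (x - z) <= sigma -> 2 * cabs (x - z) <= cabs (Z N x - Z N z).
Proof.
have [_ _ tN] := goodF_poly (poly_iter p N); have [M M0 hM] := tN B.
have M1 : 0 < M + 1 by rewrite ltr_wpDl.
exists (2 / (M + 1)); first by rewrite divr_gt0.
move=> z x jz jx xz.
have zB := julia_bound S jz; have xB := julia_bound S jx.
have T := hM z x z zB xB zB; rewrite !horner_poly_iter in T.
have ex := le_trans expN (st_base S jz N0).
apply: (expansion_step (M := M) 0 ex _ (cabs_ge0 _)).
  rewrite -cabsM lerBlDr.
  apply: le_trans (cabs_le_add _ (Z N x - Z N z)) _.
  by rewrite lerD2l cabsB.
by move: xz; rewrite ler_pdivlMr //; have := cabs_ge0 (x - z); lra.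
Qed.

(** The lifted root is close enough to [z] for [base_expand], which read backwards makes the inverse
    branch contract by [1 / 2]. *)
Lemma base_lift : exists2 sigma : R, 0 < sigma &
  (forall z x, julia p z -> julia p x ->
    cabs (x - z) <= sigma -> 2 * cabs (x - z) <= cabs (Z N x - Z N z)) /\
  forall z y, julia p z -> julia p y -> cabs (Z N z - y) <= sigma ->
    exists x, [/\ julia p x, Z N x = y & cabs (z - x) <= cabs (Z N z - y) / 2].
Proof.
have [s s0 hs] := base_expand.
have sP := poly_iter_size N; case sD : (size (poly_iter p N)) sP => [|[|D]] // _.
have lP0 : lead_coef (poly_iter p N) != 0.
  by rewrite lead_coef_eq0 -size_poly_gt0 sD.
have [t t0 ht] := root_near_eps D lP0 s0.
have min_s : Num.min s (t / 2) <= s by rewrite ge_min lexx.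
have min_t : Num.min s (t / 2) <= t / 2 by rewrite ge_min lexx orbT.
exists (Num.min s (t / 2)); first by rewrite lt_min s0 divr_gt0.
split=> [z x jz jx xz|z y jz jy zy].
  by apply: (hs _ _ jz jx); exact: le_trans min_s.
have [|x] := ht (poly_iter p N) (erefl _) sD z y.
  by rewrite horner_poly_iter; lra.
rewrite horner_poly_iter => Px zx.
have jx : julia p x by apply/(julia_iter S N); rewrite Px.
exists x; split; [exact: jx|exact: Px|].
have := hs x z jx jz (ltW zx); rewrite Px; lra.
Qed.

(** Inverse branches composed along the orbit of [z]. The bound at all intermediate times serves
    shadowing; the factor [2 ^+ k] makes the initial points converge as the segment gets longer. *)
Lemma base_chain (sigma : R) k z x : 0 < sigma ->
  (forall z y, julia p z -> julia p y -> cabs (Z N z - y) <= sigma ->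
    exists x, [/\ julia p x, Z N x = y & cabs (z - x) <= cabs (Z N z - y) / 2]) ->
  julia p z -> julia p x -> cabs (Z (k * N) z - x) <= sigma ->
  exists x0, [/\ julia p x0, Z (k * N) x0 = x,
    forall i, (i <= k)%N ->
      cabs (Z (i * N) z - Z (i * N) x0) <= cabs (Z (k * N) z - x) &
    2 ^+ k * cabs (z - x0) <= cabs (Z (k * N) z - x)].
Proof.
move=> s0 lift; elim: k z => [|k IH] z jz jx zx.
  exists x; split; [exact: jx|by []|by move=> i; rewrite leqn0 => /eqP ->|].
  by rewrite expr0 mul1r.
have jz1 := juliaZ S N jz.
have EZ y i : Z (i.+1 * N) y = Z (i * N) (Z N y) by rewrite mulSnr iterD.
rewrite EZ in zx *.
have [x1 [jx1 Zx1 close1 geo]] := IH _ jz1 jx zx.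
have c0 := close1 0%N (leq0n _); rewrite /= in c0.
have [x0 [jx0 Zx0 zx0]] := lift z x1 jz jx1 (le_trans c0 zx).
have h0 : cabs (z - x0) <= cabs (Z (k * N) (Z N z) - x) / 2 by lra.
exists x0; split; [exact: jx0|by rewrite EZ Zx0| |]; last first.
  apply: le_trans geo; rewrite exprS mulrAC mulrC ler_wpM2l ?exprn_ge0 //; lra.
case=> [_|i ik]; last by rewrite !EZ Zx0; exact: close1.
by rewrite /=; have := cabs_ge0 (Z (k * N) (Z N z) - x); lra.
Qed.

(** [closing] picks its lifts by [choice]; expansion between two lifts that stay close is what makes
    the picked map a contraction. *)
Lemma base_separation (sigma : R) k x y : (0 < k)%N ->
  (forall z x, julia p z -> julia p x ->
    cabs (x - z) <= sigma -> 2 * cabs (x - z) <= cabs (Z N x - Z N z)) ->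
  julia p x -> julia p y ->
  (forall i, (i < k)%N -> cabs (Z (i * N) x - Z (i * N) y) <= sigma) ->
  cabs (x - y) <= cabs (Z (k * N) x - Z (k * N) y) / 2.
Proof.
move=> + expa jx jy; elim: k => // -[|k] IH _ close.
  rewrite mul1n; have := expa y x jy jx (close 0%N (ltn0Sn _)); lra.
apply: le_trans (IH (ltn0Sn _) _) _; first by move=> i ik; exact/close/ltnW.
have EZ u : Z (k.+2 * N) u = Z N (Z (k.+1 * N) u) by rewrite mulSn iterD.
have := expa _ _ (juliaZ S (k.+1 * N) jy) (juliaZ S (k.+1 * N) jx) (close _ (ltnSn _)).
rewrite !EZ; have := cabs_ge0 (Z (k.+1 * N) x - Z (k.+1 * N) y); lra.
Qed.

Definition saddle_point (x : C * C) := julia p x.1 /\ exists n, [/\ (0 < n)%N,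
    iter n (skew_map p q) x = x & `|((fiber_iter p q x.1 n)^`()).[x.2]| < 1].

Lemma ball_closed (u : C) (s : R) : cclosed [set x | cabs (x - u) <= s].
Proof.
move=> x h /=; rewrite leNgt; apply/negP => sx.
have e0 : 0 < cabs (x - u) - s by rewrite subr_gt0.
have [y /= yu xy] := h _ e0.
by have := cabs_tri y x u; lra.
Qed.

(** In the base, the inverse branch along the segment maps a small ball of [J_p] around its end
    point into itself, because the segment almost closes; its fixed point [z'] is periodic. Over
    [z'] the return map sends a disc around [w0] into itself and contracts it. Vertical errors are
    halved at each step before the next is added, so [del] does not depend on [l]. *)
Lemma closing (eps : R) : 0 < eps -> exists2 del : R, 0 < del &
  forall (y : nat -> C * C) l, (0 < l)%N -> julia p (y 0%N).1 ->
  (forall i, y i.+1 = (Z N (y i).1, W (y i).1 N (y i).2)) ->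
  (forall i, (i < l)%N -> exists z w, Lset p q tau z w /\ near2 del (y i) (z, w)) ->
  near2 del (y l) (y 0%N) -> exists2 s, saddle_point s & near2 eps s (y 0%N).
Proof.
move=> eps0.
have [[rho M] /= [/andP[rho0 rho1] M0 con lipz]] := robust_contraction.
have [sigma sigma0 [expa lift]] := base_lift.
pose r1 := Num.min (rho / 2) (eps / 2).
have r10 : 0 < r1 by rewrite lt_min !divr_gt0.
have r1rho : r1 <= rho / 2 by rewrite ge_min lexx.
have r1eps : r1 <= eps / 2 by rewrite ge_min lexx orbT.
clearbody r1.
have M1 : 0 < 4 * (M + 1) by rewrite mulr_gt0 // ltr_wpDl.
(* [sigma / 2] keeps two lifts within [sigma] of each other; [r1 / (4 * (M + 1))] makes a change of
   base point cost at most [r1 / 4] per step. *)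
pose s1 := Num.min (Num.min (sigma / 2) r1) (r1 / (4 * (M + 1))).
have s10 : 0 < s1 by rewrite !lt_min r10 !divr_gt0.
have s1sigma : s1 <= sigma / 2 by rewrite !ge_min lexx.
have s1r : s1 <= r1 by rewrite !ge_min lexx !orbT.
have s1M : M * s1 <= r1 / 4.
  have : s1 <= r1 / (4 * (M + 1)) by rewrite !ge_min lexx !orbT.
  by rewrite ler_pdivlMr //; lra.
exists (s1 / 8); first by rewrite divr_gt0.
move=> y l l0 jy0 orb nearL [close1 close2].
have yE i : y i = (Z (i * N) (y 0%N).1, W (y 0%N).1 (i * N) (y 0%N).2).
  elim: i => [|i IH]; first by rewrite /= hornerX; case: (y 0%N).
  by rewrite orb IH /= -iterD -horner_fiber_iterD -mulSn.
set z0 := (y 0%N).1 in jy0 yE close1; set w0 := (y 0%N).2 in yE close2.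
have y1 i : (y i).1 = Z (i * N) z0 by rewrite yE.
have jl := juliaZ S (l * N) jy0.
pose E := [set x | julia p x /\ cabs (x - Z (l * N) z0) <= s1].
have ch x : exists x0, E x -> [/\ julia p x0, Z (l * N) x0 = x,
    forall i, (i <= l)%N -> cabs (Z (i * N) z0 - Z (i * N) x0) <= s1 &
    cabs (z0 - x0) <= s1 / 2].
  have [[jx xl]|nE] := pselect (E x); last by exists 0.
  have xl' : cabs (Z (l * N) z0 - x) <= s1 by rewrite cabsB.
  have xs : cabs (Z (l * N) z0 - x) <= sigma by clear - S tau0 N0 expN conN xl' s1sigma sigma0; lra.
  have [x0 [jx0 Zx0 cl h]] := base_chain sigma0 lift jy0 jx xs.
  exists x0 => _; split; [exact: jx0|exact: Zx0| |].
    by move=> i il; exact: le_trans (cl i il) _.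
  have l2 : 2 <= (2 : R) ^+ l by rewrite -[leLHS]expr1 ler_weXn2l // ler1n.
  have : 2 * cabs (z0 - x0) <= 2 ^+ l * cabs (z0 - x0) by rewrite ler_wpM2r ?cabs_ge0.
  lra.
have [g hg] := choice ch.
have [z' Ez' gz'] : exists2 x, E x & g x = x.
  apply: (@contraction_fixpoint _ E B g (Z (l * N) z0)).
  - move=> x h; split.
      by apply: (julia_closed S) => e /h[u [ju _] xu]; exists u.
    by apply: (ball_closed (u := Z (l * N) z0)) => e /h[u [_ hu] xu]; exists u.
  - by move=> x [jx _]; exact: (julia_bound S jx).
  - by split; [exact: jl|rewrite subrr cabs0; exact: ltW].
  - move=> x Ex; have [jg _ _ h] := hg x Ex; split; first exact: jg.
    apply: le_trans (cabs_tri z0 _ _) _; rewrite cabsB [cabs (z0 - Z _ _)]cabsB.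
    by rewrite y1 in close1; lra.
  move=> x u Ex Eu; have [jx Zx cx _] := hg x Ex; have [ju Zu cu _] := hg u Eu.
  rewrite -{2}Zx -{2}Zu; apply: (base_separation l0 expa jx ju) => i il.
  apply: le_trans (cabs_tri (Z (i * N) z0) _ _) _.
  have := cu i (ltnW il); have := cx i (ltnW il).
  by rewrite [cabs (Z _ (g x) - _)]cabsB; lra.
have [jz' Zz' cz' _] := hg z' Ez'; rewrite gz' in jz' Zz' cz'.
(* Of [3 / 4 * r1], the vertical contraction accounts for [r1 / 2] and the change of base point for
   [r1 / 4]. At the last step the remaining [r1 / 4] absorbs the closing error, so that the disc
   around [w0] returns into itself. *)
have step i v v' : (i < l)%N ->
    cabs (v - (y i).2) <= r1 -> cabs (v' - (y i).2) <= r1 ->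
    [/\ cabs (W (Z (i * N) z') N v - (y i.+1).2) <= 3 / 4 * r1,
        cabs (dW (Z (i * N) z') N v) <= 1 / 2 &
        cabs (W (Z (i * N) z') N v - W (Z (i * N) z') N v') <= cabs (v - v') / 2].
  move=> il vy vy'; have [za [wa [La [/= n1 n2]]]] := nearL i il.
  have cl := cz' i (ltnW il); rewrite -y1 in cl.
  have zz : cabs (Z (i * N) z' - za) <= rho.
    apply: le_trans (cabs_tri (y i).1 _ _) _; rewrite cabsB.
    by clear - S tau0 N0 expN conN cl n1 s1r r1rho rho0 r10 s10; lra.
  have nb u : cabs (u - (y i).2) <= r1 -> cabs (u - wa) <= rho.
    move=> uy; apply: le_trans (cabs_tri (y i).2 _ _) _.
    by clear - S tau0 N0 expN conN uy n2 s1r r1rho rho0 r10; lra.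
  have nb0 : cabs ((y i).2 - wa) <= rho.
    by clear - S tau0 N0 expN conN n2 s1r r1rho rho0 r10; lra.
  have [_ h1] := con _ _ _ _ _ La zz (nb v vy) nb0.
  have [_ h2] := con _ _ _ _ _ La zz (nb v vy) (nb v' vy').
  have [h2' _] := con _ _ _ _ _ La zz (nb v vy) (nb v vy).
  split; [|exact: h2'|exact: h2].
  have -> : (y i.+1).2 = W (y i).1 N (y i).2 by rewrite orb.
  apply: le_trans (cabs_tri (W (Z (i * N) z') N (y i).2) _ _) _.
  have ja : julia p za by case: La.
  have war := Kz_bound S ja (safe_Kz tau0 (Lset_safe La)).
  have zaB := julia_bound S ja.
  have jyi : julia p (y i).1 by rewrite y1; exact: (juliaZ S _ jy0).
  have B1 : cabs (Z (i * N) z') <= B + 1.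
    by apply: le_trans (julia_bound S (juliaZ S (i * N) jz')) _; rewrite lerDl.
  have B2 : cabs (y i).1 <= B + 1.
    by apply: le_trans (julia_bound S jyi) _; rewrite lerDl.
  have B3 : cabs (y i).2 <= r + 1.
    by have := cabs_le_add (y i).2 wa; clear - S tau0 N0 expN conN n2 war s1r r1rho rho1 r10; lra.
  have := lipz _ _ _ B1 B2 B3; rewrite [cabs (Z _ _ - _)]cabsB => h3.
  have h4 : M * cabs ((y i).1 - Z (i * N) z') <= M * s1 by rewrite ler_wpM2l.
  by clear - S tau0 N0 expN conN h1 h3 h4 vy s1M; lra.
have path i v : (i <= l)%N -> cabs (v - w0) <= r1 ->
    cabs (W z' (i * N) v - (y i).2) <= r1.
  elim: i => [|i IH] il vw; first by rewrite hornerX.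
  rewrite mulSn horner_fiber_iterD.
  have [h _ _] := step i _ _ il (IH (ltnW il) vw) (IH (ltnW il) vw).
  by clear - S tau0 N0 expN conN h r10; lra.
have lip i v v' : (0 < i <= l)%N -> cabs (v - w0) <= r1 -> cabs (v' - w0) <= r1 ->
    cabs (dW z' (i * N) v) <= 1 / 2 /\
    cabs (W z' (i * N) v - W z' (i * N) v') <= cabs (v - v') / 2.
  elim: i => // i IH /= il vw vw'.
  have [_ h1 h2] := step i _ _ il (path i v (ltnW il) vw) (path i v' (ltnW il) vw').
  rewrite mulSn deriv_fiber_iterD !horner_fiber_iterD cabsM.
  have [i0|i0] := posnP i.
    move: h1 h2; rewrite i0 mul0n !hornerX derivX hornerC cabs1 mulr1.
    by split.
  have il' : (0 < i <= l)%N by rewrite i0 ltnW.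
  have [h3 h4] := IH il' vw vw'; split; last first.
    by have := cabs_ge0 (v - v'); clear - S tau0 N0 expN conN h2 h4; lra.
  apply: le_trans (_ : 1 / 2 * 1 <= _); last by rewrite mulr1.
  by rewrite ler_pM ?cabs_ge0 //; clear - S tau0 N0 expN conN h3; lra.
pose F := [set v | cabs (v - w0) <= r1].
have ll : (0 < l <= l)%N by rewrite l0 leqnn.
case El : l l0 ll => [//|l'] _ _.
have hl' : (l' < l)%N by rewrite El.
have last_step v : F v -> cabs (W z' (l * N) v - w0) <= 7 / 8 * r1.
  move=> Fv; have Pv := path l' v (ltnW hl') Fv.
  have [h _ _] := step l' _ _ hl' Pv Pv.
  move: h; rewrite -horner_fiber_iterD -mulSn -El => h.
  apply: le_trans (cabs_tri (y l).2 _ _) _.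
  by clear - S tau0 N0 expN conN h close2 s1r r10; lra.
have ll : (0 < l <= l)%N by rewrite El leqnn.
have [w' Fw' hw'] : exists2 v, F v & W z' (l * N) v = v.
  apply: (@contraction_fixpoint _ F (cabs w0 + r1) (fun v => W z' (l * N) v) w0).
  - exact: ball_closed.
  - move=> v Fv; apply: le_trans (cabs_le_add v w0) _.
    by rewrite lerD2l; exact: Fv.
  - by rewrite /F /= subrr cabs0; exact: ltW.
  - by move=> v Fv; apply: le_trans (last_step v Fv) _; clear - S tau0 N0 expN conN r10; lra.
  by move=> v v' Fv Fv'; have [_] := lip l v v' ll Fv Fv'.
exists (z', w'); last first.
  split=> /=.
    have := cz' 0%N (leq0n _); rewrite /= cabsB.
    by clear - S tau0 N0 expN conN s10 s1r r1eps eps0 r10; lra.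
  by apply: le_lt_trans Fw' _; clear - S tau0 N0 expN conN r1eps eps0; lra.
split; first exact: jz'.
exists (l * N)%N; split.
- by rewrite muln_gt0 N0 El.
- by rewrite iter_skew Zz' hw'.
have [h _] := lip l w' w' ll Fw' Fw'.
rewrite cabsE -(rmorph1 (real_complex R)) ltcR /=.
by clear - S tau0 N0 expN conN h; lra.
Qed.

End Closing.

(** * Critical points attracted to saddle points *)

Section Lemniscate.
Variable R : realType.
Local Notation C := (Cplx R).

(* If [T] has no critical point in [{|T| <= rho}], the radial lift [h], with
   [T (h x) = theta T x] and [h x] near [x], splits this set into clopen sheets,
   one for each zero; the minimum principle for [T / ('X - w)] on the sheet of
   [w] then bounds [T'(w)] from below. *)
Lemma lemniscate_crit (T : {poly C}) w (rho Rb : R) :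
  (2 < size T)%N -> T.[w] = 0 -> 0 < rho ->
  (forall x, cabs T.[x] <= rho -> cabs (x - w) <= Rb) ->
  Rb * cabs (T^`()).[w] < rho ->
  exists2 x, (T^`()).[x] = 0 & cabs T.[x] <= rho.
Proof.
move=> sT Tw rho0 bd small; apply: contrapT => nocrit.
pose E := [set x | cabs T.[x] <= rho].
have cE : cclosed E.
  move=> x h; rewrite /E /= leNgt; apply/negP => rx.
  have e0 : 0 < cabs T.[x] - rho by rewrite subr_gt0.
  have [s s0 hs] := poly_cont T x e0; have [y Ey /hs xy] := h s s0.
  have h1 : cabs T.[y] <= rho := Ey.
  by have := cabs_le_add T.[x] T.[y]; lra.
have Ew : E w by rewrite /E /= Tw cabs0 ltW.
have Rb0 : 0 <= Rb by apply: le_trans (bd w Ew); exact: cabs_ge0.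
pose D := cabs w + Rb + 2.
have ED x : E x -> cabs x <= cabs w + Rb.
  by move=> /bd h; apply: le_trans (cabs_le_add x w) _; rewrite lerD2l.
have [x0 Ex0 hx0] : exists2 x, E x & forall y, E y -> cabs (T^`()).[x] <= cabs (T^`()).[y].
  apply: (cplx_min cE ED Ew (g := fun x => cabs (T^`()).[x])).
    by move=> x _; exact: cabs_ge0.
  move=> x Ex e e0; have [s s0 hs] := poly_cont (T^`()) x e0.
  exists s; [exact: s0|move=> y; rewrite cabsB => /hs h].
  have := cabs_le_add (T^`()).[x] (T^`()).[y].
  have := cabs_le_add (T^`()).[y] (T^`()).[x].
  by rewrite [cabs (_.[y] - _)]cabsB ltr_norml => h1 h2; apply/andP; split; lra.
pose m := cabs (T^`()).[x0].
have m0 : 0 < m.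
  rewrite /m cabs_gt0; apply/eqP => T0; apply: nocrit; exists x0; [exact: T0|exact: Ex0].
have hm x : E x -> m <= cabs (T^`()).[x] by exact: hx0.
clearbody m.
have [_ l1 tT] := goodF_poly T.
have [M1 M10 hM1] := l1 D; have [M2 M20 hM2] := tT D.
have M12 : 0 < 8 * (M1 + M2 + 1) by rewrite mulr_gt0 // ltr_wpDl // addr_ge0.
(* On discs of this radius around points of [E] the map [T] is injective with slope at least [m / 2]
   ([inj]), so lifts are unique at this scale. *)
pose eps := Num.min 1 (m / (8 * (M1 + M2 + 1))).
have eps0 : 0 < eps by rewrite lt_min ltr01 divr_gt0.
have eps1 : eps <= 1 by rewrite ge_min lexx.
have epsM : eps * (M1 + M2) <= m / 8.
  have : eps <= m / (8 * (M1 + M2 + 1)) by rewrite ge_min lexx orbT.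
  rewrite ler_pdivlMr //; lra.
clearbody eps.
have inj x x1 x2 : E x -> cabs (x1 - x) <= eps -> cabs (x2 - x) <= eps ->
    m / 2 * cabs (x1 - x2) <= cabs (T.[x1] - T.[x2]).
  move=> Ex h1 h2; have xD := ED x Ex; have w0 := cabs_ge0 w.
  have D0 : cabs x <= D by rewrite /D; lra.
  have D1 : cabs x1 <= D by have := cabs_le_add x1 x; rewrite /D; lra.
  have D2 : cabs x2 <= D by have := cabs_le_add x2 x; rewrite /D; lra.
  have T2 := hM2 0 x1 x2; rewrite cabs0 in T2.
  have {}T2 := T2 (le_trans (cabs_ge0 _) D0) D1 D2.
  have L1 := hM1 0 0 x2 x; rewrite cabs0 subrr cabs0 add0r in L1.
  have {}L1 := L1 (le_trans (cabs_ge0 _) D0) (le_trans (cabs_ge0 _) D0) D2 D0.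
  have L2 : M1 * cabs (x2 - x) <= M1 * eps by rewrite ler_wpM2l.
  have e20 : 0 <= M2 * eps by rewrite mulr_ge0 // ltW.
  have e10 : 0 <= M1 * eps by rewrite mulr_ge0 // ltW.
  have d2 : 3 / 4 * m <= cabs (T^`()).[x2].
    have := cabs_le_add (T^`()).[x] (T^`()).[x2].
    rewrite [cabs (_.[x] - _)]cabsB; have := hm x Ex; lra.
  have x12 : cabs (x1 - x2) <= 2 * eps.
    by apply: le_trans (cabs_tri x _ _) _; rewrite [cabs (x - _)]cabsB; lra.
  have y0 := cabs_ge0 (x1 - x2).
  have h3 : M2 * cabs (x1 - x2) ^+ 2 <= M2 * (2 * eps) * cabs (x1 - x2).
    by rewrite expr2 mulrA ler_wpM2r // ler_wpM2l.
  have h4 : (3 / 4 * m) * cabs (x1 - x2) <= cabs (T^`()).[x2] * cabs (x1 - x2).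
    by rewrite ler_wpM2r.
  have h5 : M2 * (2 * eps) * cabs (x1 - x2) <= (m / 4) * cabs (x1 - x2).
    by rewrite ler_wpM2r //; lra.
  rewrite -cabsM in h4.
  have := cabs_le_add ((T^`()).[x2] * (x1 - x2)) (T.[x1] - T.[x2]).
  rewrite [cabs (_ * _ - _)]cabsB; lra.
have T0 : T != 0 by rewrite -size_poly_gt0 (leq_trans _ sT).
have lT0 : lead_coef T != 0 by rewrite lead_coef_eq0.
have e30 : 0 < eps / 3 by rewrite divr_gt0.
have [del del0 lift] : exists2 del : R, 0 < del & forall x y, cabs (T.[x] - y) < del ->
    exists2 x', T.[x'] = y & cabs (x - x') < eps / 3.
  case sD : (size T) sT => [|[|k]] // _.
  have [del del0 h] := root_near_eps k lT0 e30.
  exists del; [exact: del0|move=> x y xy; exact: (h T (erefl _) sD x y xy)].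
pose t := Num.min (1 / 2) (del / (2 * rho)).
have t0 : 0 < t by rewrite lt_min !divr_gt0 // mulr_gt0.
have t1 : t <= 1 / 2 by rewrite ge_min lexx.
have trho : t * rho <= del / 2.
  have : t <= del / (2 * rho) by rewrite ge_min lexx orbT.
  by rewrite ler_pdivlMr ?mulr_gt0 //; lra.
clearbody t; pose th : R := 1 - t.
have th0 : 0 <= th by rewrite /th; lra.
have th1 : th < 1 by rewrite /th; lra.
have ch x : exists x', E x -> T.[x'] = (th%:C)%C * T.[x] /\ cabs (x - x') < eps / 3.
  have [Ex|nE] := pselect (E x); last by exists 0.
  have [x' h1 h2] : exists2 x', T.[x'] = (th%:C)%C * T.[x] & cabs (x - x') < eps / 3.
    apply: lift; have -> : T.[x] - (th%:C)%C * T.[x] = (t%:C)%C * T.[x].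
      by rewrite -[X in X - _]mul1r -mulrBl /th rmorphB /= subKr.
    rewrite cabsM cabs_real ?(ltW t0) //.
    have : t * cabs T.[x] <= t * rho by rewrite ler_pM2l.
    lra.
  by exists x'.
have [h hh] := choice ch.
have Eh x : E x -> E (h x).
  move=> Ex; have [Th _] := hh x Ex; rewrite /E /= Th cabsM cabs_real //.
  have h1 : cabs T.[x] <= rho := Ex.
  by apply: le_trans h1; rewrite ler_piMl ?cabs_ge0 // ltW.
have Ehi x i : E x -> E (iter i h x).
  by move=> Ex; elim: i => [|i IH]; [exact: Ex|exact: Eh].
have Thi x i : E x -> T.[iter i h x] = ((th%:C)%C ^+ i) * T.[x].
  move=> Ex; elim: i => [|i IH]; first by rewrite expr0 mul1r.
  by rewrite iterS (hh _ (Ehi x i Ex)).1 IH exprS mulrA.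
have sep z1 z2 : T.[z1] = 0 -> T.[z2] = 0 -> cabs (z1 - z2) <= eps -> z1 = z2.
  move=> Tz1 Tz2 zz; have Ez : E z2 by rewrite /E /= Tz2 cabs0 ltW.
  have := inj z2 z1 z2 Ez zz; rewrite subrr cabs0 => /(_ (ltW eps0)).
  rewrite Tz1 Tz2 subrr cabs0 => h1.
  apply/eqP; rewrite -subr_eq0 -cabs_eq0 eq_le cabs_ge0 andbT.
  have m2 : 0 < m / 2 by rewrite divr_gt0.
  by rewrite -(ler_pM2l m2) mulr0.
have hzero z i : T.[z] = 0 -> iter i h z = z.
  move=> Tz; have Ez : E z by rewrite /E /= Tz cabs0 ltW.
  elim: i => // i IH; rewrite iterS IH; have [Th zh] := hh z Ez.
  by apply: sep; [rewrite Th Tz mulr0|exact: Tz|rewrite cabsB; lra].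
have th01 : 0 <= th < 1 by rewrite th0.
have [k0 hk0] := expr_small th01 (divr_gt0 del0 rho0).
(* After [k0] radial steps the value of [T] is below [del], so the lift lies within [eps / 3] of a
   true zero, which [sep] identifies; [V] is the sheet of the points whose lift ends at [w]. Lifts
   of nearby points stay [eps / 3]-close, which makes [V] open and closed in [E] ([locV]). *)
pose V := [set x | E x /\ cabs (iter k0 h x - w) < eps / 3].
have locV x : E x -> exists2 s : R, 0 < s & forall x', E x' -> cabs (x - x') < s ->
    V x <-> V x'.
  move=> Ex.
  have me : 0 < m / 2 * (eps / 3) by rewrite mulr_gt0 ?divr_gt0.
  have [s s0 hs] := poly_cont T x me.
  exists (Num.min s (eps / 3)); first by rewrite lt_min s0.
  move=> x' Ex'; rewrite lt_min => /andP[/hs Txx xx].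
  have close i : cabs (iter i h x - iter i h x') <= eps / 3.
    elim: i => [|i IH]; first exact: ltW.
    have m2 : 0 < m / 2 by rewrite divr_gt0.
    have [_ h1] := hh _ (Ehi x i Ex); have [_ h2] := hh _ (Ehi x' i Ex').
    have I := inj (iter i h x) (iter i.+1 h x) (iter i.+1 h x') (Ehi x i Ex).
    rewrite -(ler_pM2l m2); apply: le_trans (I _ _) _.
    - by rewrite iterS cabsB; clear - h1 eps0; lra.
    - rewrite iterS; apply: le_trans (cabs_tri (iter i h x') _ _) _.
      rewrite [cabs (h _ - _)]cabsB [cabs (_ - iter i h x)]cabsB.
      by clear - IH h2 eps0; lra.
    rewrite !Thi // -mulrBr cabsM cabsX cabs_real //.
    apply: le_trans (ltW Txx); rewrite ler_piMl ?cabs_ge0 //.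
    by rewrite exprn_ile1 // ltW.
  have key y y' : E y -> E y' -> cabs (iter k0 h y - iter k0 h y') <= eps / 3 ->
      V y -> V y'.
    move=> Ey Ey' cl [_ yw]; split; first exact: Ey'.
    have [z Tz yz] : exists2 z, T.[z] = 0 & cabs (iter k0 h y' - z) < eps / 3.
      apply: lift; rewrite subr0 Thi // cabsM cabsX cabs_real //.
      have h1 : cabs T.[y'] <= rho := Ey'.
      have h2 := hk0 k0 (leqnn k0); rewrite ltr_pdivlMr // in h2.
      apply: le_lt_trans h2; rewrite ler_wpM2l // exprn_ge0 //.
    have -> : w = z; last exact: yz.
    apply: sep => //; apply: le_trans (cabs_tri (iter k0 h y') _ _) _.
    have := cabs_tri (iter k0 h y) w (iter k0 h y').
    by rewrite [cabs (w - iter k0 h y)]cabsB; clear - yw yz cl eps0; lra.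
  split; first exact: (key x x' Ex Ex' (close k0)).
  by apply: (key x' x Ex' Ex); rewrite cabsB; exact: close.
have cV : cclosed V.
  move=> x hx; have Ex : E x.
    by apply: cE => e /hx[y [Ey _] xy]; exists y.
  have [s s0 hs] := locV x Ex; have [y Vy xy] := hx s s0.
  by apply/(hs y _ xy); [case: Vy|exact: Vy].
have Vw : V w by split; [exact: Ew|rewrite hzero // subrr cabs0].
have Vzero z : V z -> T.[z] = 0 -> z = w.
  move=> [Ez zw] Tz; apply: sep => //; rewrite hzero // in zw.
  by clear - zw eps0; lra.
have [T1 ET] : exists T1, T = T1 * ('X - w%:P).
  by apply/factor_theorem; rewrite /root Tw.
have T1w : T1.[w] = (T^`()).[w].
  by rewrite ET derivM derivXsubC !hornerE subrr mulr0 add0r.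
have ET' x : T.[x] = T1.[x] * (x - w) by rewrite ET !hornerE.
have T1nz : T1 != 0 by apply/eqP => T10; move: T0; rewrite ET T10 mul0r eqxx.
have sT1 : (1 < size T1)%N.
  by move: sT; rewrite ET size_Mmonic ?monicXsubC // size_XsubC addn2.
have [x1 Vx1 hx1] : exists2 x, V x & forall y, V y -> cabs T1.[x] <= cabs T1.[y].
  apply: (cplx_min cV (M := cabs w + Rb) _ Vw (g := fun x => cabs T1.[x])).
  - by move=> x [Ex _]; exact: ED.
  - by move=> x _; exact: cabs_ge0.
  move=> x Vx e e0; have [s s0 hs] := poly_cont T1 x e0.
  exists s; [exact: s0|move=> y; rewrite cabsB => /hs h1].
  have := cabs_le_add T1.[x] T1.[y].
  have := cabs_le_add T1.[y] T1.[x].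
  rewrite [cabs (_.[y] - _)]cabsB ltr_norml => h2 h3.
  by clear - h1 h2 h3; apply/andP; split; lra.
have [Ex1 _] := Vx1.
have T1x1 : T1.[x1] != 0.
  apply/eqP => T10; have x1w : x1 = w by apply: Vzero => //; rewrite ET' T10 mul0r.
  have := hm w Ew; by rewrite -T1w -x1w T10 cabs0; clear - m0; lra.
have Tx1 : cabs T.[x1] = rho.
  apply/eqP; rewrite eq_le; apply/andP; split; first exact: Ex1.
  rewrite leNgt; apply/negP => lt1.
  have [s s0 hs] := locV x1 Ex1.
  have e0 : 0 < rho - cabs T.[x1] by rewrite subr_gt0.
  have [s' s'0 hs'] := poly_cont T x1 e0.
  have ss : 0 < Num.min s s' by rewrite lt_min s0.
  have [x2 + lt2] := min_modulus sT1 T1x1 ss; rewrite lt_min => /andP[h1 /hs' h2].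
  have Ex2 : E x2.
    rewrite /E /=; have := cabs_le_add T.[x2] T.[x1].
    by rewrite [cabs (_.[x2] - _)]cabsB; clear - h2; lra.
  have Vx2 : V x2 by apply/(hs x2 Ex2 h1).
  by have := hx1 x2 Vx2; rewrite leNgt lt2.
(* Minimality at [x1] gives [|T1.[w]| >= |T1.[x1]| = rho / |x1 - w|], against the smallness of
   [Rb * |T'(w)|]. *)
have h1 := hx1 w Vw; have h2 := bd x1 Ex1.
move: small; rewrite -T1w -Tx1 ET' cabsM ltNge => /negP; apply.
by rewrite mulrC ler_pM ?cabs_ge0.
Qed.

End Lemniscate.

Section SaddleCritical.
Variable R : realType.
Local Notation C := (Cplx R).
Variables (d : nat) (p : {poly C}) (q : {poly {poly C}}) (b : C).
Variables (B r a c ce L : R).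
Hypothesis S : setup d p q b B r a c ce L.
Local Notation Z n z := (iter n (horner p) z).
Local Notation W z n w := ((fiber_iter p q z n).[w]).
Local Notation dW z n w := ((fiber_iter p q z n)^`()).[w].

Lemma critical_chain z l x : dW z l x = 0 ->
  exists2 j, (j < l)%N & ((fiber q (Z j z))^`()).[W z j x] = 0.
Proof.
elim: l => [|l IH]; first by rewrite /= derivX hornerC => /eqP; rewrite oner_eq0.
rewrite /= deriv_comp hornerM horner_comp => /eqP.
rewrite mulf_eq0 => /orP[/eqP h|/eqP/IH[j jl h]]; first by exists l.
by exists j => //; rewrite ltnW.
Qed.

Lemma attracting_nbhd (P : {poly C}) w : P.[w] = w -> cabs (P^`()).[w] < 1 ->
  exists A : R * R, [/\ 0 < A.1, 0 <= A.2 < 1 &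
   forall x, cabs (x - w) <= A.1 -> cabs (P.[x] - w) <= A.2 * cabs (x - w)].
Proof.
move=> Pw; set l := cabs _ => l1.
have [_ _ tP] := goodF_poly P; have [M M0 hM] := tP (cabs w + 1).
have M1 : 0 < 2 * (M + 1) by rewrite mulr_gt0 // ltr_wpDl.
pose s := Num.min 1 ((1 - l) / (2 * (M + 1))).
have s1 : s <= 1 by rewrite ge_min lexx.
have sM : M * s <= (1 - l) / 2.
  have h : s <= (1 - l) / (2 * (M + 1)) by rewrite ge_min lexx orbT.
  have s0 : 0 < s by rewrite lt_min ltr01 divr_gt0 // subr_gt0.
  move: h; rewrite ler_pdivlMr //; lra.
have l0 : 0 <= l := cabs_ge0 _.
exists (s, (1 + l) / 2); split=> /=.
- by rewrite lt_min ltr01 divr_gt0 // subr_gt0.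
- by apply/andP; split; lra.
move=> x xs; have w0 := cabs_ge0 w.
have T := hM 0 x w; rewrite cabs0 Pw in T.
have h0 : 0 <= cabs w + 1 by lra.
have h1 : cabs x <= cabs w + 1 by have := cabs_le_add x w; lra.
have h2 : cabs w <= cabs w + 1 by lra.
have {}T := T h0 h1 h2.
apply: le_trans (cabs_le_add _ ((P^`()).[w] * (x - w))) _.
rewrite cabsM -/l.
have y0 := cabs_ge0 (x - w).
have h3 : M * cabs (x - w) ^+ 2 <= (1 - l) / 2 * cabs (x - w).
  rewrite expr2 mulrA ler_wpM2r //; apply: le_trans sM; exact: ler_wpM2l.
lra.
Qed.

Lemma saddle_critical s : saddle_point p q s ->
  exists2 x, critical_locus p q x & forall e : R, 0 < e ->
    infinitely (fun n => near2 e (iter n (skew_map p q) x) s).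
Proof.
case: s => z w [/= jz [n [n0 per mul]]].
rewrite cabsE -(rmorph1 (real_complex R)) ltcR in mul.
move: per; rewrite iter_skew => -[Zz Ww].
have ZZ k : Z (k * n) z = z.
  by elim: k => // k IH; rewrite mulSn iterD IH.
have WS k x : W z (k.+1 * n) x = W z n (W z (k * n) x).
  by rewrite mulSn horner_fiber_iterD ZZ.
have dWk k : W z (k * n) w = w /\ cabs (dW z (k * n) w) = cabs (dW z n w) ^+ k.
  elim: k => [|k [IH1 IH2]]; first by rewrite hornerX derivX hornerC cabs1 expr0.
  by rewrite WS IH1 mulSn deriv_fiber_iterD ZZ IH1 Ww cabsM IH2 exprS.
have [[rho kap] /= [rho0 kap01 att]] := attracting_nbhd Ww mul.
(* Bounds [|x - w|] on [{|T| <= rho}] for all iterates at once: by [escape_mono], a value of modulus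
   at most [r + cabs w + rho] at time [K] forces the same bound at time 0. The multiplier of the
   iterate tends to 0 against this fixed [Rb]. *)
pose Rb := r + cabs w + rho + cabs w.
have r0 := r_gt0 S; have w0 := cabs_ge0 w.
have Rb1 : 0 < Rb by rewrite /Rb; lra.
have l01 : 0 <= cabs (dW z n w) < 1 by rewrite cabs_ge0.
have [k hk] := expr_small l01 (divr_gt0 rho0 Rb1).
have {}hk := hk k.+1 (leqnSn k).
pose K := (k.+1 * n)%N.
pose T : {poly C} := fiber_iter p q z K - w%:P.
have K0 : (0 < K)%N by rewrite muln_gt0.
have sT : (2 < size T)%N.
  have dK : (2 <= d ^ K)%N.
    by apply: leq_trans (st_d S) _; rewrite -{1}[d]expn1 leq_exp2l // (st_d S).
  rewrite /T size_polyDl (fiber_iter_szn S) ?ltnS //.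
  by rewrite size_polyN (leq_trans (size_polyC_leq1 w)) // (leq_trans _ dK).
have TE x : T.[x] = W z K x - w by rewrite /T !hornerE.
have dT x : (T^`()).[x] = dW z K x by rewrite /T derivB derivC subr0.
have [hW hdW] := dWk k.+1.
have [||||x] := lemniscate_crit (w := w) (rho := rho) (Rb := Rb) sT.
- by rewrite TE hW subrr.
- exact: rho0.
- move=> x; rewrite TE => h.
  have h1 : cabs (W z K x) <= r + cabs w + rho.
    by have := cabs_le_add (W z K x) w; lra.
  have ry : r <= r + cabs w + rho by lra.
  have := escape_mono S jz ry (leq0n K) h1; rewrite /= hornerX => h2.
  by apply: le_trans (cabsD _ _) _; rewrite cabsN /Rb; lra.
- by rewrite dT hdW mulrC -ltr_pdivlMr.
rewrite dT TE => /critical_chain[j jK cj] xK.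
(* A critical point of the iterate lies over a critical point of one fibre map further along its
   orbit, and this one is attracted as well. *)
exists (Z j z, W z j x); first by split; [exact: (juliaZ S j jz)|exact: cj].
move=> e e0 m0.
have shrink i : cabs (W z (i * n) (W z K x) - w) <= kap ^+ i * rho.
  elim: i => [|i IH]; first by rewrite hornerX expr0 mul1r.
  rewrite WS exprS -mulrA; case/andP: kap01 => kap0 kap1.
  have h1 : kap ^+ i * rho <= rho.
    by rewrite ler_piMl ?(ltW rho0) // exprn_ile1 // ltW.
  by apply: le_trans (att _ (le_trans IH h1)) _; rewrite ler_wpM2l.
have [i0 hi0] := expr_small kap01 (divr_gt0 e0 rho0).
pose i := maxn i0 (m0 + K)%N.
exists (i * n + K - j)%N.
  rewrite -addnBA ?(ltnW jK) //; apply: leq_trans (leq_addr _ _).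
  apply: leq_trans (leq_pmulr i n0); apply: leq_trans (leq_maxr _ _).
  exact: leq_addr.
have E : (i * n + K - j + j = i * n + K)%N by rewrite subnK // (leq_trans (ltnW jK)) // leq_addl.
rewrite iter_skew -iterD -horner_fiber_iterD E iterD horner_fiber_iterD.
rewrite /K !ZZ -/K; split=> /=; first by rewrite subrr cabs0.
apply: le_lt_trans (shrink i) _; rewrite -ltr_pdivlMr //.
by apply: hi0; rewrite leq_maxl.
Qed.

End SaddleCritical.

(** * Lower semicontinuity of the fibre Julia sets *)

Section Semicontinuity.
Variable R : realType.
Local Notation C := (Cplx R).
Variables (d : nat) (p : {poly C}) (q : {poly {poly C}}) (b : C).
Variables (B r a c ce L : R).
Hypothesis S : setup d p q b B r a c ce L.
Local Notation Z n z := (iter n (horner p) z).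
Local Notation W z n w := ((fiber_iter p q z n).[w]).
Local Notation Kz z w := (filled_julia2 p q (z, w)).
Local Notation Jz z w := (fiber_julia p q z w).

Lemma escape_unbounded z w : julia p z -> ~ Kz z w ->
  forall M : R, exists n, M < cabs (W z n w).
Proof.
move=> jz nK M; apply: contrapT => h; apply: nK; apply/bounded_cplx2.
exists (B + Num.max M 0) => n; rewrite iter_skew /=; split.
  have := julia_bound S (juliaZ S n jz) => h1.
  by apply: le_trans h1 _; rewrite lerDl le_max lexx orbT.
apply: le_trans (_ : M <= _).
  by rewrite leNgt; apply/negP => Mn; apply: h; exists n.
apply: le_trans (_ : Num.max M 0 <= _); first by rewrite le_max lexx.
by rewrite lerDr ltW // (B_gt0 S).
Qed.

Lemma fiber_iterS z n w : W z n.+1 w = (fiber q (Z n z)).[W z n w].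
Proof. by rewrite /= horner_comp. Qed.

Lemma growth_below z w j i : julia p z -> r <= cabs (W z j w) ->
  r <= cabs (W z (i + j) w) /\
  (a * cabs (W z j w)) ^+ (d ^ i) <= a * cabs (W z (i + j) w).
Proof.
move=> jz rw; have /andP[a0 a1] := st_a S.
elim: i => [|i [IH1 IH2]]; first by rewrite expn0 expr1.
have zB := julia_bound S (juliaZ S (i + j) jz).
have h1 := st_q S zB IH1; have h2 := st_qa S zB IH1.
rewrite addSn fiber_iterS; split; first by have := r_gt0 S; lra.
rewrite expnSr exprM.
apply: le_trans (_ : (a * cabs (W z (i + j) w)) ^+ d <= _).
  have h3 : 0 <= a * cabs (W z j w) by rewrite mulr_ge0 ?cabs_ge0 // ltW.
  by rewrite lerXn2r ?nnegrE ?exprn_ge0 // (le_trans _ IH2) // exprn_ge0.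
rewrite exprMn; case: (d) (st_d S) h2 => [|[|k]] // _ h2.
rewrite [a ^+ _]exprS -mulrA ler_pM2l //; apply: le_trans h2.
rewrite ler_wpM2r ?exprn_ge0 ?cabs_ge0 //.
by rewrite exprS ler_piMr ?(ltW a0) // exprn_ile1 // ltW.
Qed.

Lemma growth_above z w j i : julia p z -> cabs (W z j w) <= r + 1 ->
  cabs (W z (i + j) w) <= (c * (r + 1)) ^+ (d ^ i).
Proof.
move=> jz wr; have c1 := st_c S; have c0 : 0 < c := lt_le_trans ltr01 c1.
have r1 := st_r S; have r0 := r_gt0 S.
suff h : c * Num.max (cabs (W z (i + j) w)) r <= (c * (r + 1)) ^+ (d ^ i).
  apply: le_trans h; apply: le_trans (_ : Num.max (cabs (W z (i + j) w)) r <= _).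
    by rewrite le_max lexx.
  by rewrite ler_peMl // le_max cabs_ge0.
elim: i => [|i IH].
  by rewrite expn0 expr1 add0n ler_pM2l // ge_max wr lerDl ler01.
have zB := julia_bound S (juliaZ S (i + j) jz).
have := st_qc S (W z (i + j) w) zB; rewrite -fiber_iterS -addSn.
set m := Num.max _ r in IH * => h.
have m1 : 1 <= m by rewrite le_max r1 orbT.
have cm1 : 1 <= c * m by rewrite -[1]mulr1 ler_pM.
have cm0 : 0 <= c * m := le_trans ler01 cm1.
rewrite expnSr exprM; apply: le_trans (_ : (c * m) ^+ d <= _); last first.
  by rewrite lerXn2r ?nnegrE // exprn_ge0 // mulr_ge0 ?(ltW c0) // addr_ge0 // ltW.
have d1 : (0 < d)%N := d_gt0 S.
have rm : c * r <= (c * m) ^+ d.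
  apply: le_trans (_ : (c * m) ^+ 1 <= _); last by rewrite ler_weXn2l.
  by rewrite expr1 ler_pM2l // le_max lexx orbT.
have hm : c * cabs (W z (i.+1 + j) w) <= (c * m) ^+ d.
  apply: le_trans (_ : c * (c * m ^+ d) <= _); first by rewrite ler_pM2l.
  rewrite mulrA -expr2 exprMn ler_wpM2r ?exprn_ge0 ?(le_trans ler01) //.
  by rewrite ler_weXn2l // (st_d S).
by case: (leP (cabs (W z (i.+1 + j) w)) r).
Qed.

(** Otherwise points of the disc that are still below [r] at arbitrarily late times cluster; by
    [escape_mono] they were below [r] at all earlier times, so the cluster point belongs to [K]. *)
Lemma uniform_escape z v (s : R) : julia p z ->
  (forall x, cabs (x - v) <= s -> ~ Kz z x) ->
  exists j0, forall j x, (j0 <= j)%N -> cabs (x - v) <= s -> r < cabs (W z j x).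
Proof.
move=> jz nK; apply: contrapT => h.
have ch j : exists x, cabs (x - v) <= s /\ cabs (W z j x) <= r.
  apply: contrapT => hj; apply: h; exists j => k x jk xv.
  rewrite ltNge; apply/negP => xr; apply: hj; exists x; split; first exact: xv.
  exact: (escape_mono S jz (lexx r) jk xr).
have [x hx] := choice ch.
have bx n : True -> cabs (x n) <= cabs v + s.
  by move=> _; apply: le_trans (cabs_le_add _ v) _; rewrite lerD2l; have [] := hx n.
have [l hl] := bw_cplx infinitely_all bx.
apply: (nK l).
  apply: (ball_closed (u := v)) => e e0; have [n _ [_ hn]] := hl e e0 0%N.
  by exists (x n); [have [] := hx n|rewrite cabsB].
apply/(KzP S _ jz) => i; rewrite leNgt; apply/negP => ri.
have e0 : 0 < cabs (W z i l) - r by rewrite subr_gt0.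
have [t t0 ht] := W_cont p q z l i e0.
have [n ni [_ hn]] := hl t t0 i.
have := ht z (x n); rewrite subrr cabs0 cabsB => /(_ t0 hn) h1.
have h2 := escape_mono S jz (lexx r) ni (hx n).2.
by have := cabs_le_add (W z i l) (W z i (x n)); lra.
Qed.

(** A convex power lies below its chord over [[0, 1]]. At [x = 2^-n] and [m = n] it shows that
    [(1 + 2^-n) ^+ n] is at most 2. *)
Lemma expr1D_le (x : R) m : 0 <= x <= 1 -> (1 + x) ^+ m <= 1 + (2 ^+ m - 1) * x.
Proof.
move=> /andP[x0 x1]; elim: m => [|m IH]; first by rewrite !expr0; lra.
have p0 : 1 <= (2 : R) ^+ m by rewrite exprn_ege1 // ler1n.
rewrite exprS; apply: le_trans (_ : (1 + x) * (1 + (2 ^+ m - 1) * x) <= _).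
  by rewrite ler_wpM2l // addr_ge0.
rewrite [X in _ <= X]/= [(2 : R) ^+ m.+1]exprS; move: p0; set y := 2 ^+ m => y1.
have h1 : (y - 1) * x * x <= (y - 1) * x.
  by rewrite ler_piMr // mulr_ge0 // subr_ge0.
lra.
Qed.

(* Over [z'] near [z] with no point of [J_z'] near [v], a whole disc around [v]
   escapes, so a high iterate [T] is zero-free and [> 1] there; since [T] is
   much smaller at [v] than at [u], this contradicts [circle_product]. *)
Lemma Jz_lsc z v (s : R) : julia p z -> Jz z v -> 0 < s ->
  exists2 e : R, 0 < e & forall z', julia p z' -> cabs (z - z') < e ->
    exists2 v', Jz z' v' & cabs (v - v') < s.
Proof.
move=> jz Jv s0; have r0 := r_gt0 S; have r1 := st_r S; have d0 := d_gt0 S.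
have /andP[a0 a1] := st_a S; have c1 := st_c S.
have s80 : 0 < s / 8 by rewrite divr_gt0.
pose B1 := c * (r + 1).
have c0 : 0 < c := lt_le_trans ltr01 c1.
have B10 : 0 < B1 by rewrite mulr_gt0 ?addr_gt0.
have Ba0 : 0 <= 2 * B1 / a.
  apply: divr_ge0; last exact: ltW.
  by apply: mulr_ge0; [exact: ler0n|exact: ltW].
have s40 : 0 < s / 4 by rewrite divr_gt0.
have [Kv /(_ _ s80)[u nKu vu]] := proj1 (boundaryP v (Kz_closed S jz)) Jv.
(* After losing 1 in the passage to [z'], [a] times the modulus at [u] still exceeds [2 * B1]; the
   factor 2 pays for the error term of [circle_product]. *)
have [j0 hj0] := escape_unbounded jz nKu (r + 2 * B1 / a + 1).
have [e1 e10 he1] := W_cont p q z u j0 ltr01.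
have [e2 e20 he2] := W_cont p q z v (j0 + j0) ltr01.
clear nKu.
exists (Num.min e1 e2); first by rewrite lt_min e10.
move=> z' jz'; rewrite lt_min => /andP[ze1 ze2].
have Wu : r + 2 * B1 / a < cabs (W z' j0 u).
  have := he1 z' u ze1; rewrite subrr cabs0 => /(_ e10).
  have := cabs_le_add (W z j0 u) (W z' j0 u); lra.
have Wv : cabs (W z' (j0 + j0) v) <= r + 1.
  have := he2 z' v ze2; rewrite subrr cabs0 => /(_ e20); rewrite cabsB.
  have := proj1 (KzP S v jz) Kv (j0 + j0)%N.
  clear Kv; have := cabs_le_add (W z' (j0 + j0) v) (W z (j0 + j0) v); lra.
clear Kv; have ru : r <= cabs (W z' j0 u) by lra.
apply: contrapT => nJ.
have [j2 hj2] : exists j2, forall j x, (j2 <= j)%N -> cabs (x - v) <= s / 4 ->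
    r < cabs (W z' j x).
  apply: (uniform_escape jz') => x xv Kx; apply: nJ.
  have nKu' : ~ Kz z' u by move=> /(KzP S _ jz')/(_ j0); lra.
  have [v' Jv' v'x] := segment_boundary (Kz_closed S jz') Kx nKu'.
  clear Kx nKu'; exists v'; first exact: Jv'.
  have h1 : cabs (u - x) < s / 8 + s / 4.
    by apply: le_lt_trans (cabs_tri v _ _) _; rewrite cabsB [cabs (v - x)]cabsB; lra.
  by apply: le_lt_trans (cabs_tri x _ _) _; rewrite cabsB [cabs (x - v')]cabsB; lra.
clear nJ.
(* [v] stays bounded for [j0] steps more than [u], so up to time [j] its growth has exponent [d ^ i]
   against [d ^ (i + j0)] for [u]. A polygon with [n = d ^ j0] vertices equalizes them: [|T.[v]| ^+
   n] and [|T.[u]|] are compared at the common exponent [E]. *)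
pose i := (j2 + (j0 + j0))%N; pose j := (i + (j0 + j0))%N.
have j2j : (j2 <= j)%N by rewrite /j /i -addnA leq_addr.
pose T := fiber_iter p q z' j; pose n := (d ^ j0)%N.
have n0 : (0 < n)%N by rewrite expn_gt0 d0.
have [w pw] := @cplx_prim_root R n n0.
have w1 k : cabs (w ^+ k) = 1.
  have wn : cabs w ^+ n = 1 by rewrite -cabsX prim_expr_order // cabs1.
  rewrite cabsX; have -> : cabs w = 1; last by rewrite expr1n.
  by apply/eqP; rewrite -(@pexpr_eq1 _ (cabs w) n) ?cabs_ge0 // wn.
have hs : cabs (u - v) <= s / 4 / 2 by rewrite cabsB; lra.
have nz x : cabs (x - v) < s / 4 -> T.[x] != 0.
  by move=> xv; rewrite -cabs_gt0; have := hj2 j x j2j (ltW xv); rewrite -/T; lra.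
have cp := circle_product pw s40 hs nz.
have sT : (size T).-1 = (d ^ j)%N by rewrite /T (fiber_iter_szn S).
rewrite sT in cp.
(* The vertex [k = 0] is [u]; the others lie in the escaping disc, where [|T| > r >= 1], and only
   increase the product. *)
have lowprod : cabs T.[u] <= \prod_(k < n) cabs T.[v + (u - v) * w ^+ k].
  rewrite (bigD1 (Ordinal n0)) //= expr0 mulr1 [v + _]addrC subrK.
  rewrite ler_peMr ?cabs_ge0 //; elim/big_rec : _ => // k y _ y1.
  have : r < cabs T.[v + (u - v) * w ^+ k].
    apply: hj2 => //; rewrite [v + _]addrC addrK cabsM w1 mulr1; lra.
  by move=> h; rewrite -[1]mulr1 ler_pM // ltW // (le_lt_trans r1).
pose E := (d ^ (i + j0))%N.
have E0 : (0 < E)%N by rewrite expn_gt0 d0.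
have [_ low] := growth_below (i + j0)%N jz' ru.
rewrite -addnA -/j -/E -/T in low.
have up := growth_above i jz' Wv; rewrite -/j -/T -/B1 in up.
have upn : cabs T.[v] ^+ n <= B1 ^+ E.
  rewrite /E expnD exprM lerXn2r ?nnegrE ?cabs_ge0 ?exprn_ge0 //; exact: ltW.
have upe : (1 + 2^-1 ^+ n) ^+ (d ^ j) <= (2 : R) ^+ E.
  have -> : (d ^ j = n * E)%N by rewrite /E /n -expnD /j addnA addnC.
  have p0 : 0 <= (2^-1 : R) ^+ n by rewrite exprn_ge0 // invr_ge0.
  rewrite exprM lerXn2r ?nnegrE ?exprn_ge0 ?addr_ge0 //.
  apply: le_trans (expr1D_le _ _) _.
    by rewrite p0 /= exprn_ile1 ?invr_ge0 // invf_le1 // ler1n.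
  have p2 : (2 : R) ^+ n * 2^-1 ^+ n = 1 by rewrite -exprMn divff ?expr1n ?pnatr_eq0.
  by rewrite mulrBl mul1r p2; lra.
have fin : (a * cabs (W z' j0 u)) ^+ E <= (B1 * 2) ^+ E.
  apply: le_trans low _; apply: le_trans (_ : cabs T.[u] <= _).
    by rewrite ler_piMl ?cabs_ge0.
  apply: le_trans lowprod _; apply: le_trans cp _; rewrite exprMn.
  have p0 : 0 <= (2^-1 : R) ^+ n by rewrite exprn_ge0 // invr_ge0.
  apply: ler_pM; [by rewrite exprn_ge0 ?cabs_ge0| |exact: upn|exact: upe].
  by apply: exprn_ge0; apply: addr_ge0.
have aw0 : 0 <= a * cabs (W z' j0 u) by apply: mulr_ge0; [exact: ltW|exact: cabs_ge0].
have B20 : 0 <= B1 * 2 by apply: mulr_ge0; [exact: ltW|exact: ler0n].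
move: fin; rewrite (ler_pXn2r E0) ?nnegrE ?aw0 ?B20 //.
have : a * (r + 2 * B1 / a) < a * cabs (W z' j0 u) by rewrite ltr_pM2l.
rewrite mulrDr [a * (_ / a)]mulrC divfK; last by rewrite gt_eqF.
have : 0 < a * r by rewrite mulr_gt0.
lra.
Qed.

End Semicontinuity.

(** * The four inclusions *)

Section Accumulation.
Variable R : realType.
Local Notation C := (Cplx R).

Lemma accumP (g : C * C -> C * C) (X : set (C * C)) y :
  accum g X y <-> forall n0 (e : R), 0 < e ->
    exists n x, [/\ (n0 <= n)%N, X x & near2 e y (iter n g x)].
Proof.
split=> [h n0 e e0|h n0 _].
  have /closure_cplx2/(_ e e0)[z [n /= n0n [x Xx <-]] yz] := h n0 I.
  by exists n, x.
apply/closure_cplx2 => e e0; have [n [x [n0n Xx yx]]] := h n0 e e0.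
by exists (iter n g x); [exists n => //; exists x|].
Qed.

Lemma accum1P (g : C * C -> C * C) x y :
  accum g [set x] y <-> forall e : R, 0 < e ->
    infinitely (fun n => near2 e y (iter n g x)).
Proof.
split=> [/accumP h e e0 n0|h].
  by have [n [_ [n0n -> yx]]] := h n0 e e0; exists n.
by apply/accumP => n0 e e0; have [n n0n yx] := h e e0 n0; exists n, x.
Qed.

Lemma accum_sub (T : topologicalType) (g : T -> T) (X Y : set T) :
  X `<=` Y -> accum g X `<=` accum g Y.
Proof.
move=> XY y h n0 n0T; apply: closure_subset (h n0 n0T) => z [n n0n [x Xx <-]].
by exists n => //; exists x => //; exact: XY.
Qed.

Lemma accum_closed (T : topologicalType) (g : T -> T) (X : set T) : closed (accum g X).
Proof. by apply: closed_bigI => n _; exact: closed_closure. Qed.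

Lemma accum_pt_cc (T : topologicalType) (g : T -> T) (X : set T) :
  accum_pt g X `<=` accum_cc g X.
Proof.
apply: closure_subset => y [x Xx h]; exists x => //.
by apply: accum_sub h => _ ->; exact: connected_component_refl.
Qed.

Lemma accum_cc_sub (T : topologicalType) (g : T -> T) (X : set T) :
  accum_cc g X `<=` accum g X.
Proof.
rewrite [X in _ `<=` X](proj1 (closure_id _) (@accum_closed T g X)).
apply: closure_subset => y [x Xx h].
by apply: accum_sub h; exact: connected_component_sub.
Qed.

Lemma infinitely_mod (P : nat -> Prop) N : (0 < N)%N -> infinitely P ->
  exists s, (s < N)%N /\ infinitely (fun n => P n /\ (n %% N = s)%N).
Proof.
move=> N0 infP; apply: contrapT => h.
have ch s : exists M, (s < N)%N -> forall n, (M <= n)%N -> P n -> (n %% N)%N <> s.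
  apply: contrapT => hs; apply: h; exists s; split.
    by apply: contrapT => sN; apply: hs; exists 0%N => sN'; case: sN.
  move=> n0; apply: contrapT => hn; apply: hs; exists n0 => _ n n0n Pn ns.
  by apply: hn; exists n.
have [M hM] := choice ch.
have [n Mn Pn] := infP (\max_(s < N) M s).
have nN : (n %% N < N)%N by rewrite ltn_pmod.
apply: (hM _ nN n _ Pn (erefl _)).
by apply: leq_trans Mn; exact: (leq_bigmax (F := fun s : 'I_N => M s) (Ordinal nN)).
Qed.

(** [closing] works with the [N]-th iterate, so its two return times must differ by a positive
    multiple of [N]; the pigeonhole principle modulo [N] finds them. *)
Lemma infinitely_pair (P : nat -> Prop) N : (0 < N)%N -> infinitely P ->
  exists n l, [/\ (0 < l)%N, P n & P (n + l * N)%N].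
Proof.
move=> N0 infP; have [s [_ h]] := infinitely_mod N0 infP.
have [n _ [Pn ns]] := h 0%N; have [n' nn' [Pn' ns']] := h n.+1.
exists n, ((n' - n) %/ N)%N.
have dv : (N %| n' - n)%N.
  by rewrite -eqn_mod_dvd ?(ltnW nn') // ns ns'.
rewrite divnK // subnKC ?(ltnW nn') //; split=> //.
by rewrite divn_gt0 // dvdn_leq // subn_gt0.
Qed.

End Accumulation.

(** * Accumulation sets compared with [Lambda] and its unstable set *)

Section Inclusions.
Variable R : realType.
Local Notation C := (Cplx R).
Variables (d : nat) (p : {poly C}) (q : {poly {poly C}}) (b : C).
Variables (B r a c ce L : R).
Hypothesis S : setup d p q b B r a c ce L.
Variables (tau : R) (N : nat).
Hypothesis tau0 : 0 < tau.
Hypothesis N0 : (0 < N)%N.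
Hypothesis expN : 4 <= ce * L ^+ N.
Local Notation Z n z := (iter n (horner p) z).
Local Notation W z n w := ((fiber_iter p q z n).[w]).
Local Notation dW z n w := ((fiber_iter p q z n)^`()).[w].
Local Notation Kz z w := (filled_julia2 p q (z, w)).
Local Notation Jz z w := (fiber_julia p q z w).
Local Notation f := (skew_map p q).
Local Notation X := (critical_locus p q).
Local Notation Ls := (Lset p q tau).
Hypothesis farN : forall z w n, julia p z -> ((fiber q z)^`()).[w] = 0 ->
    far p q tau (Z n z) (W z n w).
Hypothesis conN : forall z w, Ls z w -> cabs (dW z N w) <= 1 / 4.

Lemma skew_cont n x (e : R) : 0 < e -> exists2 s : R, 0 < s &
  forall y, near2 s x y -> near2 e (iter n f x) (iter n f y).
Proof.
move=> e0; have [s s0 hs] := lip_cont x (lipB_iter p n) e0.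
have [g1 _ _] := goodF_iter p q n; have [t t0 ht] := lip_cont x g1 e0.
exists (Num.min s t) => [|y xy]; first by rewrite lt_min s0.
rewrite !iter_skewE; split=> /=.
  by apply: hs; apply: near2_le xy; rewrite ge_min lexx.
by apply: ht; apply: near2_le xy; rewrite ge_min lexx orbT.
Qed.

(** By [escape_mono], bounds at infinitely many times bound the whole orbit. *)
Lemma recurrent_filled x y : julia p x.1 ->
  infinitely (fun n => near2 1 y (iter n f x)) -> Kz x.1 x.2.
Proof.
move=> jx inf; pose M := r + cabs y.2 + 1.
have y0 := cabs_ge0 y.2; have r0 := r_gt0 S.
apply/bounded_cplx2; exists (B + M) => n; rewrite iter_skew /=.
have B0 := B_gt0 S; have h1 := julia_bound S (juliaZ S n jx).
have [k nk [_ h2]] := inf n; rewrite iter_skewE /= in h2.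
have h3 : cabs (W x.1 k x.2) <= M.
  have := cabs_le_add (W x.1 k x.2) y.2.
  by rewrite [cabs (_ - y.2)]cabsB /M; lra.
have rM : r <= M by rewrite /M; lra.
have h4 := escape_mono S jx rM nk h3.
by rewrite /M in h4 *; split; lra.
Qed.

Lemma far_safe_orbit z w : julia p z -> Kz z w ->
  (forall n, far p q tau (Z n z) (W z n w)) -> Ls z w.
Proof.
move=> jz Kw fw; split; first exact: jz.
move=> n; apply: (far_safe S (juliaZ S n jz) _ (fw n)).
exact: (proj1 (Kz_iter S n w jz) Kw).
Qed.

Lemma critical_Lset x : X x -> Kz x.1 x.2 -> Ls x.1 x.2.
Proof.
by move=> [jx cx] Kx; apply: (far_safe_orbit jx Kx) => n; exact: farN.
Qed.

Lemma Lset_closed x : (forall e : R, 0 < e -> exists2 y, Ls y.1 y.2 & near2 e x y) ->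
  Ls x.1 x.2.
Proof.
move=> h; have jx : julia p x.1.
  by apply: (julia_closed S) => e /h[y [jy _] [xy _]]; exists y.1.
split; first exact: jx.
move=> n v vx; apply: (Kz_closed2 S (juliaZ S n jx)) => e e0.
have m0 : 0 < Num.min e (tau - cabs (v - W x.1 n x.2)) by rewrite lt_min e0 subr_gt0.
have [s s0 hs] := skew_cont n x m0.
have [y [jy Ly] /hs] := h s s0; rewrite !iter_skewE => -[/= h1 h2].
rewrite !lt_min in h1 h2; case/andP: h1 => h1 _; case/andP: h2 => _ h2.
exists (Z n y.1), v; split; [exact: (juliaZ S n jy)|apply: Ly|exact: h1|by rewrite subrr cabs0].
by apply: le_lt_trans (cabs_tri (W x.1 n x.2) _ _) _; lra.
Qed.

(** A saddle is a limit of the orbit of a critical point. That point is in [K], so its orbit lies in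
    [Ls], which is closed; saddles thus inherit the distance [tau] from critical orbits. *)
Lemma saddle_Lset s : saddle_point p q s -> Ls s.1 s.2.
Proof.
move=> /(saddle_critical S)[x Xx acc].
have Kx : Kz x.1 x.2.
  apply: (recurrent_filled (y := s)); first by case: Xx.
  by apply: infinitely_mono (acc 1 ltr01) => n; exact: near2_sym.
have Lx := critical_Lset Xx Kx.
apply: Lset_closed => e e0; have [n _ xs] := acc e e0 0%N.
exists (iter n f x); last exact: near2_sym.
by rewrite iter_skewE; exact: (Lset_iter S n Lx).
Qed.

Lemma saddle_setE : saddle_set p q = closure (saddle_point p q).
Proof. by []. Qed.

Lemma Lambda_Lset x : saddle_set p q x -> Ls x.1 x.2.
Proof.
rewrite saddle_setE => /closure_cplx2 h; apply: Lset_closed => e e0.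
by have [y Sy xy] := h e e0; exists y; [exact: saddle_Lset|].
Qed.

Lemma Lambda_sub_accum_pt : saddle_set p q `<=` accum_pt f X.
Proof.
rewrite saddle_setE; apply: closure_subset => s /(saddle_critical S)[x Xx acc].
exists x; first exact: Xx.
by apply/accum1P => e e0; apply: infinitely_mono (acc e e0) => n; exact: near2_sym.
Qed.

Lemma orbit_step (x : C * C) i : iter (i.+1 * N) f x =
  (Z N (iter (i * N) f x).1, W (iter (i * N) f x).1 N (iter (i * N) f x).2).
Proof. by rewrite mulSn iterD iter_skewE. Qed.

Lemma accum_pt_sub_Lambda : accum_pt f X `<=` saddle_set p q.
Proof.
rewrite saddle_setE [Y in _ `<=` Y](proj1 (closure_id _) (@closed_closure _ _)).
apply: closure_subset => y [x Xx /accum1P acc].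
have jx : julia p x.1 by case: Xx.
have Lx := critical_Lset Xx (recurrent_filled jx (acc 1 ltr01)).
apply/closure_cplx2 => e e0.
have e2 : 0 < e / 2 by rewrite divr_gt0.
have [del del0 cl] := closing S tau0 N0 expN conN e2.
have m0 : 0 < Num.min (del / 2) (e / 2) by rewrite lt_min divr_gt0.
have [n [l [l0 yn yn']]] := infinitely_pair N0 (acc _ m0).
have Lon k : Ls (iter k f x).1 (iter k f x).2.
  by rewrite iter_skewE; exact: (Lset_iter S k Lx).
have [||i il||s Ss sx] := cl (fun i => iter (i * N) f (iter n f x)) l l0.
- by rewrite /= iter_skewE /=; exact: (juliaZ S n jx).
- by move=> i; exact: orbit_step.
- exists (iter (i * N) f (iter n f x)).1, (iter (i * N) f (iter n f x)).2.
  by rewrite -iterD; split; [exact: Lon|exact: near2_refl].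
- rewrite -iterD addnC /=; apply: near2_half (near2_sym _) _.
    by apply: near2_le yn'; rewrite ge_min lexx.
  by apply: near2_le yn; rewrite ge_min lexx.
exists s; first exact: Ss.
apply: near2_half _ (near2_sym sx).
by apply: near2_le yn; rewrite ge_min lexx orbT.
Qed.

Lemma accum_julia y : accum f X y -> julia p y.1.
Proof.
move=> /accumP h; apply: (julia_closed S) => e e0.
have [n [x [_ [jx _] [xy _]]]] := h 0%N e e0.
exists (iter n f x).1; last exact: xy.
by rewrite iter_skewE; exact: (juliaZ S n jx).
Qed.

(* An accumulation point may lie outside [K], because critical points over [J_p]
   need not escape uniformly; only its distance to [J_z] is controlled. *)
Lemma accum_far y : accum f X y -> far p q tau y.1 y.2.
Proof.
move=> Ay v Jv; rewrite leNgt; apply/negP => yv.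
have s0 : 0 < (tau - cabs (y.2 - v)) / 2 by rewrite divr_gt0 // subr_gt0.
have [e e0 he] := Jz_lsc S (accum_julia Ay) Jv s0.
have m0 : 0 < Num.min e ((tau - cabs (y.2 - v)) / 2) by rewrite lt_min e0.
have [n [x [_ [jx cx] []]]] := proj1 (accumP _ _ _) Ay 0%N _ m0.
rewrite iter_skewE /= !lt_min => /andP[h1 _] /andP[_ h2].
have [v' Jv' vv'] := he _ (juliaZ S n jx) h1.
have := farN (n := n) jx cx Jv'.
have := cabs_tri y.2 (W x.1 n x.2) v'; have := cabs_tri v y.2 v'.
rewrite [cabs (W _ _ _ - y.2)]cabsB; lra.
Qed.

(** Critical iterates approaching [y] have predecessors on their orbits; these stay bounded because
    the fibre maps double beyond [r], and a cluster point of them is the preimage. The bound by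
    [max(r, |y.2|)] is stable under repetition and bounds a whole backward orbit. *)
Lemma accum_preimage y : accum f X y ->
  exists y', [/\ accum f X y', f y' = y & cabs y'.2 <= Num.max r (cabs y.2)].
Proof.
move=> /accumP Ay; have r0 := r_gt0 S; have B0 := B_gt0 S.
have ch k : exists ux : nat * (C * C), [/\ (k <= ux.1)%N, X ux.2 &
    near2 k.+1%:R^-1 y (iter ux.1.+1 f ux.2)].
  have k0 : 0 < (k.+1%:R^-1 : R) by rewrite invr_gt0.
  (* Asking for a time of at least [k.+1] makes it positive, so that a predecessor exists, still at
     a time of at least [k]. *)
  have [[|n] [x [kn Xx xy]]] := Ay k.+1 _ k0; first by [].
  by exists (n, x).
have [ux hux] := choice ch.
pose u k := iter (ux k).1 f (ux k).2.
have ju k : julia p (u k).1.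
  have [_ [jx _] _] := hux k; rewrite /u iter_skewE; exact: (juliaZ S _ jx).
have fu k : near2 k.+1%:R^-1 y (f (u k)) by have [_ _] := hux k.
have inv1 k : (k.+1%:R^-1 : R) <= 1 by rewrite invf_le1 ?ler1n ?ltr0n.
have bu k : True -> cabs (u k).1 <= B + r + cabs y.2 + 1 /\
                    cabs (u k).2 <= B + r + cabs y.2 + 1.
  move=> _; have uB := julia_bound S (ju k); have y0 := cabs_ge0 y.2.
  split; first lra.
  have [ru|ur] := leP r (cabs (u k).2); last by lra.
  have h1 := st_q S uB ru; have [_ h2] := fu k; rewrite /= in h2.
  have h3 := cabs_le_add (fiber q (u k).1).[(u k).2] y.2.
  rewrite [cabs (_ - y.2)]cabsB in h3; have h4 := lt_le_trans h2 (inv1 k).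
  by clear h2; lra.
have [y' hy'] := bw_cplx2 infinitely_all bu.
have Ay' : accum f X y'.
  apply/accumP => n0 e e0; have [k n0k [_ uk]] := hy' e e0 n0.
  exists (ux k).1, (ux k).2; have [h1 h2 _] := hux k.
  by split; [exact: leq_trans h1|exact: h2|exact: near2_sym].
have fy' : f y' = y.
  have small (e : R) : 0 < e -> near2 e (f y') y.
    move=> e0; have e2 : 0 < e / 2 by rewrite divr_gt0.
    have [s s0 hs] := skew_cont 1 y' e2.
    have [k0 hk0] := inv_small e2.
    have [k k0k [_ /near2_sym/hs /= h1]] := hy' s s0 k0.
    apply: near2_half h1 (near2_sym _).
    by apply: near2_le (fu k); exact/ltW/hk0.
  have eq0 (x1 x2 : C) : (forall e : R, 0 < e -> cabs (x1 - x2) < e) -> x1 = x2.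
    move=> h; apply/eqP; rewrite -subr_eq0 -cabs_eq0 eq_le cabs_ge0 andbT.
    exact: le_small.
  rewrite [LHS]surjective_pairing [RHS]surjective_pairing.
  by congr pair; apply: eq0 => e /small[].
exists y'; split; [exact: Ay'|exact: fy'|].
rewrite leNgt; apply/negP; rewrite gt_max => /andP[h1 h2].
have yB := julia_bound S (accum_julia Ay').
have := st_q S yB (ltW h1).
have -> : (fiber q y'.1).[y'.2] = y.2 by rewrite -fy'.
lra.
Qed.

Lemma accum_sub_unstable : accum f X `<=` unstable_set f (saddle_set p q).
Proof.
move=> y Ay; have r0 := r_gt0 S; pose Y := Num.max r (cabs y.2).
have ch x : exists x', accum f X x -> [/\ accum f X x', f x' = x &
    cabs x'.2 <= Num.max r (cabs x.2)].
  have [Ax|nA] := pselect (accum f X x); last by exists x.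
  by have [x' h] := accum_preimage Ax; exists x'.
have [g hg] := choice ch.
pose u k := iter k g y.
have Au k : accum f X (u k).
  by elim: k => [|k IH]; [exact: Ay|have [] := hg _ IH].
have fu k : f (u k.+1) = u k by have [] := hg _ (Au k).
have uY k : cabs (u k).2 <= Y.
  elim: k => [|k IH]; first by rewrite le_max lexx orbT.
  have [_ _ h] := hg _ (Au k); apply: le_trans h _.
  by rewrite ge_max IH le_max lexx.
have fiu n k : iter n f (u (n + k)%N) = u k.
  by elim: n => // n IH; rewrite iterSr fu.
have bu k : cabs (u k).1 <= Num.max B Y /\ cabs (u k).2 <= Num.max B Y.
  split; last by rewrite le_max uY orbT.
  by rewrite le_max (julia_bound S (accum_julia (Au k))).
have cluster P : infinitely P -> exists l, forall e : R, 0 < e ->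
    infinitely (fun k => P k /\ near2 e (u k) l).
  move=> infP; apply: (bw_cplx2 (M := Num.max B Y) infP) => k _.
  exact: bu.
have limL l : (forall e : R, 0 < e -> infinitely (fun k => near2 e (u k) l)) ->
    Ls l.1 l.2.
  move=> hl.
  have An n : accum f X (iter n f l).
    apply/accumP => n0 e e0; have e2 : 0 < e / 2 by rewrite divr_gt0.
    have [s s0 hs] := skew_cont n l e2.
    have [k nk /near2_sym/hs h1] := hl s s0 n.
    rewrite -(subnKC nk) fiu in h1.
    have [m [x [h2 h3 h4]]] := proj1 (accumP _ _ _) (Au (k - n)%N) n0 _ e2.
    by exists m, x; split; [exact: h2|exact: h3|exact: near2_half h1 h4].
  have jl : julia p l.1 by have := accum_julia (An 0%N).
  have Kl : Kz l.1 l.2.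
    apply/bounded_cplx2; exists (B + (Y + 1)) => n; rewrite iter_skew /=.
    have B0 := B_gt0 S; have h1 := julia_bound S (juliaZ S n jl).
    have Y0 : 0 < Y by rewrite lt_max r0.
    have [s s0 hs] := skew_cont n l ltr01.
    have [k nk /near2_sym/hs] := hl s s0 n.
    rewrite -(subnKC nk) fiu iter_skewE => -[_ /= h2].
    have := uY (k - n)%N; have := cabs_le_add (W l.1 n l.2) (u (k - n)%N).2.
    by move=> h3 h4; split; lra.
  apply: (far_safe_orbit jl Kl) => n; have := accum_far (An n).
  by rewrite iter_skewE.
(* The points [u k] may lie outside [K]; compactness brings them close to [Ls] from some index on,
   which is all that [closing] asks of a segment. *)
have nearL (e : R) : 0 < e -> exists k0, forall k, (k0 <= k)%N ->
    exists z w, Ls z w /\ near2 e (u k) (z, w).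
  move=> e0; apply: contrapT => h.
  pose P k := ~ exists z w, Ls z w /\ near2 e (u k) (z, w).
  have infP : infinitely P.
    move=> n0; apply: contrapT => hn; apply: h; exists n0 => k nk.
    by apply: contrapT => hk; apply: hn; exists k.
  have [l hl] := cluster P infP.
  have Ll : Ls l.1 l.2.
    by apply: limL => e' e'0; apply: infinitely_mono (hl e' e'0) => k [].
  have [k _ [Pk lk]] := hl e e0 0%N; apply: Pk; exists l.1, l.2.
  by split; [exact: Ll|case: (l) lk].
have limS l : (forall e : R, 0 < e -> infinitely (fun k => near2 e (u k) l)) ->
    saddle_set p q l.
  move=> hl; apply/closure_cplx2 => e e0.
  have e2 : 0 < e / 2 by rewrite divr_gt0.
  have [del del0 cl] := closing S tau0 N0 expN conN e2.
  have [k0 hk0] := nearL del del0.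
  have m0 : 0 < Num.min (del / 2) (e / 2) by rewrite lt_min divr_gt0.
  have inf' : infinitely (fun k => (k0 <= k)%N /\
      near2 (Num.min (del / 2) (e / 2)) (u k) l).
    move=> n0; have [k kn h] := hl _ m0 (maxn n0 k0).
    rewrite geq_max in kn; case/andP: kn => k1 k2.
    by exists k.
  have [k [m [m0' [k0k uk] [k0k' uk']]]] := infinitely_pair N0 inf'.
  (* Read forwards from index [k + m * N] down to [k], the backward orbit is an orbit segment of the
     [N]-th iterate; it is almost closed because both ends are near [l]. *)
  have uE i : (i <= m)%N -> iter (i * N) f (u (k + m * N)%N) = u (k + (m - i) * N)%N.
    move=> im; rewrite -(fiu (i * N)%N (k + (m - i) * N)%N); congr (iter _ _ (u _)).
    by rewrite addnCA -mulnDl subnKC.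
  have [||i im||s Ss sx] := cl (fun i => iter (i * N) f (u (k + m * N)%N)) m m0'.
  - exact: accum_julia (Au _).
  - by move=> i; exact: orbit_step.
  - rewrite uE ?(ltnW im) //; apply: hk0; exact: leq_trans k0k (leq_addr _ _).
  - rewrite /= (uE m (leqnn m)) subnn mul0n addn0; apply: near2_half _ (near2_sym _).
      by apply: near2_le uk; rewrite ge_min lexx.
    by apply: near2_le uk'; rewrite ge_min lexx.
  exists s; first exact: Ss.
  apply: near2_half (near2_sym _) (near2_sym sx).
  by apply: near2_le uk'; rewrite ge_min lexx orbT.
exists u; split; [by []|exact: fu|].
move=> e e0; apply: contrapT => h.
pose P k := ~ exists2 y0, saddle_set p q y0 & ball y0 (e%:C%C : C) (u k).
have infP : infinitely P.
  move=> n0; apply: contrapT => hn; apply: h; exists n0 => // k /= nk.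
  by apply: contrapT => hk; apply: hn; exists k.
have [l hl] := cluster P infP.
have Sl : saddle_set p q l.
  by apply: limS => e' e'0; apply: infinitely_mono (hl e' e'0) => k [].
have [k _ [Pk lk]] := hl e e0 0%N; apply: Pk; exists l; first exact: Sl.
by apply/ball_cplx2; exact: near2_sym.
Qed.

End Inclusions.

(** * The unstable set over [J_p] inside the accumulation set *)

Section UnstableInAccum.
Variable R : realType.
Local Notation C := (Cplx R).
Variables (d : nat) (p : {poly C}) (q : {poly {poly C}}) (b : C).
Variables (B r a c ce L : R).
Hypothesis S : setup d p q b B r a c ce L.
Variables (tau : R) (N : nat).
Hypothesis tau0 : 0 < tau.
Hypothesis N0 : (0 < N)%N.
Hypothesis expN : 4 <= ce * L ^+ N.
Local Notation Z n z := (iter n (horner p) z).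
Local Notation W z n w := ((fiber_iter p q z n).[w]).
Local Notation dW z n w := ((fiber_iter p q z n)^`()).[w].
Local Notation Kz z w := (filled_julia2 p q (z, w)).
Local Notation f := (skew_map p q).
Local Notation X := (critical_locus p q).
Local Notation Ls := (Lset p q tau).
Hypothesis farN : forall z w n, julia p z -> ((fiber q z)^`()).[w] = 0 ->
    far p q tau (Z n z) (W z n w).
Hypothesis conN : forall z w, Ls z w -> cabs (dW z N w) <= 1 / 4.

Lemma base_root n z (e : R) : 0 < e -> exists2 t : R, 0 < t & forall y,
  cabs (Z n z - y) < t -> exists2 x, Z n x = y & cabs (z - x) < e.
Proof.
move=> e0; have sP := poly_iter_size S n.
case sD : (size (poly_iter p n)) sP => [|[|D]] // _.
have lP0 : lead_coef (poly_iter p n) != 0.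
  by rewrite lead_coef_eq0 -size_poly_gt0 sD.
have [t t0 ht] := root_near_eps D lP0 e0.
exists t; first exact: t0.
move=> y zy; have [|x] := ht (poly_iter p n) (erefl _) sD z y.
  by rewrite horner_poly_iter.
by rewrite horner_poly_iter => Px zx; exists x.
Qed.

(** The derivatives of all fibre maps have the same degree and leading coefficient, so critical
    points can be followed into neighbouring fibres. *)
Lemma critical_root z w (e : R) : ((fiber q z)^`()).[w] = 0 -> 0 < e ->
  exists2 t : R, 0 < t & forall z', cabs (z - z') < t ->
    exists2 w', ((fiber q z')^`()).[w'] = 0 & cabs (w - w') < e.
Proof.
move=> cw e0; have d2 := st_d S.
have szd z' : size ((fiber q z')^`()) = d /\
    lead_coef ((fiber q z')^`()) = b *+ d.
  have [s1 l1] := fiber_size z' (st_sq S) (st_lq S) (st_b S).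
  have cd : ((fiber q z')^`())`_d.-1 = b *+ d.
    by rewrite coef_deriv prednK ?(d_gt0 S) // -l1 lead_coefE s1.
  have bd : b *+ d != 0 by rewrite mulrn_eq0 negb_or -lt0n (d_gt0 S) (st_b S).
  have sz : size ((fiber q z')^`()) = d.
    apply/eqP; rewrite eqn_leq; apply/andP; split.
      by rewrite -ltnS -s1 lt_size_deriv // -size_poly_gt0 s1.
    rewrite leqNgt; apply/negP => lt_d.
    have : (size ((fiber q z')^`()) <= d.-1)%N by rewrite -ltnS prednK ?(d_gt0 S).
    by move=> /leq_sizeP/(_ d.-1 (leqnn _))/eqP; rewrite cd (negbTE bd).
  by rewrite lead_coefE sz.
have bd : b *+ d != 0 by rewrite mulrn_eq0 negb_or -lt0n (d_gt0 S) (st_b S).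
have [s s0 hs] := root_near_eps d.-2 bd e0.
have [_ l1 _] := goodF_fiber q.
have [t t0 ht] := lip_cont (z, w) l1 s0.
exists t; first exact: t0.
move=> z' zz'; have [h1 h2] := szd z'.
have [||w' Pw ww'] := hs ((fiber q z')^`()) h2 _ w 0.
- by rewrite h1; case: (d) d2 => [|[|]].
- have := ht (z', w); rewrite /near2 /= subrr cabs0 cw sub0r cabsN subr0.
  by apply.
by exists w'.
Qed.

(* The orbit of a critical point attracted to a saddle point near [u k] is moved
   to a critical orbit ending in the fibre of [u k], by lifting [(u k).1] through
   the base orbit; the vertical contraction near [u 0, u 1, ...] does the rest. *)
Lemma unstable_sub_accum :
  unstable_set f (saddle_set p q) `&` (julia p `*` setT) `<=` accum f X.
Proof.
move=> x [[u [u0 fu uL]] [jx _]].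
have ju k : julia p (u k).1.
  elim: k => [|k IH]; first by rewrite u0.
  by apply/(julia_step S); have := IH; rewrite -fu.
have fiu n k : iter n f (u (n + k)%N) = u k.
  by elim: n => // n IH; rewrite iterSr fu.
apply/accumP => m0 e e0.
have [[rho M] /= [/andP[rho0 rho1] M0 con lipz]] := robust_contraction S tau0 conN.
have [sigma sigma0 [expa lift]] := base_lift S N0 expN.
have M1 : 0 < 32 * (M + 1) by rewrite mulr_gt0 // ltr_wpDl.
pose eta := Num.min (Num.min (rho / 32) (sigma / 4)) (rho / (32 * (M + 1))).
have eta0 : 0 < eta by rewrite !lt_min !divr_gt0.
have eta_rho : eta <= rho / 32 by rewrite !ge_min lexx.
have eta_sigma : eta <= sigma / 4 by rewrite !ge_min lexx !orbT.
have eta_M : M * eta <= rho / 32.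
  have : eta <= rho / (32 * (M + 1)) by rewrite !ge_min lexx !orbT.
  by rewrite ler_pdivlMr //; lra.
clearbody eta.
have [k1 _ hk1] := uL eta eta0.
have nearS k : (k1 <= k)%N -> exists2 y, saddle_set p q y & near2 eta (u k) y.
  move=> kk; have [y Sy /ball_cplx2 yu] := hk1 k kk.
  by exists y; [exact: Sy|exact: near2_sym].
(* From index [k1] on, the backward orbit stays within [eta] of [Ls] by [Lambda_Lset], so vertical
   discs around it halve at every block of [N] steps down to [u k1]; radius [rho / 2] leaves room
   for [eta]. *)
have shrink t w' (D : R) : D <= rho / 2 ->
    cabs (w' - (u (k1 + t * N)%N).2) <= D ->
    cabs (W (u (k1 + t * N)%N).1 (t * N) w' - (u k1).2) <= D * (1 / 2) ^+ t.
  elim: t w' D => [|t IH] w' D Drho ww'.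
    by rewrite mul0n addn0 hornerX expr0 mulr1 in ww' *.
  pose k := (k1 + t.+1 * N)%N.
  have kE : k = (N + (k1 + t * N))%N by rewrite /k mulSn addnCA.
  have [y Sy [uy1 uy2]] : exists2 y, saddle_set p q y & near2 eta (u k) y.
    by apply: nearS; rewrite leq_addr.
  have Ly := Lambda_Lset S farN Sy.
  rewrite -/k in ww' *.
  have D0 : 0 <= D := le_trans (cabs_ge0 _) ww'.
  have h0 : cabs ((u k).1 - y.1) <= rho by clear - S tau0 N0 expN farN conN uy1 eta_rho rho0; lra.
  have h1 : cabs (w' - y.2) <= rho.
    apply: le_trans (cabs_tri (u k).2 _ _) _.
    by clear - S tau0 N0 expN farN conN ww' Drho uy2 eta_rho rho0; lra.
  have h2 : cabs ((u k).2 - y.2) <= rho by clear - S tau0 N0 expN farN conN uy2 eta_rho rho0; lra.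
  have [_ h3] := con _ _ _ _ _ Ly h0 h1 h2.
  have uE : u (k1 + t * N)%N = (Z N (u k).1, W (u k).1 N (u k).2).
    by rewrite -(fiu N (k1 + t * N)%N) -kE iter_skewE.
  rewrite mulSnr horner_fiber_iterD.
  rewrite uE /= in IH.
  have D2 : D / 2 <= rho / 2 by clear - S tau0 N0 expN farN conN Drho D0 rho0; lra.
  have h4 : cabs (W (u k).1 N w' - W (u k).1 N (u k).2) <= D / 2.
    by clear - S tau0 N0 expN farN conN h3 ww'; lra.
  have h5 := IH _ _ D2 h4.
  by apply: le_trans h5 _; rewrite exprS mulrA mul1r.
have [s1 s10 hs1] := skew_cont p q k1 (u k1) e0.
have half01 : 0 <= (1 / 2 : R) < 1 by lra.
have [t0 ht0] := expr_small half01 (divr_gt0 s10 rho0).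
pose t := maxn t0 m0; pose k := (k1 + t * N)%N.
have [y Sy uy] : exists2 y, saddle_set p q y & near2 eta (u k) y.
  by apply: nearS; rewrite leq_addr.
have [s Ss ys] : exists2 s, saddle_point p q s & near2 eta y s.
  by move: Sy; rewrite saddle_setE => /closure_cplx2/(_ eta eta0).
have us := near2_tri uy ys.
have [cr Xcr acc] := saddle_critical S Ss.
have [jc cc] := Xcr.
have Kc : Kz cr.1 cr.2.
  apply: (recurrent_filled S (y := s) jc).
  by apply: infinitely_mono (acc 1 ltr01) => n; exact: near2_sym.
have Lc := critical_Lset S farN Xcr Kc.
have [m [mN infm]] := infinitely_mod N0 (acc eta eta0).
have r80 : 0 < rho / 8 by rewrite divr_gt0.
have [s2 s20 hs2] := W_cont p q cr.1 cr.2 m r80.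
have [s3 s30 hs3] := critical_root cc s20.
have s23 : 0 < Num.min s2 s3 by rewrite lt_min s20.
have [s4 s40 hs4] := base_root m cr.1 s23.
have sig0 : 0 < s4 / sigma by rewrite divr_gt0.
have [a0 ha0] := expr_small half01 sig0.
(* So late a time makes the base pullback of [(u k).1] land within [s4] of [Z m cr.1]. It can then
   be lifted through the remaining [m] steps to a point close to [cr.1], in whose fibre
   [critical_root] supplies a critical point. *)
have [i ia [ci im]] := infm (a0 * N)%N.
pose l := (i %/ N)%N.
have iE : i = (l * N + m)%N by rewrite [LHS](divn_eq i N) im.
have la : (a0 <= l)%N by rewrite leq_divRL.
have jm := juliaZ S m jc.
have zi : cabs (Z (l * N) (Z m cr.1) - (u k).1) <= 3 * eta.
  have [h1 _] := ci; have [h2 _] := us; rewrite iter_skewE /= in h1.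
  rewrite -iterD -iE; apply: le_trans (cabs_tri s.1 _ _) _.
  by rewrite [cabs (s.1 - _)]cabsB; clear - S tau0 N0 expN farN conN h1 h2; lra.
have zi_sigma : cabs (Z (l * N) (Z m cr.1) - (u k).1) <= sigma.
  by clear - S tau0 N0 expN farN conN zi eta_sigma sigma0; lra.
have [zb [jzb Zzb close geo]] := base_chain S sigma0 lift jm (ju k) zi_sigma.
have zb_near : cabs (Z m cr.1 - zb) < s4.
  have h1 := ha0 l la; rewrite ltr_pdivlMr // in h1.
  apply: le_lt_trans h1.
  have h2 : (1 / 2 : R) ^+ l * 2 ^+ l = 1 by rewrite -exprMn mul1r mulVf ?expr1n ?pnatr_eq0.
  have -> : cabs (Z m cr.1 - zb) = (1 / 2) ^+ l * (2 ^+ l * cabs (Z m cr.1 - zb)).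
    by rewrite mulrA h2 mul1r.
  apply: ler_wpM2l; first by rewrite exprn_ge0 // divr_ge0.
  exact: le_trans geo zi_sigma.
have [z0 Zz0] := hs4 zb zb_near; rewrite lt_min => /andP[zz2 zz3].
have [w0 cw0 ww0] := hs3 z0 zz3.
have jz0 : julia p z0 by apply/(julia_iter S m); rewrite Zz0.
have Wm := hs2 z0 w0 zz2 ww0.
(* A vertical error [e] becomes at most [e / 2 + 3 * M * eta] in one block, and the choice of [eta]
   makes the bound [rho / 4] invariant. *)
have shadow j : (j <= l)%N ->
    cabs (W zb (j * N) (W z0 m w0) - W (Z m cr.1) (j * N) (W cr.1 m cr.2)) <= rho / 4.
  elim: j => [|j IH] jl.
    by rewrite !hornerX cabsB; clear - S tau0 N0 expN farN conN Wm rho0; lra.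
  have {}IH := IH (ltnW jl).
  have Lj := Lset_iter S (j * N) (Lset_iter S m Lc).
  rewrite mulSn !horner_fiber_iterD.
  set y1 := W zb _ _ in IH *; set y2 := W (Z m cr.1) (j * N) _ in IH Lj *.
  set za := Z (j * N) (Z m cr.1) in Lj *.
  have h0 : cabs (Z (j * N) zb - za) <= 3 * eta.
    by rewrite cabsB; apply: le_trans (close j (ltnW jl)) zi.
  have h0' : cabs (Z (j * N) zb - za) <= rho.
    by clear - S tau0 N0 expN farN conN h0 eta_rho rho0; lra.
  have h1 : cabs (y1 - y2) <= rho by clear - S tau0 N0 expN farN conN IH rho0; lra.
  have h2 : cabs (y2 - y2) <= rho by rewrite subrr cabs0 ltW.
  have [_ h3] := con _ _ _ _ _ Lj h0' h1 h2.
  have ja : julia p za by case: Lj.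
  have y2r := Kz_bound S ja (safe_Kz tau0 (Lset_safe Lj)).
  have B1 : cabs (Z (j * N) zb) <= B + 1.
    by apply: le_trans (julia_bound S (juliaZ S (j * N) jzb)) _; rewrite lerDl.
  have B2 : cabs za <= B + 1.
    by apply: le_trans (julia_bound S ja) _; rewrite lerDl.
  have B3 : cabs y2 <= r + 1 by apply: le_trans y2r _; rewrite lerDl.
  have h4 := lipz _ _ _ B1 B2 B3.
  have h5 : M * cabs (Z (j * N) zb - za) <= M * (3 * eta) by rewrite ler_wpM2l.
  apply: le_trans (cabs_tri (W (Z (j * N) zb) N y2) _ _) _.
  by clear - S tau0 N0 expN farN conN h3 h4 h5 IH eta_M rho0; lra.
have fi : iter i f (z0, w0) = ((u k).1, W zb (l * N) (W z0 m w0)).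
  by rewrite iter_skew iE iterD horner_fiber_iterD Zz0 Zzb.
set v := W zb (l * N) (W z0 m w0) in fi.
have vu : cabs (v - (u k).2) <= rho / 2.
  have [_ h1] := ci; have [_ h2] := us; rewrite iter_skewE /= iE horner_fiber_iterD in h1.
  have h3 := shadow l (leqnn l); rewrite -/v in h3.
  apply: le_trans (cabs_tri (W (Z m cr.1) (l * N) (W cr.1 m cr.2)) _ _) _.
  have := cabs_tri s.2 (W (Z m cr.1) (l * N) (W cr.1 m cr.2)) (u k).2.
  rewrite [cabs (s.2 - (u k).2)]cabsB.
  by clear - S tau0 N0 expN farN conN h1 h2 h3 eta_rho rho0; lra.
have vk := shrink t v (rho / 2) (lexx _) vu.
exists (k1 + (t * N + i))%N, (z0, w0); split.
- apply: leq_trans (leq_addl _ _); apply: leq_trans (leq_addr _ _).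
  by apply: leq_trans (leq_pmulr t N0); rewrite leq_maxr.
- by split; [exact: jz0|exact: cw0].
rewrite iterD iterD fi iter_skew -u0 -(fiu k1 0%N) addn0.
apply: hs1; split=> /=.
  have := fiu (t * N)%N k1; rewrite addnC -/k iter_skewE => <- /=.
  by rewrite subrr cabs0.
rewrite cabsB; apply: le_lt_trans vk _.
have := ht0 t (leq_maxl _ _); rewrite ltr_pdivlMr // => h1.
have : 0 <= (1 / 2 : R) ^+ t by rewrite exprn_ge0 // divr_ge0.
by move: h1; set g := (1 / 2) ^+ t; clear - S tau0 N0 expN farN conN rho0; nra.
Qed.

End UnstableInAccum.

Unset Implicit Arguments.

Theorem theorem1p1 (R : realType) (d : nat) (p : {poly Cplx R})
    (q : {poly {poly Cplx R}})
    (f_skew : skew_product d p q) (f_axiomA : axiomA p q) :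
  [/\ saddle_set p q = accum_pt (skew_map p q) (critical_locus p q),
      accum_pt (skew_map p q) (critical_locus p q)
        `<=` accum_cc (skew_map p q) (critical_locus p q),
      accum_cc (skew_map p q) (critical_locus p q)
        `<=` accum (skew_map p q) (critical_locus p q) &
      accum (skew_map p q) (critical_locus p q)
        = unstable_set (skew_map p q) (saddle_set p q) `&` (julia p `*` setT)].
Proof.
have [b [B [r [a [c [ce [L S]]]]]]] := setup_exists f_skew f_axiomA.
have [tau [N [tau0 N0 expN farN conN]]] := contraction_constants S.
split.
- apply/seteqP; split; first exact: (Lambda_sub_accum_pt S).
  exact: (accum_pt_sub_Lambda S tau0 N0 expN farN conN).
- exact: accum_pt_cc.
- exact: accum_cc_sub.
apply/seteqP; split.
  move=> y Ay; split; first exact: (accum_sub_unstable S tau0 N0 expN farN conN Ay).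
  by split; [exact: (accum_julia S Ay)|].
exact: (unstable_sub_accum S tau0 N0 expN farN conN).
Qed.
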